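(* Fix a prime power $q$. Let $\mathbf{1}_{\mathcal P}$ be the indicator function of the monic irreducible polynomials in $\mathbb{F}_q[t]$. Then the Dirichlet convolution $\mathbf{1}_{\mathcal P}\ast\mathbf{1}_{\mathcal P}$ satisfies the growth condition, the Siegel-Walfisz bound and the Bombieri-Vinogradov type equidistribution property.
   Context: $\mathbb{F}_q$ is the finite field with $q$ elements, and $q$ is fixed. In all sums below $f,g,h$ run over monic polynomials in $\mathbb{F}_q[t]$. An arithmetic function is a map $\psi:\mathbb{F}_q[t]\to\mathbb{C}$ (only its values on monic polynomials matter). $\tau(f)$ is the number of monic divisors of $f$, and $\phi(m)=\#(\mathbb{F}_q[t]/(m))^{*}$. The Dirichlet convolution is $\psi_1\ast\psi_2(f)=\sum_{gh=f}\psi_1(g)\psi_2(h)$, over monic $g,h$ with $gh=f$. A (multiplicative) character $\chi$ modulo a non-constant polynomial $m$ is a character of $(\mathbb{F}_q[t]/(m))^{*}$, extended to $\mathbb{F}_q[t]$ by $\chi(f)=\chi(f \bmod m)$ if $(f,m)=1$ and $\chi(f)=0$ otherwise. It is principal if $\chi(f)=1$ for all $f$ with $(f,m)=1$. Its conductor is the monic $d\mid m$ of least degree such that $\chi$ is induced by a (primitive) character modulo $d$. Here $\log$ is the logarithm to base $q$. For an arithmetic function $\psi$ define: Growth condition: $\psi(f)=O(\tau(f)^{C})$ for some $C>0$. Siegel-Walfisz bound: for all sufficiently large $D>0$, for a non-principal character $\chi$ with conductor of degree $\le D\log N$, $$\sum_{\deg(f)=N}\psi(f)\chi(f)=O\left(\frac{q^N}{N^{3D}}\right),$$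 with implied constant independent of $N$ and $\chi$. Bombieri-Vinogradov type equidistribution property: for $m,l\in\mathbb{F}_q[t]$ with $m$ monic and $(m,l)=1$, let $$E(M;m,l;\psi)=\sum_{\substack{f\equiv l\ (\mathrm{mod}\ m)\\ \deg(f)=M}}\psi(f)-\frac{1}{\phi(m)}\sum_{\substack{(f,m)=1\\ \deg(f)=M}}\psi(f).$$ Then for any $A>0$ there exists $B=B(A)>0$ such that $$\sum_{\deg(m)\le \frac N2-B\log N}\ \max_{M\le N}\ \max_{(m,l)=1}|E(M;m,l;\psi)|\ll_A\frac{q^N}{N^A},$$ the outer sum being over monic $m$.
   Formalization: In the Siegel-Walfisz bound the implied constant is uniform only over moduli m with deg(m) ≤ N^E (E arbitrary, constant depending on D and E); uniformity over all imprimitive characters of small conductor, as literally stated, is false. *)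

(* Defs.v *)
From mathcomp Require Import all_boot all_order all_algebra.
From mathcomp Require Import classical_sets reals exp numfun.
From mathcomp Require Export complex.

Set Implicit Arguments.
Unset Strict Implicit.
Unset Printing Implicit Defensive.

Import Order.TTheory GRing.Theory Num.Theory.
Local Open Scope ring_scope.
Local Open Scope complex_scope.

(* The degree of a nonzero polynomial; [deg 0 = 0] is a junk value. *)
Definition deg (F : finFieldType) (f : {poly F}) : nat := (size f).-1.

Definition monics (F : finFieldType) (N : nat) : {set {poly_N.+1 F}} :=
  [set f : {poly_N.+1 F} | (val f \is monic) && (size (val f) == N.+1)].

(* The residue classes modulo [m <> 0] are represented by the polynomials of
   degree [< deg m].  The library's [{poly %/ m}] is not used because it is
   [F[t]/(m)] only when [m] is monic and not constant, whereas [m = 1] occurs as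
   a modulus in the Bombieri-Vinogradov sum and characters may have a
   non-monic modulus. *)
Definition residue_units (F : finFieldType) (m : {poly F}) :
    {set {poly_(deg m) F}} :=
  [set r : {poly_(deg m) F} |
    [exists s : {poly_(deg m) F}, (val r * val s) %% m == 1 %% m]].

Definition phi (F : finFieldType) (m : {poly F}) : nat := #|residue_units m|.

Lemma mem_residue_units (F : finFieldType) (m : {poly F})
    (r : {poly_(deg m) F}) :
  m != 0 -> (r \in residue_units m) = coprimep (val r) m.
Proof.
move=> m0; rewrite inE; apply/existsP/idP => [[s /eqP rs]|].
  have /dvdpP[k kE] : m %| val r * val s - 1.
    by rewrite /dvdp modpD modpN rs subrr.
  apply/Bezout_coprimepP; exists (val s, - k) => /=.
  suff -> : val s * val r + - k * m = 1 by rewrite eqpxx.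
  by rewrite mulNr -kE mulrC opprB addrC subrK.
move=> /Bezout_eq1_coprimepP[[u v] /= uv].
have us : (size (u %% m)%R <= deg m)%N.
  have : (size (u %% m)%R < size m)%N by rewrite ltn_modp.
  by rewrite /deg; case: (size m).
exists (NPoly us); rewrite /= modp_mul mulrC -uv modpD modp_mull addr0.
by rewrite eqxx.
Qed.

Definition tau (F : finFieldType) (f : {poly F}) : nat :=
  #|[set g : {poly_(size f) F} | (val g \is monic) && (val g %| f)]|.

Definition dirichlet_conv (R : realType) (F : finFieldType)
    (psi1 psi2 : {poly F} -> R[i]) (f : {poly F}) : R[i] :=
  \sum_(gh : {poly_(size f) F} * {poly_(size f) F} |
      [&& val gh.1 \is monic, val gh.2 \is monic &
          val gh.1 * val gh.2 == f])
    psi1 (val gh.1) * psi2 (val gh.2).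

Definition primes_poly (F : finFieldType) : set {poly F} :=
  [set f | f \is monic /\ irreducible_poly f]%classic.
Arguments primes_poly F : clear implicits.

Definition ind_primes (R : realType) (F : finFieldType) : {poly F} -> R[i] :=
  indic (primes_poly F).
Arguments ind_primes R F : clear implicits.

Definition logq (R : realType) (F : finFieldType) (x : R) : R :=
  ln x / ln #|F|%:R.

Definition cabs (R : realType) (z : R[i]) : R := ComplexField.Normc.normc z.

Definition growth_condition (R : realType) (F : finFieldType)
    (psi : {poly F} -> R[i]) : Prop :=
  exists2 C : R, 0 < C &
  exists2 K : R, 0 < K &
    forall f : {poly F}, f \is monic -> cabs (psi f) <= K * (tau f)%:R `^ C.

(* Only the values of [lam] on [residue_units m] matter; they are nonzero
   because [lam] maps 1 to 1. *)
Definition residue_character (R : realType) (F : finFieldType) (m : {poly F})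
    (lam : {poly F} -> R[i]) : Prop :=
  lam (1 %% m) = 1 /\
  {in residue_units m &, forall a b : {poly_(deg m) F},
    lam ((val a * val b) %% m) = lam (val a) * lam (val b)}.

Definition is_character (R : realType) (F : finFieldType) (m : {poly F})
    (chi : {poly F} -> R[i]) : Prop :=
  exists2 lam : {poly F} -> R[i], residue_character m lam &
    forall f : {poly F}, chi f = if coprimep f m then lam (f %% m) else 0.

Definition principal (R : realType) (F : finFieldType) (m : {poly F})
    (chi : {poly F} -> R[i]) : Prop :=
  forall f : {poly F}, coprimep f m -> chi f = 1.

Definition induced_from (R : realType) (F : finFieldType) (m : {poly F})
    (chi : {poly F} -> R[i]) (d : {poly F}) : Prop :=
  exists2 chi' : {poly F} -> R[i], is_character d chi' &
    forall f : {poly F}, coprimep f m -> chi f = chi' f.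

(* By minimality of the degree, the character modulo [d] that induces [chi] is
   automatically primitive. *)
Definition is_conductor (R : realType) (F : finFieldType) (m : {poly F})
    (chi : {poly F} -> R[i]) (d : {poly F}) : Prop :=
  [/\ d \is monic, d %| m, induced_from m chi d &
      forall d' : {poly F}, d' \is monic -> d' %| m -> induced_from m chi d' ->
        (deg d <= deg d')%N].

(* The modulus [m] of [chi] may be larger than its conductor [d].  The implied
   constant [K] depends on [D] but not on [N], [m] or [chi], uniformly for
   [deg m <= N ^ E] with [E] arbitrary.  Every pair of [N] and a non-principal
   [chi] with [deg d <= D log N] is covered by some [E], and some [E] covers all
   pairs with [deg m <= D log N] (hence all primitive [chi]) at once.
   Uniformity over all [m] with a given conductor is impossible in general, in
   particular for the convolution square of the prime indicator: for a fixed
   non-principal [chi'] modulo [d], let [m] be the product of [d] and all the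
   primes [p] of degree at most [N] with [chi' p <> 1]; then [chi p] is 0 or 1
   for every prime [p] of degree at most [N], and there is no cancellation. *)
Definition siegel_walfisz (R : realType) (F : finFieldType)
    (psi : {poly F} -> R[i]) : Prop :=
  exists2 D0 : R, 0 < D0 &
  forall D : R, D0 <= D ->
  forall E : nat,
  exists2 K : R, 0 < K &
    forall (N : nat) (m : {poly F}) (chi : {poly F} -> R[i]) (d : {poly F}),
      (0 < N)%N -> (0 < deg m <= N ^ E)%N ->
      is_character m chi -> ~ principal m chi ->
      is_conductor m chi d -> (deg d)%:R <= D * logq F N%:R ->
      cabs (\sum_(f in monics F N) psi (val f) * chi (val f))
        <= K * (#|F|%:R ^+ N / N%:R `^ (3%:R * D)).

Definition progression_error (R : realType) (F : finFieldType)
    (psi : {poly F} -> R[i]) (M : nat) (m l : {poly F}) : R[i] :=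
  \sum_(f in monics F M | m %| val f - l) psi (val f)
  - (phi m)%:R^-1 * \sum_(f in monics F M | coprimep (val f) m) psi (val f).

(* [progression_error psi M m l] depends on [l] only modulo [m], so the maximum
   over [l] is taken over representatives of the residue classes.  All the
   quantities are nonnegative, so 0 is a neutral starting value. *)
Definition max_progression_error (R : realType) (F : finFieldType)
    (psi : {poly F} -> R[i]) (N : nat) (m : {poly F}) : R :=
  \big[Num.max/0]_(M < N.+1)
    \big[Num.max/0]_(l : {poly_(deg m) F} | coprimep m (val l))
      cabs (progression_error psi M m (val l)).

Definition bombieri_vinogradov (R : realType) (F : finFieldType)
    (psi : {poly F} -> R[i]) : Prop :=
  forall A : R, 0 < A ->
  exists2 B : R, 0 < B &
  exists2 K : R, 0 < K &
    forall N : nat, (0 < N)%N ->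
      \sum_(k < N.+1 | k%:R <= N%:R / 2%:R - B * logq F N%:R)
        \sum_(m in monics F k) max_progression_error psi N (val m)
      <= K * (#|F|%:R ^+ N / N%:R `^ A).

(* Main.v *)
Require Import Defs.
From HB Require Import structures.
From mathcomp Require Import all_boot all_order all_fingroup all_algebra all_field.
From mathcomp Require Import numfun reals exp boolp complex mxred zify ring lra.

Set Implicit Arguments.
Unset Strict Implicit.
Unset Printing Implicit Defensive.

Import Order.TTheory GRing.Theory Num.Theory.
Local Open Scope ring_scope.
Local Open Scope complex_scope.

(* A power saving for character sums implies everything.  As [psi] is a convolution
   square and [chi] is completely multiplicative, the sum of [psi chi] in degree [N]
   is the convolution square of the sums of [chi] over the primes.  By the Riemann
   hypothesis for the L-function of [chi] these are [O((deg m + N^2) q^(N/2))], so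
   that the sum of [psi chi] is [O(N (deg m + N^2)^2 q^(N/2))] for all
   non-principal [chi] modulo [m].  This is stronger than the Siegel-Walfisz bound;
   with the orthogonality of characters, it bounds [E(M; m, l; psi)] individually,
   and summing over the [m] of degree at most [N/2 - B log N] gives the
   Bombieri-Vinogradov property.

   The Riemann hypothesis is proved with Stepanov's method in Bombieri's form, on an
   explicit abelian cover of the affine line.  Let [T] be the matrix of
   multiplication by [t] on [F[t]/(m)], and consider the pairs [(x, g)], [g] a
   matrix, with [g^(q) = g (T - x)], where [g^(q)] is the entrywise [q]-th power.
   If [x^(q^N) = x], then the [q^N]-Frobenius multiplies [g] by [f(T)], where
   [f = \prod_(i < N) (t - x^(q^i))]: the residue class of [f] modulo [m] is the
   Frobenius element at [x].  Let [H] be the stabilizer of one component of the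
   curve.  Stepanov's method shows that each class in [H] arises from at most
   [q^N / |H| + O(q^(N/2))] values of [x], and the classes outside [H] from only
   [O(1)]; as there are [q^N] values of [x], the upper bounds are nearly
   equalities, and for even [N] the sum of [chi f] over [x] is [c q^N + O(q^(N/2))] with
   [c >= 0].  On the other hand it is minus the [N]-th power sum of the inverse
   roots of the L-function, which is a polynomial, so these have absolute value at
   most [q^(1/2)]. *)

(** * Finite-dimensional spaces over a field acting on a ring through [io] *)

(** The cover is handled through expansions at one place above infinity: its coordinates are
    explicit elements of the field of fractions of power series, so the ring they generate is a
    domain and singles out one component. Whether the whole cover is irreducible is not decided;
    this is why the stabilizer [H] and a main term [c q^N] appear. The sign of [c] is what saves the
    argument: the sum of [chi] over the residue classes in [H] is 0 or a cardinality, and [c q^N]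
    stands on the same side as the power sums of the inverse roots, so it cannot cancel a large one.
    Genus and Riemann-Roch are replaced by the eventual linear growth of dimensions in a degree
    filtration. The constants obtained in this way depend on [m] without control, but they are
    harmless: a bound [O(q^(N/2))] for all large even [N], whatever its constant, fixes the size of
    the inverse roots, and uniformity in [m] comes from their number, at most [deg m]. *)

Section LinearCombinations.
Variables (k : fieldType) (L : comNzRingType) (io : {rmorphism k -> L}).

Definition lc n (c : 'rV[k]_n) (b : 'I_n -> L) : L := \sum_i io (c 0 i) * b i.

Definition indep n (b : 'I_n -> L) := forall c, lc c b = 0 -> c = 0.

(** In the applications [L] has infinite dimension over [k], so subspaces are predicates on [L], and
    the dimension is witnessed by a finite basis. Coordinates are row vectors, which turns dimension
    counts into rank computations. *)
Definition hasdim (W : L -> Prop) n :=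
  exists2 b : 'I_n -> L, indep b & forall f, W f <-> exists c, f = lc c b.

Lemma lc0 n (b : 'I_n -> L) : lc 0 b = 0.
Proof. by rewrite /lc big1 // => i _; rewrite mxE rmorph0 mul0r. Qed.

Lemma lcD n (b : 'I_n -> L) c d : lc (c + d) b = lc c b + lc d b.
Proof.
by rewrite /lc -big_split; apply: eq_bigr => i _; rewrite mxE rmorphD mulrDl.
Qed.

Lemma lcZ n (b : 'I_n -> L) a c : lc (a *: c) b = io a * lc c b.
Proof.
by rewrite /lc mulr_sumr; apply: eq_bigr => i _; rewrite mxE rmorphM mulrA.
Qed.

Lemma lcB n (b : 'I_n -> L) c d : lc (c - d) b = lc c b - lc d b.
Proof. by rewrite -scaleN1r lcD lcZ rmorphN1 mulN1r. Qed.

Lemma lc_mulr n (b : 'I_n -> L) c h : lc c b * h = lc c (fun i => b i * h).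
Proof. by rewrite /lc mulr_suml; apply: eq_bigr => i _; rewrite mulrA. Qed.

Lemma lc_delta n (b : 'I_n -> L) i : lc (delta_mx 0 i) b = b i.
Proof.
rewrite /lc (bigD1 i) //= mxE !eqxx rmorph1 mul1r big1 ?addr0 // => j ji.
by rewrite mxE (negbTE ji) andbF rmorph0 mul0r.
Qed.

Lemma lc_mulmx m n (e : 'I_m -> L) (b : 'I_n -> L) (C : 'M_(m, n)) v :
  (forall i, e i = lc (row i C) b) -> lc v e = lc (v *m C) b.
Proof.
move=> eb; rewrite /lc.
under eq_bigr do rewrite eb /lc mulr_sumr.
rewrite exchange_big; apply: eq_bigr => j _.
rewrite mxE rmorph_sum mulr_suml; apply: eq_bigr => i _.
by rewrite mxE rmorphM mulrA.
Qed.

Lemma lc_family m n (e : 'I_m -> L) (b : 'I_n -> L) :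
  (forall i, exists c, e i = lc c b) ->
  exists C : 'M_(m, n), forall i, e i = lc (row i C) b.
Proof.
move=> /fin_all_exists[c ec]; exists (\matrix_i c i) => i.
by rewrite rowK ec.
Qed.

Lemma indep_row_free m n (e : 'I_m -> L) (b : 'I_n -> L) (C : 'M_(m, n)) :
  (forall i, e i = lc (row i C) b) -> indep e -> row_free C.
Proof.
move=> eb ie; apply/inj_row_free => v vC0; apply: ie.
by rewrite (lc_mulmx v eb) vC0 lc0.
Qed.

Lemma dependent m n (e : 'I_m -> L) (b : 'I_n -> L) :
  (forall i, exists c, e i = lc c b) -> (n < m)%N ->
  exists2 c, c != 0 & lc c e = 0.
Proof.
move=> /lc_family[C eC] nm; apply: contrapT => nex.
have : row_free C.
  apply: (indep_row_free eC) => c c0; apply/eqP/negPn/negP => cn.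
  by apply: nex; exists c.
by rewrite /row_free => /eqP rC; move: (rank_leq_col C); rewrite rC leqNgt nm.
Qed.

Lemma indep_le m n (e : 'I_m -> L) (b : 'I_n -> L) :
  indep e -> (forall i, exists c, e i = lc c b) -> (m <= n)%N.
Proof.
move=> ie eb; rewrite leqNgt; apply/negP => nm.
by have [c cn /ie c0] := dependent eb nm; rewrite c0 eqxx in cn.
Qed.

Lemma hasdim_dependent W m n (e : 'I_m -> L) :
  hasdim W n -> (forall i, W (e i)) -> (n < m)%N ->
  exists2 c, c != 0 & lc c e = 0.
Proof.
by case=> b _ Wb We; apply: (@dependent _ _ _ b) => i; apply/Wb.
Qed.

Lemma hasdim_indep_le W m n (e : 'I_m -> L) :
  hasdim W n -> (forall i, W (e i)) -> indep e -> (m <= n)%N.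
Proof. by case=> b _ Wb We ie; apply: (indep_le ie) => i; apply/Wb. Qed.

Lemma hasdim_le W V m n :
  (forall f, W f -> V f) -> hasdim W m -> hasdim V n -> (m <= n)%N.
Proof.
move=> WV [e ie We] hV; apply: (hasdim_indep_le hV) ie => i; apply/WV/We.
by exists (delta_mx 0 i); rewrite lc_delta.
Qed.

Lemma hasdim_scale W n h :
  (forall f, h * f = 0 -> f = 0) -> hasdim W n ->
  hasdim (fun f => exists2 g, W g & f = h * g) n.
Proof.
move=> hinj [b ib Wb]; exists (fun i => b i * h).
  by move=> c; rewrite -lc_mulr mulrC => /hinj /ib.
move=> f; split=> [[g /Wb[c ->] ->]|[c ->]].
  by exists c; rewrite -lc_mulr mulrC.
by exists (lc c b); [apply/Wb; exists c | rewrite -lc_mulr mulrC].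
Qed.

Definition subsp (W : L -> Prop) :=
  [/\ W 0, forall f g, W f -> W g -> W (f + g) & forall a f, W f -> W (io a * f)].

Lemma subsp_lc W n (b : 'I_n -> L) c :
  subsp W -> (forall i, W (b i)) -> W (lc c b).
Proof. by case=> W0 WD WZ Wb; apply: (big_ind W) => // i _; apply: WZ. Qed.

(** A largest independent family inside [W] exists because its size is at most [m]; appending any
    further [f] of [W] creates a relation in which the coefficient of [f] is nonzero. *)
Lemma subsp_hasdim W m (e : 'I_m -> L) :
  subsp W -> (forall f, W f -> exists c, f = lc c e) -> exists n, hasdim W n.
Proof.
move=> sW We.
pose Q n := `[< exists2 b : 'I_n -> L, indep b & forall i, W (b i) >].
have Q0 : exists n, Q n.
  exists 0%N; apply/asboolP; exists (fun=> 0) => [c _|[]//].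
  by apply/matrixP => i [].
have Qle n : Q n -> (n <= m)%N.
  move=> /asboolP[b ib Wb]; apply: (indep_le ib (b := e)) => i.
  exact/We/Wb.
case: (ex_maxnP Q0 Qle) => n /asboolP[b ib Wb] nmax.
exists n, b => // f; split=> [Wf|[c ->]]; last exact: subsp_lc.
pose b' (i : 'I_n.+1) := oapp b f (unlift ord_max i).
have b'E c : lc c b' = lc (\row_i c 0 (lift ord_max i)) b + io (c 0 ord_max) * f.
  rewrite /lc big_ord_recr /= {2}/b' unlift_none /=; congr (_ + _).
  apply: eq_bigr => i _; rewrite mxE.
  have -> : widen_ord (leqnSn n) i = lift ord_max i.
    by apply: val_inj; rewrite /= /bump leqNgt ltn_ord.
  by rewrite /b' liftK.
have : ~~ Q n.+1 by apply/negP => /nmax; rewrite ltnn.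
move=> /asboolPn nQ.
have [c cn c0] : exists2 c, c != 0 & lc c b' = 0.
  apply: contrapT => nex; apply: nQ; exists b'; last first.
    by move=> i; rewrite /b'; case: (unlift ord_max i).
  move=> c c0; apply/eqP/negPn/negP => cn; apply: nex; exists c => //.
rewrite b'E in c0.
have cm : c 0 ord_max != 0.
  apply: contraNneq cn => cm0; move: c0; rewrite cm0 rmorph0 mul0r addr0.
  move=> /ib c0; apply/eqP/rowP => i; rewrite [RHS]mxE.
  case: (unliftP ord_max i) => [j ->|->] //.
  by move/rowP/(_ j): c0; rewrite !mxE.
exists (- (c 0 ord_max)^-1 *: \row_i c 0 (lift ord_max i)).
rewrite lcZ (_ : lc _ b = - (io (c 0 ord_max) * f)); last first.
  by apply/eqP; rewrite -addr_eq0; apply/eqP.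
by rewrite rmorphN mulrNN mulrA -rmorphM mulVf // rmorph1 mul1r.
Qed.

Lemma sub_hasdim W V n :
  subsp W -> (forall f, W f -> V f) -> hasdim V n -> exists m, hasdim W m.
Proof.
move=> sW WV [b _ Vb]; apply: (@subsp_hasdim _ n b) => // f /WV.
by move/Vb.
Qed.

Lemma hasdim_sub_eq W V m n : (forall f, W f -> V f) ->
  hasdim W m -> hasdim V n -> (n <= m)%N -> forall f, V f -> W f.
Proof.
move=> WV [e ie We] [b ib Vb] nm f /Vb[c ->].
have [C eC] : exists C : 'M_(m, n), forall i, e i = lc (row i C) b.
  by apply: lc_family => i; apply/Vb/WV/We; exists (delta_mx 0 i); rewrite lc_delta.
have /eqP rC := indep_row_free eC ie.
have : row_full C by rewrite /row_full eqn_leq rank_leq_col rC.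
move=> /row_fullP[B BC]; apply/We; exists (c *m B).
by rewrite (lc_mulmx _ eC) -mulmxA BC mulmx1.
Qed.

(** In coordinates on [S], this is the rank formula for a sum and an intersection of row spaces,
    with [U + V = S] and [D] inside the intersection. *)
Lemma hasdim_submod S U V D s u v t :
  hasdim S s -> hasdim U u -> hasdim V v -> hasdim D t ->
  (forall f, U f -> S f) -> (forall f, V f -> S f) ->
  (forall f, S f -> exists g h, [/\ U g, V h & f = g + h]) ->
  (forall f, D f -> U f /\ V f) ->
  (s + t <= u + v)%N.
Proof.
move=> [b ib Sb] [bU iU Ub] [bV iV Vb] [bD iD Db] US VS SUV DUV.
have inb n (e : 'I_n -> L) i : e i = lc (delta_mx 0 i) e by rewrite lc_delta.
have [MU eU] : exists C : 'M_(u, s), forall i, bU i = lc (row i C) b.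
  by apply: lc_family => i; apply/Sb/US/Ub; exists (delta_mx 0 i).
have [MV eV] : exists C : 'M_(v, s), forall i, bV i = lc (row i C) b.
  by apply: lc_family => i; apply/Sb/VS/Vb; exists (delta_mx 0 i).
have [MD eD] : exists C : 'M_(t, s), forall i, bD i = lc (row i C) b.
  apply: lc_family => i; apply/Sb/US; apply: (proj1 (DUV _ _)).
  by apply/Db; exists (delta_mx 0 i).
have DU : forall f, D f -> exists c, f = lc c bU by move=> f /DUV[/Ub].
have DV : forall f, D f -> exists c, f = lc c bV by move=> f /DUV[_ /Vb].
have bi : injective (fun c => lc c b).
  by move=> c d /= cd; apply/eqP; rewrite -subr_eq0; apply/eqP/ib; rewrite lcB cd subrr.
have sub1 n (M : 'M_(n, s)) (e : 'I_n -> L) c d :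
    (forall i, e i = lc (row i M) b) -> lc c b = lc d e -> (c <= M)%MS.
  by move=> eM; rewrite (lc_mulmx d eM) => /bi ->; rewrite submxMl.
have rD : \rank MD = t by apply/eqP; exact: (indep_row_free eD iD).
have rU : \rank MU = u by apply/eqP; exact: (indep_row_free eU iU).
have rV : \rank MV = v by apply/eqP; exact: (indep_row_free eV iV).
have capD : (MD <= MU :&: MV)%MS.
  apply/row_subP => i; rewrite sub_capmx.
  have Di : D (bD i) by apply/Db; exists (delta_mx 0 i).
  have [[c ec] [d ed]] := (DU _ Di, DV _ Di).
  by apply/andP; split; [apply: (sub1 _ _ _ _ c eU)|apply: (sub1 _ _ _ _ d eV)];
    rewrite -eD.
have sumS : ((1%:M : 'M_s) <= MU + MV)%MS.
  apply/row_subP => i.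
  have Si : S (b i) by apply/Sb; exists (delta_mx 0 i).
  have [g [h [/Ub[c gc] /Vb[d hd] bgh]]] := SUV _ Si.
  have -> : row i 1%:M = c *m MU + d *m MV.
    apply: bi; rewrite row1 lc_delta bgh gc hd lcD.
    by rewrite -(lc_mulmx _ eU) -(lc_mulmx _ eV).
  by rewrite addmx_sub_adds // submxMl.
have := mxrank_sum_cap MU MV; rewrite rU rV => <-.
have := mxrankS capD; have := mxrankS sumS; rewrite mxrank1 rD => h1 h2.
exact: leq_add.
Qed.

(* [val f v] stands for: [f] takes the values [v] at [s] given points, or has the
   first [s] Laurent coefficients [v] at a given place. *)
Lemma hasdim_eval_le W n s m (val : L -> 'rV[k]_s -> Prop) (e : 'I_m -> L)
    (h : 'I_s -> L) (Hm : 'M[k]_s) :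
  hasdim W n -> indep e -> (forall i, W (e i)) -> (forall i, W (h i)) ->
  (forall f, W f -> exists v, val f v) ->
  (forall a f g v w, val f v -> val g w -> val (io a * f + g) (a *: v + w)) ->
  (forall v, val 0 v -> v = 0) ->
  (forall i, val (e i) 0) -> (forall i, val (h i) (row i Hm)) ->
  Hm \in unitmx -> (m + s <= n)%N.
Proof.
move=> [b ib Wb] ie We Wh exv vlin v0 ve vh uH.
have inb i : W (b i) by apply/Wb; exists (delta_mx 0 i); rewrite lc_delta.
have val00 : val 0 0.
  have [v fv] := exv _ (proj2 (Wb 0) (ex_intro _ 0 (esym (lc0 b)))).
  by rewrite -(v0 _ fv).
have [e' eE] : exists E : 'M_(n, s), forall i, val (b i) (row i E).
  have /fin_all_exists[E HE] : forall i, exists v, val (b i) v.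
    by move=> i; apply: exv.
  by exists (\matrix_i E i) => i; rewrite rowK.
have vallc c : val (lc c b) (c *m e').
  rewrite mulmx_sum_row /lc; elim/big_ind2: _ => // [x1 x2 y1 y2 h1 h2|i _].
    by have := vlin 1 _ _ _ _ h1 h2; rewrite rmorph1 mul1r scale1r.
  by have := vlin (c 0 i) _ _ _ _ (eE i) val00; rewrite !addr0.
have valu f v w : val f v -> val f w -> v = w.
  move=> fv fw; have := vlin (-1) _ _ _ _ fv fw.
  rewrite rmorphN1 mulN1r addNr scaleN1r => /v0 /eqP.
  by rewrite addrC subr_eq0 => /eqP.
have [C eC] := lc_family (fun i => (proj1 (Wb _) (We i))).
have [G hG] := lc_family (fun i => (proj1 (Wb _) (Wh i))).
have CE : C *m e' = 0.
  apply/row_matrixP => i; rewrite row_mul row0.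
  by apply: (valu (e i)) (ve i); rewrite eC.
have GE : G *m e' = Hm.
  apply/row_matrixP => i; rewrite row_mul.
  by apply: (valu (h i)) (vh i); rewrite hG.
have rC : \rank C = m by apply/eqP; exact: (indep_row_free eC ie).
have rE : (s <= \rank e')%N.
  by have := mxrankM_maxr G e'; rewrite GE mxrank_unit.
by have := mulmx0_rank_max CE; rewrite rC => h1; apply: leq_trans h1; rewrite leq_add2l.
Qed.

End LinearCombinations.

(** * Formal power series *)

Definition pser (k : fieldType) : Type := nat -> k.

Section PowerSeries.
Variable k : fieldType.
Local Notation S := (pser k).
Implicit Types f g h : S.

HB.instance Definition _ := Choice.copy S (nat -> k).

Definition ps_add f g : S := fun n => f n + g n.
Definition ps_opp f : S := fun n => - f n.
Definition ps_mul f g : S := fun n => \sum_(i < n.+1) f i * g (n - i)%N.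
Definition psC (c : k) : S := fun n => if n == 0%N then c else 0.
Definition psX : S := fun n => (n == 1%N)%:R.

Fact ps_addA : associative ps_add.
Proof. by move=> f g h; apply: funext => n; rewrite /ps_add addrA. Qed.
Fact ps_addC : commutative ps_add.
Proof. by move=> f g; apply: funext => n; rewrite /ps_add addrC. Qed.
Fact ps_add0 : left_id (psC 0) ps_add.
Proof. by move=> f; apply: funext => n; rewrite /ps_add /psC if_same add0r. Qed.
Fact ps_addN : left_inverse (psC 0) ps_opp ps_add.
Proof.
by move=> f; apply: funext => n; rewrite /ps_add /ps_opp /psC if_same addNr.
Qed.

HB.instance Definition _ := GRing.isZmodule.Build S ps_addA ps_addC ps_add0 ps_addN.

Definition ps_trunc N f : {poly k} := \poly_(i < N) f i.

(** A coefficient of a product only involves truncations of the factors, so the ring laws can be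
    read off from polynomials. *)
Lemma ps_mul_trunc N f g n :
  (n < N)%N -> ps_mul f g n = (ps_trunc N f * ps_trunc N g)`_n.
Proof.
move=> nN; rewrite coefM; apply: eq_bigr => i _; rewrite !coef_poly.
by rewrite (leq_trans (ltn_ord i) nN) (leq_ltn_trans (leq_subr i n) nN).
Qed.

Lemma ps_trunc_mul N f g n :
  (n < N)%N -> (ps_trunc N (ps_mul f g))`_n = (ps_trunc N f * ps_trunc N g)`_n.
Proof. by move=> nN; rewrite coef_poly nN; apply: ps_mul_trunc. Qed.

Fact ps_mulC : commutative ps_mul.
Proof.
move=> f g; apply: funext => n.
by rewrite !(@ps_mul_trunc n.+1) // mulrC.
Qed.
Fact ps_mulA : associative ps_mul.
Proof.
move=> f g h; apply: funext => n; rewrite !(@ps_mul_trunc n.+1) //.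
transitivity ((ps_trunc n.+1 f * (ps_trunc n.+1 g * ps_trunc n.+1 h))`_n).
  rewrite !coefM; apply: eq_bigr => i _; congr (_ * _).
  by rewrite ps_trunc_mul // ltnS leq_subr.
rewrite mulrA !coefM; apply: eq_bigr => i _; congr (_ * _).
by rewrite ps_trunc_mul.
Qed.
Fact ps_mul1 : left_id (psC 1) ps_mul.
Proof.
move=> f; apply: funext => n; rewrite /ps_mul big_ord_recl subn0 /psC eqxx mul1r.
by rewrite big1 ?addr0 // => i _; rewrite mul0r.
Qed.
Fact ps_mulD : left_distributive ps_mul ps_add.
Proof.
move=> f g h; apply: funext => n; rewrite /ps_mul /ps_add -big_split.
by apply: eq_bigr => i _; rewrite mulrDl.
Qed.
Fact ps_1neq0 : psC 1 != psC 0 :> S.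
Proof. by apply/eqP => /(congr1 (fun f : S => f 0%N)) /eqP; rewrite oner_eq0. Qed.

HB.instance Definition _ :=
  GRing.Zmodule_isComNzRing.Build S ps_mulA ps_mulC ps_mul1 ps_mulD ps_1neq0.

Lemma psM f g n : (f * g) n = \sum_(i < n.+1) f i * g (n - i)%N.
Proof. by []. Qed.
Lemma psD f g n : (f + g) n = f n + g n. Proof. by []. Qed.
Lemma psN f n : (- f) n = - f n. Proof. by []. Qed.
Lemma ps0 n : (0 : S) n = 0. Proof. by rewrite /GRing.zero /= /psC if_same. Qed.

Lemma psM0 f g : (f * g) 0%N = f 0%N * g 0%N.
Proof. by rewrite psM big_ord1. Qed.

Fact psC_is_additive : zmod_morphism psC.
Proof.
move=> a b; apply: funext => n; rewrite psD psN /psC.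
by case: eqP; rewrite ?subrr.
Qed.
Fact psC_is_multiplicative : monoid_morphism psC.
Proof.
split=> // a b; apply: funext => n; rewrite psM big_ord_recl subn0 /psC eqxx.
rewrite big1 ?addr0 => [|i _]; last by rewrite mul0r.
by case: eqP => _; rewrite ?mulr0.
Qed.
HB.instance Definition _ := GRing.isZmodMorphism.Build k S psC psC_is_additive.
HB.instance Definition _ := GRing.isMonoidMorphism.Build k S psC psC_is_multiplicative.

Lemma psCM a f n : (psC a * f) n = a * f n.
Proof.
rewrite psM big_ord_recl subn0 big1 ?addr0 => [|i _]; last by rewrite mul0r.
by [].
Qed.

Lemma psXM f n : (psX * f) n = if n is n'.+1 then f n' else 0.
Proof.
case: n => [|n]; first by rewrite psM0 /psX mul0r.
rewrite psM 2!big_ord_recl /= {1 2}/psX mul0r add0r /= mul1r subSS subn0.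
by rewrite big1 ?addr0 // => i _; rewrite /psX mul0r.
Qed.

Lemma psXnM f m n : (psX ^+ m * f) n = if (m <= n)%N then f (n - m)%N else 0.
Proof.
elim: m n => [|m IH] n; first by rewrite expr0 mul1r subn0.
by rewrite exprS -mulrA psXM; case: n => [|n] //; rewrite IH.
Qed.

Lemma ps_divXn f m : (forall n, (n < m)%N -> f n = 0) -> exists g, f = psX ^+ m * g.
Proof.
move=> f0; exists (fun n => f (n + m)%N); apply: funext => n.
by rewrite psXnM; case: leqP => h; [rewrite subnK | rewrite f0].
Qed.

Lemma ps_divX f : f 0%N = 0 -> exists g, f = psX * g.
Proof. by move=> f0; apply: (@ps_divXn f 1%N) => -[]. Qed.

Lemma ps_dec f : exists g, f = psC (f 0%N) + psX * g.
Proof.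
have [g fg] : exists g, f - psC (f 0%N) = psX * g by apply: ps_divX; rewrite psD psN subrr.
by exists g; rewrite -fg addrC subrK.
Qed.

Lemma ps_neq0 f : f != 0 -> exists n g, f = psX ^+ n * g /\ g 0%N != 0.
Proof.
move=> fn; have fnn : exists n, f n != 0.
  apply: contrapT => nex; case/eqP: fn; apply: funext => n; rewrite ps0.
  by apply/eqP/negPn/negP => h; apply: nex; exists n.
case: (ex_minnP fnn) => m fm mmin.
have [g fg] : exists g, f = psX ^+ m * g.
  apply: ps_divXn => i; rewrite ltnNge => im; apply/eqP/negPn/negP => h.
  by rewrite mmin in im.
exists m, g; split=> //.
by move: fm; rewrite fg psXnM leqnn subnn.
Qed.

Lemma psX_neq0 : psX != 0.
Proof. by apply/eqP => /(congr1 (fun f : S => f 1%N)) /eqP; rewrite ps0 /psX oner_eq0. Qed.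

Lemma psXn_inj n f : psX ^+ n * f = 0 -> f = 0.
Proof.
move=> h; apply: funext => i; rewrite ps0.
by have := congr1 (fun g : S => g (i + n)%N) h; rewrite /= psXnM leq_addl addnK ps0.
Qed.

Fact ps_integral f g : f * g = 0 -> (f == 0) || (g == 0).
Proof.
move=> fg0; apply/orP; case: (eqVneq f 0) => [_|fn]; [by left|right].
apply/negPn/negP => gn.
have [n [f' [fE f0]]] := ps_neq0 fn; have [m [g' [gE g0]]] := ps_neq0 gn.
have : psX ^+ (n + m) * (f' * g') = 0 by rewrite exprD mulrACA -fE -gE.
move/psXn_inj => /(congr1 (fun f : S => f 0%N)) /eqP.
by rewrite psM0 ps0 mulf_eq0 (negbTE f0) (negbTE g0).
Qed.

Definition ps_unit : pred S := fun f => `[< exists g, g * f = 1 >].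
Definition ps_inv f : S := if pselect (exists g, g * f = 1) is left e then projT1 (cid e) else f.

Fact ps_mulVr : {in ps_unit, left_inverse 1 ps_inv *%R}.
Proof.
move=> f /asboolP uf; rewrite /ps_inv; case: pselect => // e.
by case: (cid e).
Qed.
Fact ps_unitPl f g : g * f = 1 -> ps_unit f.
Proof. by move=> gf; apply/asboolP; exists g. Qed.
Fact ps_inv_out : {in [predC ps_unit], ps_inv =1 id}.
Proof. by move=> f /asboolPn nu; rewrite /ps_inv; case: pselect. Qed.

HB.instance Definition _ :=
  GRing.ComNzRing_hasMulInverse.Build S ps_mulVr ps_unitPl ps_inv_out.
HB.instance Definition _ := GRing.ComUnitRing_isIntegral.Build S ps_integral.

End PowerSeries.

Section MapPowerSeries.
Variables (k k' : fieldType) (th : {rmorphism k -> k'}).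

Definition ps_map (f : pser k) : pser k' := fun n => th (f n).

Fact ps_map_is_additive : zmod_morphism ps_map.
Proof. by move=> f g; apply: funext => n; rewrite /ps_map psD psN rmorphB. Qed.
Fact ps_map_is_multiplicative : monoid_morphism ps_map.
Proof.
split=> [|f g]; apply: funext => n.
  by rewrite /ps_map /GRing.one /= /psC; case: eqP; rewrite ?rmorph1 ?rmorph0.
by rewrite /ps_map !psM rmorph_sum; apply: eq_bigr => i _; rewrite rmorphM.
Qed.
HB.instance Definition _ := GRing.isZmodMorphism.Build _ _ ps_map ps_map_is_additive.
HB.instance Definition _ := GRing.isMonoidMorphism.Build _ _ ps_map ps_map_is_multiplicative.

Lemma ps_mapX : ps_map (psX k) = psX k'.
Proof. by apply: funext => n; rewrite /ps_map /psX rmorph_nat. Qed.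

Lemma ps_mapC c : ps_map (psC c) = psC (th c).
Proof. by apply: funext => n; rewrite /ps_map /psC; case: eqP; rewrite ?rmorph0. Qed.

Lemma ps_map_eq0 f : ps_map f = 0 -> f = 0.
Proof.
move=> h; apply: funext => n; rewrite ps0; apply/eqP; rewrite -(fmorph_eq0 th).
by move/(congr1 (fun f : pser k' => f n)): h; rewrite ps0 => <-.
Qed.
End MapPowerSeries.

(** * The affine curve [U^(w+1) = U (T - X)] and its filtered coordinate ring *)

Section Curve.
Variables (k : closedFieldType) (L : fieldType) (io : {rmorphism k -> L}).
Variables (n w : nat) (T : 'M[k]_n) (X : L) (U : 'M[L]_n).

Definition point := (k * 'M[k]_n)%type.

(* [Pol d f phi]: some polynomial of weighted degree at most [d], where [X] has
   weight [w] and each [U i j] weight 1, takes the value [f] at the generic point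
   [(X, U)] and [phi P] at every point [P].  Thus [funA d] is the degree filtration
   of the coordinate ring, and [onC0] is the Zariski closure of the generic point:
   one component of the curve. *)
Inductive Pol : nat -> L -> (point -> k) -> Prop :=
| Pol_C c : Pol 0 (io c) (fun=> c)
| Pol_X d f phi : Pol d f phi -> Pol (d + w) (X * f) (fun P => P.1 * phi P)
| Pol_U d f phi i j : Pol d f phi -> Pol d.+1 (U i j * f) (fun P => P.2 i j * phi P)
| Pol_D d f g phi psi :
    Pol d f phi -> Pol d g psi -> Pol d (f + g) (fun P => phi P + psi P)
| Pol_le d d' f phi : (d <= d')%N -> Pol d f phi -> Pol d' f phi.

Lemma Pol_eq d d' f f' phi phi' :
  Pol d f phi -> (d <= d')%N -> f = f' -> phi =1 phi' -> Pol d' f' phi'.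
Proof. by move=> h dd' <- /funext <-; apply: Pol_le h. Qed.

Lemma Pol_Z c d f phi : Pol d f phi -> Pol d (io c * f) (fun P => c * phi P).
Proof.
elim=> {d f phi}.
- by move=> c'; apply: (Pol_eq (Pol_C (c * c'))); rewrite ?rmorphM.
- move=> d f phi _ IH; apply: (Pol_eq (Pol_X IH)) => // [|P].
    by rewrite mulrCA.
  by rewrite mulrCA.
- move=> d f phi i j _ IH; apply: (Pol_eq (Pol_U i j IH)) => // [|P].
    by rewrite mulrCA.
  by rewrite mulrCA.
- move=> d f g phi psi _ IH1 _ IH2; apply: (Pol_eq (Pol_D IH1 IH2)) => // [|P].
    by rewrite mulrDr.
  by rewrite mulrDr.
by move=> d d' f phi dd' _ IH; apply: Pol_le IH.
Qed.

Lemma Pol_const c d : Pol d (io c) (fun=> c).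
Proof. by apply: Pol_le (Pol_C c). Qed.

Lemma Pol_M d e f g phi psi :
  Pol d f phi -> Pol e g psi -> Pol (d + e) (f * g) (fun P => phi P * psi P).
Proof.
move=> hf hg; elim: hf => {d f phi}.
- by move=> c; apply: Pol_Z.
- move=> d f phi _ IH; apply: (Pol_eq (Pol_X IH)) => [||P]; first by lia.
    by rewrite mulrA.
  by rewrite mulrA.
- move=> d f phi i j _ IH; apply: (Pol_eq (Pol_U i j IH)) => // [|P].
    by rewrite mulrA.
  by rewrite mulrA.
- move=> d f f' phi phi' _ IH1 _ IH2; apply: (Pol_eq (Pol_D IH1 IH2)) => // [|P].
    by rewrite mulrDl.
  by rewrite mulrDl.
by move=> d d' f phi dd' _ IH; apply: Pol_le IH; rewrite leq_add2r.
Qed.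

Lemma Pol_B d f g phi psi :
  Pol d f phi -> Pol d g psi -> Pol d (f - g) (fun P => phi P - psi P).
Proof.
move=> hf /(Pol_Z (-1)) hg; apply: (Pol_eq (Pol_D hf hg)) => // [|P].
  by rewrite rmorphN1 mulN1r.
by rewrite mulN1r.
Qed.

Lemma Pol_exp d f phi m :
  Pol d f phi -> Pol (m * d) (f ^+ m) (fun P => phi P ^+ m).
Proof.
move=> h; elim: m => [|m IH].
  by apply: (Pol_eq (Pol_C 1)); rewrite ?rmorph1.
by apply: (Pol_eq (Pol_M h IH)) => // [|P]; rewrite exprS.
Qed.

Lemma Pol_sum (J : Type) (r : seq J) d (f : J -> L) (phi : J -> point -> k) :
  (forall i, Pol d (f i) (phi i)) ->
  Pol d (\sum_(i <- r) f i) (fun P => \sum_(i <- r) phi i P).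
Proof.
move=> h; elim: r => [|i r IH].
  by apply: (Pol_eq (Pol_const 0 d)) => // [|P]; rewrite big_nil ?rmorph0.
by apply: (Pol_eq (Pol_D (h i) IH)) => // [|P]; rewrite big_cons.
Qed.

Lemma Pol_prod (J : Type) (r : seq J) d (f : J -> L) (phi : J -> point -> k) :
  (forall i, Pol d (f i) (phi i)) ->
  Pol (size r * d) (\prod_(i <- r) f i) (fun P => \prod_(i <- r) phi i P).
Proof.
move=> h; elim: r => [|i r IH].
  by apply: (Pol_eq (Pol_C 1)) => // [|P]; rewrite big_nil ?rmorph1.
by apply: (Pol_eq (Pol_M (h i) IH)) => // [|P]; rewrite big_cons.
Qed.

Lemma Pol_coordX : Pol w X fst.
Proof.
by apply: (Pol_eq (Pol_X (Pol_C 1))) => // [|P]; rewrite ?rmorph1 mulr1.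
Qed.

Lemma Pol_coordU i j : Pol 1 (U i j) (fun P => P.2 i j).
Proof.
by apply: (Pol_eq (Pol_U i j (Pol_C 1))) => // [|P]; rewrite ?rmorph1 mulr1.
Qed.

Definition funA d f := exists phi, Pol d f phi.
Definition onC0 (P : point) := forall d phi, Pol d 0 phi -> phi P = 0.

Lemma onC0_eq P d e f phi psi : onC0 P -> Pol d f phi -> Pol e f psi -> phi P = psi P.
Proof.
move=> cP hf hg; apply/eqP; rewrite -subr_eq0; apply/eqP.
apply: (cP (maxn d e) (fun P => phi P - psi P)).
rewrite -(subrr f); apply: Pol_B.
  by apply: Pol_le hf; apply: leq_maxl.
by apply: Pol_le hg; apply: leq_maxr.
Qed.

Lemma funA_le d e f : (d <= e)%N -> funA d f -> funA e f.
Proof. by move=> de [phi h]; exists phi; apply: Pol_le h. Qed.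

Lemma funA_M d e f g : funA d f -> funA e g -> funA (d + e) (f * g).
Proof. by move=> [phi h] [psi h']; eexists; apply: Pol_M h h'. Qed.

Lemma funA_D d f g : funA d f -> funA d g -> funA d (f + g).
Proof. by move=> [phi h] [psi h']; eexists; apply: Pol_D h h'. Qed.

Lemma funA_C d c : funA d (io c).
Proof. by eexists; apply: Pol_const. Qed.

Lemma funA_X : funA w X. Proof. by eexists; apply: Pol_coordX. Qed.

Lemma funA_U i j : funA 1 (U i j). Proof. by eexists; apply: Pol_coordU. Qed.

Lemma funA_exp d f m : funA d f -> funA (m * d) (f ^+ m).
Proof. by move=> [phi h]; eexists; apply: Pol_exp h. Qed.

Lemma funA_subsp d : subsp io (funA d).
Proof.
split; first by rewrite -(rmorph0 io); apply: funA_C.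
  by move=> f g; apply: funA_D.
by move=> a f [phi h]; eexists; apply: Pol_Z h.
Qed.

Hypothesis w_gt0 : (0 < w)%N.
Hypothesis UE : forall i j, U i j ^+ w.+1 = \sum_l io (T l j) * U i l - X * U i j.

Local Notation expo := {ffun 'I_n * 'I_n -> 'I_w.+1}.

Definition mon (e : expo) : L := \prod_x U x.1 x.2 ^+ e x.
Definition wt (e : expo) : nat := \sum_x e x.
Definition upd (e : expo) x (v : 'I_w.+1) : expo := [ffun y => if y == x then v else e y].

Lemma mon_upd e x v : mon (upd e x v) * U x.1 x.2 ^+ e x = mon e * U x.1 x.2 ^+ v.
Proof.
rewrite /mon (bigD1 x) //= [in RHS](bigD1 x) //= ffunE eqxx.
rewrite (eq_bigr (fun y => U y.1 y.2 ^+ e y)); last first.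
  by move=> y /negbTE yx; rewrite ffunE yx.
by rewrite mulrC mulrA [RHS]mulrC mulrA [_ ^+ e x * _]mulrC.
Qed.

Lemma mon_upd0 e x : mon e = mon (upd e x ord0) * U x.1 x.2 ^+ e x.
Proof. by rewrite mon_upd expr0 mulr1. Qed.

Lemma wt_upd e x v : (wt (upd e x v) + e x = wt e + v)%N.
Proof.
rewrite /wt (bigD1 x) //= [in RHS](bigD1 x) //= ffunE eqxx.
rewrite (eq_bigr (fun y => e y : nat)); last first.
  by move=> y /negbTE yx; rewrite ffunE yx.
by rewrite -addnA addnC; congr (_ + _)%N; apply: addnC.
Qed.

(** Span of the monomials in which every [U i j] has exponent at most [w]. The relation [UE]
    respects the weights, since [X * U i j] has weight [w.+1] like [U i j ^+ w.+1]; rewriting with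
    it never raises the weighted degree. *)
Inductive reduced d : L -> Prop :=
| red0 : reduced d 0
| redD f g : reduced d f -> reduced d g -> reduced d (f + g)
| redZ c f : reduced d f -> reduced d (io c * f)
| red_mon a e : (w * a + wt e <= d)%N -> reduced d (X ^+ a * mon e).

Lemma red_sum d (J : Type) (r : seq J) (f : J -> L) :
  (forall i, reduced d (f i)) -> reduced d (\sum_(i <- r) f i).
Proof. by move=> h; apply: (big_ind (reduced d)) => //; [apply: red0|apply: redD]. Qed.

Lemma red_opp d f : reduced d f -> reduced d (- f).
Proof. by move=> h; rewrite -mulN1r -(rmorphN1 io); apply: redZ. Qed.

Lemma red_mulX d f : reduced d f -> reduced (d + w) (X * f).
Proof.
elim=> {f} [|f g _ h1 _ h2|c f _ h|a e h].
- by rewrite mulr0; apply: red0.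
- by rewrite mulrDr; apply: redD.
- by rewrite mulrCA; apply: redZ.
by rewrite mulrA -exprS; apply: red_mon; lia.
Qed.

Lemma red_monU_lt (e : expo) i j a d : (e (i, j) < w)%N ->
  (w * a + wt e <= d)%N -> reduced d.+1 (U i j * (X ^+ a * mon e)).
Proof.
move=> ew ad.
pose v : 'I_w.+1 := inord (e (i, j)).+1.
have vE : v = (e (i, j)).+1 :> nat by rewrite inordK.
have := wt_upd e (i, j) v; rewrite vE => wE.
have me := mon_upd0 e (i, j); have := mon_upd0 (upd e (i, j) v) (i, j).
have -> : upd (upd e (i, j) v) (i, j) ord0 = upd e (i, j) ord0.
  by apply/ffunP => y; rewrite !ffunE; case: eqP.
rewrite ffunE eqxx vE exprSr mulrA -me /= => mE.
rewrite mulrC -mulrA -mE; apply: red_mon.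
by move: wE; rewrite addnS -addSn => /addIn ->; rewrite addnS ltnS.
Qed.

(** By induction on the weight of [e]: when the exponent of [U i j] would reach [w.+1], the relation
    gives terms whose remaining exponents have weight smaller by [w], the lost weight reappearing at
    most as one factor [X]. *)
Lemma red_monU s (e : expo) i j a d :
  (wt e <= s)%N -> (w * a + wt e <= d)%N -> reduced d.+1 (U i j * (X ^+ a * mon e)).
Proof.
elim: s e i j a d => [|s IH] e i j a d es ad; case: (ltnP (e (i, j)) w) => ew.
- exact: red_monU_lt.
- have := wt_upd e (i, j) ord0; rewrite addn0 => we.
  by have := leq_trans w_gt0 ew; rewrite lt0n -leqn0 (leq_trans _ es) // -we leq_addl.
- exact: red_monU_lt.
have eE : e (i, j) = w :> nat.
  by apply/eqP; rewrite eqn_leq ew andbT -ltnS ltn_ord.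
have me := mon_upd0 e (i, j); have := wt_upd e (i, j) ord0.
rewrite eE /= in me *; set e' := upd _ _ _ in me * => we.
have -> : U i j * (X ^+ a * mon e) = \sum_l io (T l j) * (U i l * (X ^+ a * mon e')) -
     U i j * (X ^+ a.+1 * mon e').
  have -> : U i j * (X ^+ a * mon e) = (X ^+ a * mon e') * U i j ^+ w.+1.
    by rewrite me exprSr; ring.
  rewrite UE mulrBr mulr_sumr; congr (_ - _); last by rewrite exprSr; ring.
  by apply: eq_bigr => l _; ring.
apply: redD.
  by apply: red_sum => l; apply: redZ; apply: IH; lia.
by apply/red_opp/IH; lia.
Qed.

Lemma red_mulU d f i j : reduced d f -> reduced d.+1 (U i j * f).
Proof.
elim=> {f} [|f g _ h1 _ h2|c f _ h|a e h].
- by rewrite mulr0; apply: red0.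
- by rewrite mulrDr; apply: redD.
- by rewrite mulrCA; apply: redZ.
exact: red_monU h.
Qed.

Lemma red_le d d' f : (d <= d')%N -> reduced d f -> reduced d' f.
Proof.
move=> dd'; elim=> {f} [|f g _ h1 _ h2|c f _ h|a e h].
- exact: red0.
- exact: redD.
- exact: redZ.
by apply: red_mon; lia.
Qed.

Lemma funA_red d f : funA d f -> reduced d f.
Proof.
case=> phi; elim=> {d f phi} [c|d f phi _|d f phi i j _|d f g phi psi _ h _|d d' f phi dd' _].
- have -> : io c = io c * (X ^+ 0 * mon [ffun=> ord0]).
    by rewrite expr0 mul1r /mon big1 ?mulr1 // => x _; rewrite ffunE expr0.
  apply/redZ/red_mon.
  by rewrite muln0 /wt big1 // => x _; rewrite ffunE.
- exact: red_mulX.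
- exact: red_mulU.
- exact: redD.
exact: red_le.
Qed.

Lemma funA_mon e : funA (wt e) (mon e).
Proof.
rewrite /wt /mon; elim/big_rec2: _ => [|x y1 y2 _ h].
  by rewrite -(rmorph1 io); apply: funA_C.
apply: funA_M h; rewrite -[X in funA X]muln1.
by apply: funA_exp; apply: funA_U.
Qed.

Lemma red_funA d f : reduced d f -> funA d f.
Proof.
have [A0 AD AZ] := funA_subsp d.
elim=> {f} [|f g _ h1 _ h2|c f _ h|a e h] //; [exact: AD|exact: AZ|].
apply: (funA_le h); apply: funA_M (funA_mon e).
by rewrite mulnC; apply/funA_exp/funA_X.
Qed.

Lemma funA_hasdim d : exists m, hasdim io (funA d) m.
Proof.
pose J := ('I_d.+1 * expo)%type.
pose g (i : 'I_#|{: J}|) := let x := enum_val i in X ^+ x.1 * mon x.2.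
apply: (subsp_hasdim (e := g)); first exact: funA_subsp.
move=> f /funA_red; elim=> {f} [|f f' _ [c ->] _ [c' ->]|c f _ [c' ->]|a e h].
- by exists 0; rewrite lc0.
- by exists (c + c'); rewrite lcD.
- by exists (c *: c'); rewrite lcZ.
have ad : (a < d.+1)%N.
  by rewrite ltnS; apply: leq_trans h; apply: leq_trans (leq_addr _ _); rewrite leq_pmull.
exists (delta_mx 0 (enum_rank (Ordinal ad, e))).
by rewrite lc_delta /g enum_rankK.
Qed.

Lemma wt_max e : (wt e <= w * (n * n))%N.
Proof.
rewrite /wt; apply: (leq_trans (n := \sum_(x : 'I_n * 'I_n) w)%N).
  by apply: leq_sum => x _; rewrite -ltnS.
by rewrite sum_nat_const card_prod card_ord mulnC.
Qed.

(** There are [n * n] exponents, each at most [w], so a reduced monomial without [X] has weight at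
    most [w * (n * n)]; all others are divisible by [X]. *)
Lemma funA_step d f : (w * (n * n) <= d)%N -> funA (d + w) f ->
  exists g h, [/\ funA d g, funA d h & f = g + X * h].
Proof.
have [A0 AD AZ] := funA_subsp d.
move=> dn /funA_red; elim=> {f} [|f f' _ [g [h [Ag Ah ->]]] _ [g' [h' [Ag' Ah' ->]]]|c f _ [g [h [Ag Ah ->]]]|a e h].
- by exists 0, 0; split; rewrite // mulr0 addr0.
- exists (g + g'), (h + h'); split; [exact: AD|exact: AD|].
  by rewrite mulrDr addrACA.
- exists (io c * g), (io c * h); split; [exact: AZ|exact: AZ|].
  by rewrite mulrDr [X * (_ * _)]mulrCA.
case: a h => [|a] h.
  exists (mon e), 0; rewrite expr0 mul1r mulr0 addr0; split => //.
  by apply: funA_le (funA_mon e); apply: leq_trans dn; apply: wt_max.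
exists 0, (X ^+ a * mon e); rewrite add0r exprS -mulrA; split => //.
by apply: red_funA; apply: red_mon; lia.
Qed.

End Curve.

(** * Growth of the filtration, zeros and poles, and Stepanov's method *)

(** The least increment after [J0] is attained at some [J]; from there on the increments can neither
    grow nor drop below it. *)
Lemma concave_eventually_linear (a : nat -> nat) J0 :
  (forall j, (J0 <= j)%N -> (a j <= a j.+1)%N) ->
  (forall j, (J0 <= j)%N -> (a j.+2 + a j <= a j.+1 + a j.+1)%N) ->
  exists J delta, (J0 <= J)%N /\ forall j, (J <= j)%N -> a j.+1 = (a j + delta)%N.
Proof.
move=> mono conc.
have ex : exists d, [pred d | `[< exists2 j, (J0 <= j)%N & a j.+1 = (a j + d)%N >]] d.
  exists (a J0.+1 - a J0)%N; apply/asboolP; exists J0 => //.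
  by rewrite subnKC // mono.
case: (ex_minnP ex) => d /asboolP[J JJ aJ] dmin; exists J, d; split=> // j.
elim: j => [|j IH] Jj; first by move: Jj aJ; rewrite leqn0 => /eqP ->.
move: Jj; rewrite leq_eqVlt => /orP[/eqP <- //|]; rewrite ltnS => Jj.
have J0j := leq_trans JJ Jj.
have h1 := IH Jj; have h2 := conc _ J0j; have h3 := mono _ (leqW J0j).
have : (d <= a j.+2 - a j.+1)%N.
  apply: dmin; apply/asboolP; exists j.+1; first exact: leqW.
  by rewrite subnKC.
lia.
Qed.

Lemma expr_pchar_sum (S : comNzRingType) p mu (J : Type) (r : seq J) (f : J -> S) :
  p \in [pchar S] ->
  (\sum_(i <- r) f i) ^+ (p ^ mu) = \sum_(i <- r) f i ^+ (p ^ mu).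
Proof.
move=> ch; have pp := pcharf_prime ch.
have pn : [pchar S].-nat (p ^ mu)%N by rewrite pnatX pnatE // ch.
elim/big_rec2: _ => [|i x y _ <-]; first by rewrite expr0n expn_eq0 -[p == 0]negbK -lt0n prime_gt0.
by rewrite exprDn_pchar.
Qed.

Lemma closed_root (k : closedFieldType) r (x : k) : (0 < r)%N -> exists y, y ^+ r = x.
Proof.
move=> r0; have [y] := solve_monicpoly (fun i => if i == 0%N then x else 0) r0.
rewrite -(prednK r0) big_ord_recl /= mulr1 big1 ?addr0 => [<-|i _]; first by exists y.
by rewrite mul0r.
Qed.

Section Growth.
Variables (k : closedFieldType) (L : fieldType) (tau : {rmorphism pser k -> L}).
Variables (n' w : nat) (T : 'M[k]_n'.+1) (u : 'M[pser k]_n'.+1).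
Hypothesis tau_inj : injective tau.
Hypothesis w_gt0 : (0 < w)%N.
Local Notation n := n'.+1.

Definition cst (c : k) : L := tau (psC c).
HB.instance Definition _ := GRing.RMorphism.copy cst (tau \o @psC k).
Local Notation io := cst.

(* Expansion at a place above [X = oo]: [Zt] is a uniformizer, [X = - Zt^-w], and
   the entries of [Ut] have simple poles there. *)
Definition Zt := tau (psX k).
Definition Xt := - Zt ^- w.
Definition Ut : 'M[L]_n := \matrix_(i, j) (Zt^-1 * tau (u i j)).
Local Notation Z := Zt.
Local Notation X := Xt.
Local Notation U := Ut.
Local Notation Pol := (@Pol k L io n w X U).
Local Notation funA := (@funA k L io n w X U).
Local Notation onC0 := (@onC0 k L io n w X U).

Hypothesis uE : forall i j,
  u i j ^+ w.+1 = u i j + psX k ^+ w * \sum_l psC (T l j) * u i l.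
Hypothesis u00 : u 0 0 0%N = 1.

Lemma Z_neq0 : Z != 0.
Proof.
by apply/eqP; rewrite -(rmorph0 tau) => /tau_inj/eqP; rewrite (negbTE (psX_neq0 k)).
Qed.

Lemma ZnV m : Z ^+ m * Z ^- m = 1.
Proof. by rewrite mulfV // expf_neq0 // Z_neq0. Qed.

Lemma UE i j : U i j ^+ w.+1 = \sum_l io (T l j) * U i l - X * U i j.
Proof.
have ZZ : Z^-1 ^+ w.+1 * Z ^+ w = Z^-1.
  by rewrite exprS -mulrA -exprMn mulVf ?Z_neq0 // expr1n mulr1.
rewrite /X mulNr opprK mxE exprMn -rmorphXn uE rmorphD rmorphM rmorph_sum rmorphXn /=.
rewrite mulrDr addrC mulrA ZZ mulr_sumr; congr (_ + _).
  by apply: eq_bigr => l _; rewrite mxE rmorphM mulrCA.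
by rewrite exprSr exprVn mulrA.
Qed.

Lemma X_neq_cst c : X != io c.
Proof.
apply/eqP => Xc; have : tau (-1) = tau (psX k ^+ w * psC c).
  rewrite rmorphN1 rmorphM rmorphXn -[tau (psC c)]/(io c) -Xc.
  by rewrite mulrN ZnV.
move/tau_inj/(congr1 (fun f : pser k => f 0%N))/eqP.
rewrite psXnM leqNgt w_gt0 psN /GRing.one /= /psC eqxx oppr_eq0.
by rewrite oner_eq0.
Qed.

(** A nonconstant element is transcendental: over the algebraically closed field [k], a polynomial
    relation splits into factors [y - io c], none of which vanishes. *)
Lemma Xexp_indep y m : (forall c, y != io c) -> indep io (fun i : 'I_m => y ^+ i).
Proof.
move=> yc c; rewrite /lc.
have -> : \sum_i io (c 0 i) * y ^+ i = (map_poly io (\sum_i c 0 i *: 'X^i)).[y].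
  rewrite rmorph_sum horner_sum; apply: eq_bigr => i _ /=.
  by rewrite map_polyZ map_polyXn hornerZ hornerXn.
move=> c0; apply/rowP => i; rewrite mxE.
set p := \sum_i _ in c0.
have [p0|pn] := eqVneq p 0.
  have : p`_i = 0 by rewrite p0 coef0.
  rewrite /p coef_sum (bigD1 i) //= coefZ coefXn eqxx mulr1 big1 ?addr0 // => l li.
  rewrite coefZ coefXn eq_sym (_ : (_ == _) = false) ?mulr0 //.
  exact: negbTE li.
have [rs pE] := closed_field_poly_normal p.
move: c0; rewrite pE map_polyZ rmorph_prod hornerZ horner_prod => /eqP.
rewrite mulf_eq0 fmorph_eq0 lead_coef_eq0 (negbTE pn) /=.
suff /negbTE -> : \prod_(c <- rs) (map_poly io ('X - c%:P)).[y] != 0 by [].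
rewrite prodf_seq_neq0; apply/allP => c' _.
by rewrite rmorphB /= map_polyX map_polyC hornerXsubC subr_eq0 yc.
Qed.

(** The weights are the pole orders of the coordinates at infinity, so the weighted degree bounds
    the pole order of every function. *)
Lemma funA_Z d f : funA d f -> exists f0, Z ^+ d * f = tau f0.
Proof.
case=> phi; elim=> {d f phi} [c|d f phi _ [f0 h]|d f phi i j _ [f0 h]|d f g phi psi _ [f0 h] _ [g0 h']|d d' f phi dd' _ [f0 h]].
- by exists (psC c); rewrite expr0 mul1r.
- exists (- f0); rewrite rmorphN -h exprD /X.
  rewrite -[RHS]mulrN -mulrA; congr (_ * _).
  by rewrite mulNr mulrN mulrA ZnV mul1r.
- exists (u i j * f0); rewrite rmorphM -h exprS mxE.
  have -> : Z * Z ^+ d * (Z^-1 * tau (u i j) * f) =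
      Z * Z^-1 * (tau (u i j) * (Z ^+ d * f)) by ring.
  by rewrite mulfV ?Z_neq0 // mul1r.
- by exists (f0 + g0); rewrite rmorphD mulrDr h h'.
by exists (psX k ^+ (d' - d) * f0); rewrite rmorphM -h rmorphXn mulrA -exprD subnK.
Qed.

Lemma funA_step_shift c d f : (w * (n * n) <= d)%N -> funA (d + w) f ->
  exists g h, [/\ funA d g, funA d h & f = g + (X - io c) * h].
Proof.
have [A0 AD AZ] := funA_subsp io w X U d.
move=> dn /(funA_step w_gt0 UE dn)[g [h [Ag Ah ->]]].
exists (g + io c * h), h; split=> //; first by apply: AD => //; apply: AZ.
by rewrite mulrBl; ring.
Qed.

Lemma funA_XsubM c d f : funA d f -> funA (d + w) ((X - io c) * f).
Proof.
have [A0 AD AZ] := funA_subsp io w X U (d + w).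
move=> h; rewrite mulrBl; apply: AD.
  by rewrite addnC; apply: funA_M (funA_X _ _ _ _) h.
rewrite -mulNr -rmorphN; apply: AZ; exact: funA_le (leq_addr _ _) h.
Qed.

(* Division by [X] makes the increments of [a] non-increasing; their limit [delta]
   plays the role of the degree of the divisor of poles, which replaces
   Riemann-Roch throughout. *)
Lemma growth : exists a J delta,
  [/\ forall j, hasdim io (funA (w * j)) (a j), (0 < delta)%N,
      (n * n <= J)%N & forall j, (J <= j)%N -> a j.+1 = (a j + delta)%N].
Proof.
have /choice[a ha] : forall j, exists m, hasdim io (funA (w * j)) m.
  by move=> j; apply: (funA_hasdim (T := T) w_gt0 UE).
have mono j : (a j <= a j.+1)%N.
  by apply: hasdim_le (ha j) (ha j.+1) => f; apply: funA_le; rewrite leq_mul2l leqnSn orbT.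
have inj0 f : X * f = 0 -> f = 0.
  move/eqP; rewrite mulf_eq0 => /orP[/eqP X0|/eqP //].
  by have := X_neq_cst 0; rewrite rmorph0 X0 eqxx.
(* With [A j] for [funA (w * j)]: [A j.+2] is the sum of [A j.+1] and [X] times [A j.+1], whose
   intersection contains [X] times [A j]. *)
have conc j : (n * n <= j)%N -> (a j.+2 + a j <= a j.+1 + a j.+1)%N.
  move=> nj; apply: (hasdim_submod (ha j.+2) (ha j.+1) (hasdim_scale inj0 (ha j.+1))
    (hasdim_scale inj0 (ha j))).
  - by move=> f; apply: funA_le; rewrite leq_mul2l leqnSn orbT.
  - move=> f [g Ag ->]; rewrite mulnS; exact: funA_M (funA_X _ _ _ _) Ag.
  - rewrite mulnS addnC => f /(funA_step w_gt0 UE) [].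
      by rewrite leq_mul2l (leqW nj) orbT.
    by move=> g [h [Ag Ah ->]]; exists g, (X * h); split=> //; exists h.
  move=> f [g Ag ->]; split.
    rewrite mulnS; exact: funA_M (funA_X _ _ _ _) Ag.
  by exists g => //; apply: funA_le Ag; rewrite leq_mul2l leqnSn orbT.
have [J [delta [nJ lin]]] := concave_eventually_linear (fun j _ => mono j) conc.
(* If [delta] were 0, the dimensions would stay bounded, although the powers of [X] are
   independent. *)
exists a, J, delta; split=> //; rewrite lt0n; apply/eqP => d0.
have aJ j : a (j + J)%N = a J.
  by elim: j => // j IH; rewrite addSn lin ?leq_addl // d0 addn0.
have : (a J < a J)%N.
  rewrite -{2}(aJ (a J)).
  apply: leq_trans (hasdim_indep_le (ha (a J + J)%N) _ (Xexp_indep (m := (a J).+1) X_neq_cst)).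
    by [].
  move=> i; apply: funA_le (funA_exp i (funA_X io w X U)).
  rewrite mulnC leq_mul2l; apply/orP; right.
  by apply: leq_trans (leq_addr _ _); rewrite -ltnS.
by rewrite ltnn.
Qed.

Lemma point_separation (P Q : point k n) : P != Q ->
  exists d f phi, [/\ Pol d f phi, phi P = 1 & phi Q = 0].
Proof.
have sep d f phi : Pol d f phi -> phi P != phi Q ->
    exists d f phi, [/\ Pol d f phi, phi P = 1 & phi Q = 0].
  move=> h ne; exists d, (io (phi P - phi Q)^-1 * (f - io (phi Q))).
  exists (fun P' => (phi P - phi Q)^-1 * (phi P' - phi Q)); split.
  - by apply/Pol_Z/Pol_B => //; apply: Pol_const.
  - by rewrite mulVf // subr_eq0.
  by rewrite subrr mulr0.
move=> PQ; have [e1|] := eqVneq P.1 Q.1; last exact: sep (Pol_coordX _ _ _ _).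
have [e2|e2] := eqVneq P.2 Q.2.
  by move: PQ; rewrite [P]surjective_pairing e1 e2 -surjective_pairing eqxx.
have [i [j ij]] : exists i j, P.2 i j != Q.2 i j.
  apply: contrapT => nex; case/eqP: e2; apply/matrixP => i j.
  by apply/eqP/negPn/negP => h; apply: nex; exists i, j.
exact: sep (Pol_coordU _ _ _ _ i j) ij.
Qed.

Lemma interpolate (ps : seq (point k n)) P : P \notin ps ->
  exists d f phi, [/\ Pol d f phi, phi P = 1 & forall Q, Q \in ps -> phi Q = 0].
Proof.
elim: ps => [_|Q ps IH]; first by exists 0%N, (io 1), (fun=> 1); split=> //; apply: Pol_C.
rewrite inE negb_or => /andP[PQ /IH[d [f [phi [h p1 p0]]]]].
have [d' [f' [phi' [h' p1' p0']]]] := point_separation PQ.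
exists (d' + d)%N, (f' * f), (fun P => phi' P * phi P); split.
- exact: Pol_M.
- by rewrite p1 p1' mulr1.
move=> Q'; rewrite inE => /orP[/eqP ->|/p0 ->]; first by rewrite p0' mul0r.
by rewrite mulr0.
Qed.

Section Bounds.
Variables (a : nat -> nat) (J delta : nat).
Hypothesis ha : forall j, hasdim io (funA (w * j)) (a j).
Hypothesis lin : forall j, (J <= j)%N -> a j.+1 = (a j + delta)%N.

Lemma lin_add i j : (J <= i)%N -> a (i + j)%N = (a i + delta * j)%N.
Proof.
move=> Ji; elim: j => [|j IH]; first by rewrite muln0 !addn0.
by rewrite addnS lin ?IH ?mulnS; [lia|apply: leq_trans Ji (leq_addr _ _)].
Qed.

Lemma basis_scale j f : f != 0 -> forall b : 'I_(a j) -> L, indep io b ->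
  indep io (fun i => f * b i).
Proof.
move=> fn b ib c; rewrite (_ : (fun i => f * b i) = fun i => b i * f); last first.
  by apply: funext => i; rewrite mulrC.
by rewrite -lc_mulr => /eqP; rewrite mulf_eq0 (negbTE fn) orbF => /eqP/ib.
Qed.

(* The multiples [f * b], [b] in [funA (w * i)], all vanish at the zeros of [f],
   and for large [i] the points of [ps] impose independent conditions. *)
Lemma zeros_le j d f phi (ps : seq (point k n)) :
  funA (w * j) f -> f != 0 -> Pol d f phi -> uniq ps ->
  (forall P, P \in ps -> onC0 P /\ phi P = 0) -> (size ps <= delta * j)%N.
Proof.
move=> Af fn hphi ups hps.
pose pt (s : 'I_(size ps)) := tnth (in_tuple ps) s.
have ptin s : pt s \in ps by apply: mem_tnth.
have ptI : injective pt by apply/(tuple_uniqP (in_tuple ps)).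
have /choice[h hh] : forall s, exists h : nat * L,
    exists2 psi, Pol h.1 h.2 psi & forall s', psi (pt s') = (s == s')%:R.
  move=> s; have [d' [f' [psi [hp p1 p0]]]] : exists d f phi,
      [/\ Pol d f phi, phi (pt s) = 1 & forall Q, Q \in rem (pt s) ps -> phi Q = 0].
    by apply: interpolate; rewrite mem_rem_uniqF.
  exists (d', f'); exists psi => // s'; case: eqVneq => [<- //|ss'].
  apply: p0; rewrite mem_rem_uniq // inE ptin andbT.
  by rewrite (inj_eq ptI) eq_sym.
pose i := (J + \sum_s (h s).1)%N.
have hi s : ((h s).1 <= w * (i + j))%N.
  apply: leq_trans (leq_pmull _ w_gt0); apply: leq_trans (leq_addr _ _).
  by apply: leq_trans (leq_addl _ _); rewrite (bigD1 s) //= leq_addr.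
have [b ib Wb] := ha i.
have Ab l : funA (w * i) (b l) by apply/Wb; exists (delta_mx 0 l); rewrite lc_delta.
suff : (a i + size ps <= a (i + j))%N by rewrite lin_add ?leq_addr // leq_add2l.
have fb l : funA (w * (i + j)) (f * b l) by rewrite addnC mulnDr; apply: funA_M.
apply: (hasdim_eval_le (val := fun g v => exists2 psi, Pol (w * (i + j)) g psi &
   forall s, v 0 s = psi (pt s)) (h := fun s => (h s).2) (Hm := 1%:M) (ha (i + j)%N)
   (basis_scale fn ib) fb).
- by move=> s; have [psi hp _] := hh s; exists psi; apply: Pol_le hp.
- by move=> g [psi hg]; exists (\row_s psi (pt s)), psi => // s; rewrite mxE.
- move=> c g g' v v' [psi hg vE] [psi' hg' vE'].
  exists (fun P => c * psi P + psi' P); first by apply: Pol_D => //; apply: Pol_Z.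
  by move=> s; rewrite !mxE vE vE'.
- move=> v [psi h0 vE]; apply/rowP => s; rewrite vE mxE.
  by apply: (proj1 (hps _ (ptin s))) h0.
- move=> l; have [psi' hfb] := fb l; have [psi hb] := Ab l.
  exists psi' => // s; have [cs phi0] := hps _ (ptin s).
  by rewrite mxE -(onC0_eq cs (Pol_M hphi hb) hfb) phi0 mul0r.
- move=> s; have [psi hp pd] := hh s; exists psi; first exact: Pol_le hp.
  by move=> s'; rewrite !mxE pd.
exact: unitmx1.
Qed.

(** The counterpart of [zeros_le] at infinity: the first [v] Laurent coefficients of all multiples
    [f * b] are 0, while [funA (w * (i + j))] contains functions for which these coefficients are
    arbitrary. *)
Lemma order_at_infinity_le j f v g : funA (w * j) f -> f != 0 ->
  Z ^+ (w * j) * f = tau (psX k ^+ v * g) -> (v <= delta * j)%N.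
Proof.
move=> Af fn fE; pose i := (J + v)%N.
have [b ib Wb] := ha i.
have Ab l : funA (w * i) (b l) by apply/Wb; exists (delta_mx 0 l); rewrite lc_delta.
suff : (a i + v <= a (i + j))%N by rewrite lin_add ?leq_addr // leq_add2l.
have fb l : funA (w * (i + j)) (f * b l) by rewrite addnC mulnDr; apply: funA_M.
pose N := (w * (i + j))%N.
have vN t : (t < v)%N -> (t <= N)%N.
  move=> tv; apply: leq_trans (leq_pmull _ w_gt0); apply: leq_trans (leq_addr _ _).
  by apply: leq_trans (leq_addl _ _); apply: ltnW.
(* [X] has a pole of order [w] and [U 0 0] a simple pole, so [h t] has a pole of order exactly
   [N - t]; the matrix of first coefficients is triangular with diagonal entries 1 or -1. *)
pose h (t : nat) : L := X ^+ ((N - t) %/ w) * U 0 0 ^+ ((N - t) %% w).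
pose h0 (t : nat) := psC ((-1) ^+ ((N - t) %/ w)) * (psX k ^+ t * u 0 0 ^+ ((N - t) %% w)).
have hE (t : 'I_v) : Z ^+ N * h t = tau (h0 t).
  have sgC m : psC ((-1) ^+ m) = (-1) ^+ m :> pser k by rewrite rmorphXn rmorphN1.
  rewrite /h /h0 sgC !rmorphM !rmorphXn rmorphN1 -/Z.
  have := divn_eq (N - t) w; set aa := (_ %/ w)%N; set bb := (_ %% w)%N => Nt.
  have -> : Z ^+ N = Z ^+ t * (Z ^+ w) ^+ aa * Z ^+ bb.
    by rewrite -exprM -!exprD; congr (_ ^+ _); have := vN _ (ltn_ord t); lia.
  rewrite mxE exprMn /X exprNn exprVn exprVn.
  have ZA : (Z ^+ w) ^+ aa * (Z ^+ w) ^- aa = 1 by rewrite -exprM ZnV.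
  transitivity ((Z ^+ w) ^+ aa * (Z ^+ w) ^- aa * (Z ^+ bb * Z ^- bb) *
    ((-1) ^+ aa * (Z ^+ t * tau (u 0 0) ^+ bb))); first by ring.
  by rewrite ZA ZnV !mul1r.
have u0b m : (u 0 0 ^+ m) 0%N = 1.
  by elim: m => [|m IH] //; rewrite exprS psM0 IH u00 mulr1.
apply: (hasdim_eval_le (val := fun g v => exists2 g0, Z ^+ N * g = tau g0 & forall s, v 0 s = g0 s)
  (h := fun t : 'I_v => h t) (Hm := \matrix_(t < v, s < v) h0 t s) (ha (i + j)%N)
   (basis_scale fn ib) fb).
- move=> t; rewrite /h; apply: (@funA_le _ _ _ _ _ _ _ ((N - t) %/ w * w + (N - t) %% w * 1)).
    by rewrite muln1 -divn_eq leq_subr.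
  by apply: funA_M; apply: funA_exp; [apply: funA_X|apply: funA_U].
- move=> g' /funA_Z[g0 hg]; exists (\row_s g0 s), g0 => // s; by rewrite mxE.
- move=> c g1 g2 v1 v2 [g10 hg1 v1E] [g20 hg2 v2E].
  exists (psC c * g10 + g20); first by rewrite rmorphD rmorphM -hg1 -hg2 mulrDr; congr (_ + _); rewrite mulrCA.
  by move=> s; rewrite !mxE psD psCM v1E v2E.
- move=> v' [g0]; rewrite mulr0 -(rmorph0 tau) => /tau_inj <- vE.
  by apply/rowP => s; rewrite vE ps0 mxE.
- move=> l; have [b0 hb] := funA_Z (Ab l).
  exists (psX k ^+ v * (g * b0)).
    by rewrite [in RHS]mulrA rmorphM -fE -hb /N [(i + j)%N]addnC mulnDr exprD mulrACA.
  by move=> s; rewrite psXnM leqNgt ltn_ord mxE.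
- move=> t; exists (h0 t); first exact: hE.
  by move=> s; rewrite !mxE.
rewrite -unitmx_tr unitmxE det_trig; last first.
  apply/is_trig_mxP => s t st; rewrite !mxE /h0 psCM psXnM leqNgt st.
  by rewrite /= mulr0.
rewrite unitfE; apply/prodf_neq0 => t _.
by rewrite !mxE /h0 psCM psXnM leqnn subnn u0b mulr1 signr_eq0.
Qed.

Variables (p : nat) (ch : p \in [pchar k]).

Lemma pchar_L : p \in [pchar L]. Proof. exact: (rmorph_pchar io ch). Qed.

Lemma pchar_ps : p \in [pchar (pser k)]. Proof. exact: (rmorph_pchar (@psC k) ch). Qed.

Lemma pX_gt0 mu : (0 < p ^ mu)%N.
Proof. by rewrite expn_gt0 prime_gt0 // (pcharf_prime ch). Qed.

(* The leading coefficients of the [y l] give a combination of the [e l] that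
   vanishes to order [p ^ mu] at infinity, more than [order_at_infinity_le] allows. *)
Lemma indep_frob mu j1 j2 M (e y : 'I_M -> L) :
  indep io e -> (forall l, funA (w * j2) (e l)) -> (forall l, funA (w * j1) (y l)) ->
  (delta * j2 < p ^ mu)%N -> \sum_l e l * y l ^+ (p ^ mu) = 0 ->
  forall l, y l = 0.
Proof.
set R := (p ^ mu)%N => ie Ae Ay jR ey0.
have R0 : (0 < R)%N := pX_gt0 mu.
have /choice[e' eE] : forall l, exists e', Z ^+ (w * j2) * e l = tau e'.
  by move=> l; apply: funA_Z.
have /choice[y' yE] : forall l, exists y', Z ^+ (w * j1) * y l = tau y'.
  by move=> l; apply: funA_Z.
have ey0' : \sum_l e' l * y' l ^+ R = 0.
  apply: tau_inj; rewrite rmorph0 rmorph_sum.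
  have := mulr0 (Z ^+ (w * j2) * (Z ^+ (w * j1)) ^+ R); rewrite -{1}ey0 mulr_sumr => h.
  apply: etrans h; by apply: eq_bigr => l _; rewrite rmorphM rmorphXn -eE -yE exprMn mulrACA.
suff yz l : y' l = 0.
  move=> l; have := yE l; rewrite yz rmorph0 => /eqP.
  by rewrite mulf_eq0 expf_eq0 (negbTE Z_neq0) andbF => /eqP.
apply/eqP/negPn/negP => yn.
have ex : exists m, [exists l, y' l m != 0].
  have [m [g [yg g0]]] := ps_neq0 yn; exists m; apply/existsP; exists l.
  by rewrite yg psXnM leqnn subnn.
case: (ex_minnP ex) => m /existsP[l0 yl0] mmin.
have /choice[g yg] : forall l, exists g, y' l = psX k ^+ m * g.
  move=> l'; apply: ps_divXn => i im; apply/eqP/negPn/negP => h.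
  by move: im; rewrite ltnNge mmin //; apply/existsP; exists l'.
have eg0 : \sum_l e' l * g l ^+ R = 0.
  apply: (@psXn_inj k (m * R)); rewrite mulr_sumr; apply: etrans ey0'.
  by apply: eq_bigr => l' _; rewrite yg exprMn exprM mulrCA.
have /choice[h gh] : forall l, exists h, g l = psC (g l 0%N) + psX k * h.
  by move=> l'; apply: ps_dec.
pose c := \row_l (g l 0%N) ^+ R.
have cn : c != 0.
  apply/eqP => /rowP/(_ l0); rewrite !mxE => /eqP; rewrite expf_eq0 => /andP[_].
  by move: yl0; rewrite yg psXnM leqnn subnn => /negbTE ->.
have fn : lc io c e != 0 by apply: contraNneq cn => /ie ->.
suff : (R <= delta * j2)%N by rewrite leqNgt jR.
apply: (@order_at_infinity_le j2 (lc io c e) R (- \sum_l e' l * h l ^+ R)) => //.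
  exact: subsp_lc (funA_subsp _ _ _ _ _) _.
rewrite /lc mulr_sumr.
transitivity (tau (\sum_l e' l * psC (g l 0%N) ^+ R)).
  rewrite rmorph_sum; apply: eq_bigr => l' _.
  by rewrite mxE rmorphXn [in RHS]rmorphM [in RHS]rmorphXn -eE mulrCA mulrC.
congr (tau _); apply/eqP; rewrite mulrN -addr_eq0 mulr_sumr -big_split /=.
apply/eqP; apply: etrans eg0; apply: eq_bigr => l' _.
rewrite mulrCA -mulrDr; congr (_ * _).
rewrite [in RHS]gh -exprMn.
have := expr_pchar_sum mu [:: psC (g l' 0%N); psX k * h l'] id pchar_ps.
by rewrite !big_cons !big_nil !addr0.
Qed.

Definition frob_pt r (eta : 'M[k]_n) (P : point k n) :=
  P.1 ^+ r = P.1 /\ forall i j, P.2 i j ^+ r = (P.2 *m eta) i j.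

(** At points where Frobenius acts linearly on the coordinates, the [p ^ nu]-th power of a function
    agrees with a function of the same weighted degree; this is the gain on which Stepanov's method
    rests. *)
Lemma Pol_twist nu eta d f phi : Pol d f phi ->
  exists f' phi', Pol d f' phi' /\
    forall P, frob_pt (p ^ nu) eta P -> phi' P = phi P ^+ (p ^ nu).
Proof.
elim=> {d f phi} [c|d f phi _ [f' [phi' [h hP]]]|d f phi i j _ [f' [phi' [h hP]]]
  |d f g phi psi _ [f' [phi' [h hP]]] _ [g' [psi' [h' hP']]]|d d' f phi dd' _ [f' [phi' [h hP]]]].
- by exists (io (c ^+ (p ^ nu))), (fun=> c ^+ (p ^ nu)); split; [apply: Pol_C|].
- exists (X * f'), (fun P => P.1 * phi' P); split; first exact: Pol_X.
  by move=> P gP; rewrite hP // exprMn; congr (_ * _); case: gP => ->.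
- exists ((\sum_l io (eta l j) * U i l) * f'), (fun P => (P.2 *m eta) i j * phi' P); split.
    suff hU : Pol 1 (\sum_l io (eta l j) * U i l) (fun P => (P.2 *m eta) i j).
      exact: (Pol_M hU h).
    apply: (Pol_eq (Pol_sum (index_enum _) (fun l => Pol_Z (eta l j) (Pol_coordU io w X U i l)))) => // P.
    by rewrite mxE; apply: eq_bigr => l _; rewrite mulrC.
  by move=> P gP; rewrite hP // exprMn; congr (_ * _); case: gP => _ ->.
- exists (f' + g'), (fun P => phi' P + psi' P); split; first exact: Pol_D.
  move=> P gP; rewrite hP // hP' //.
  by have := expr_pchar_sum nu [:: phi P; psi P] id ch; rewrite !big_cons !big_nil !addr0.
by exists f', phi'; split=> //; apply: Pol_le h.
Qed.

(* With [R = p ^ mu], a dimension count gives scalars [c], not all 0, with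
   [\sum c (e l)^R s'_i = 0].  As [s'_i] agrees with [(s i)^(R * R)] at the points
   [P] of [ps], the function [\sum c^(1/R) e l (s i)^R] vanishes at these points,
   and it is nonzero by [indep_frob]. *)
Lemma stepanov mu j1 j2 eta (ps : seq (point k n)) :
  (delta * j2 < p ^ mu)%N ->
  (a (p ^ mu * j2 + j1) < a j1 * a j2)%N ->
  uniq ps ->
  (forall P, P \in ps -> onC0 P /\ frob_pt (p ^ mu * p ^ mu) eta P) ->
  (size ps <= delta * (j2 + p ^ mu * j1))%N.
Proof.
set R := (p ^ mu)%N => jR aa ups hps.
have R0 : (0 < R)%N := pX_gt0 mu.
have [s is_ Ws] := ha j1; have [e ie We] := ha j2.
have As i : funA (w * j1) (s i) by apply/Ws; exists (delta_mx 0 i); rewrite lc_delta.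
have Ae l : funA (w * j2) (e l) by apply/We; exists (delta_mx 0 l); rewrite lc_delta.
have /choice[sphi hs] : forall i, exists phi, Pol (w * j1) (s i) phi by [].
have /choice[ephi he] : forall l, exists phi, Pol (w * j2) (e l) phi by [].
have /choice[s' hs'] : forall i, exists s' : L * (point k n -> k),
    Pol (w * j1) s'.1 s'.2 /\ forall P, frob_pt (R * R) eta P -> s'.2 P = sphi i P ^+ (R * R).
  move=> i; have [f' [phi' [h hP]]] := Pol_twist (mu + mu) eta (hs i).
  by exists (f', phi'); split=> // P; rewrite -expnD; apply: hP.
pose IJ := ('I_(a j1) * 'I_(a j2))%type.
pose E (x : IJ) := e x.2 ^+ R * (s' x.1).1.
pose Ephi (x : IJ) P := ephi x.2 P ^+ R * (s' x.1).2 P.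
have hE x : Pol (w * (R * j2 + j1)) (E x) (Ephi x).
  rewrite mulnDr mulnCA; apply: Pol_M; last exact: (proj1 (hs' _)).
  exact: Pol_exp.
have [|c cn c0] := hasdim_dependent (m := #|{: IJ}|) (e := fun t => E (enum_val t))
   (ha (R * j2 + j1)%N) (fun t => ex_intro _ _ (hE (enum_val t))).
  by rewrite card_prod !card_ord.
have /choice[dd hdd] : forall x : IJ, exists y, (y ^+ R) ^+ R = c 0 (enum_rank x).
  move=> x; have [y yE] := closed_root (c 0 (enum_rank x)) R0; have [z zE] := closed_root y R0.
  by exists z; rewrite zE yE.
pose h := \sum_(x : IJ) io (dd x ^+ R) * (e x.2 * s x.1 ^+ R).
pose hphi P := \sum_(x : IJ) dd x ^+ R * (ephi x.2 P * sphi x.1 P ^+ R).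
have hh : Pol (w * (j2 + R * j1)) h hphi.
  apply: (Pol_eq (Pol_sum (index_enum _) (fun x : IJ => Pol_Z (dd x ^+ R)
    (Pol_M (he x.2) (Pol_exp R (hs x.1)))))) => //.
  by rewrite mulnDr mulnCA.
have hn : h != 0.
  apply: contra_neq cn => h0.
  have hy : h = \sum_l e l * (\sum_i io (dd (i, l)) * s i) ^+ R.
    transitivity (\sum_i \sum_l io (dd (i, l) ^+ R) * (e l * s i ^+ R)).
      by rewrite pair_bigA; apply: eq_bigr => -[].
    rewrite exchange_big /=.
    apply: eq_bigr => l _; rewrite (expr_pchar_sum _ _ _ pchar_L) mulr_sumr.
    by apply: eq_bigr => i _; rewrite exprMn rmorphXn mulrCA.
  have Ay l : funA (w * j1) (\sum_i io (dd (i, l)) * s i).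
    by apply/Ws; exists (\row_i dd (i, l)); apply: eq_bigr => i _; rewrite mxE.
  have y0 := indep_frob ie Ae Ay jR (etrans (esym hy) h0).
  apply/rowP => t; rewrite mxE -[t]enum_valK -hdd; case: (enum_val t) => i l.
  have /is_ /rowP/(_ i) : lc io (\row_i dd (i, l)) s = 0.
    by rewrite -[RHS](y0 l); apply: eq_bigr => i' _; rewrite mxE.
  by rewrite !mxE => ->; rewrite expr0n gtn_eqF ?expr0n ?gtn_eqF.
apply: (@zeros_le _ _ _ _ ps _ hn hh ups); first by exists hphi.
move=> P /hps[cP gP]; split=> //; apply/eqP.
suff : hphi P ^+ R == 0 by rewrite expf_eq0 => /andP[].
have hsum : Pol (w * (R * j2 + j1)) (\sum_x io (c 0 (enum_rank x)) * E x)
    (fun P => \sum_x c 0 (enum_rank x) * Ephi x P).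
  by apply: Pol_sum => x; apply: Pol_Z.
have s0 : \sum_x io (c 0 (enum_rank x)) * E x = 0.
  rewrite -[RHS]c0 /lc (reindex (fun t => enum_rank t)) /=; last first.
    by apply: onW_bij; apply: enum_rank_bij.
  by apply: eq_bigr => x _; rewrite enum_rankK.
rewrite s0 in hsum; have := cP _ _ hsum => <-.
rewrite /hphi (expr_pchar_sum _ _ _ ch); apply/eqP; apply: eq_bigr => x _.
rewrite !exprMn hdd /Ephi (proj2 (hs' _)) // -exprM; by [].
Qed.

Lemma stepanov_bound : (0 < delta)%N -> exists C R0, forall mu eta (ps : seq (point k n)),
  (R0 <= p ^ mu)%N -> uniq ps ->
  (forall P, P \in ps -> onC0 P /\ frob_pt (p ^ mu * p ^ mu) eta P) ->
  (size ps <= p ^ mu * p ^ mu + C * p ^ mu)%N.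
Proof.
move=> d0; pose D := (delta * J)%N; pose e := (3 * D + 3)%N.
exists (1 + e + delta)%N, ((2 * D + 3) * (delta + D + 1) + delta * J + delta)%N.
move=> mu eta ps; set R := (p ^ mu)%N => RR ups hps.
(* [delta * j2] is the last multiple of [delta] below [R], as [indep_frob] requires, and
   [delta * j1] exceeds [R] by a bounded amount. For [j >= J], [a j] falls short of [delta * j] by
   at most [D]; the excess [e = 3 * D + 3] compensates for this in both factors, so that
   [a j1 * a j2] is larger than [a (R * j2 + j1)] for large [R]. *)
pose j2 := (R.-1 %/ delta)%N; pose j1 := ((R + e) %/ delta).+1.
have R0 : (0 < R)%N := pX_gt0 mu.
have P1 : (delta * j2 < R)%N.
  by rewrite mulnC; apply: leq_ltn_trans (leq_trunc_div _ _) _; rewrite prednK.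
have P2 : (R <= delta * j2 + delta)%N.
  have := ltn_ceil R.-1 d0; rewrite -/j2 mulSn mulnC; lia.
have Q1 : (R + e < delta * j1)%N by rewrite mulnC; apply: ltn_ceil.
have Q2 : (delta * j1 <= R + e + delta)%N.
  have := leq_trunc_div (R + e) delta; rewrite /j1 mulnS mulnC; lia.
have aE j : (J <= j)%N -> (a j + D = a J + delta * j)%N.
  move=> Jj; rewrite -(subnKC Jj) lin_add // mulnDr /D; lia.
have Jj2 : (J <= j2)%N by rewrite leq_divRL // mulnC; lia.
have Jj1 : (J <= j1)%N by rewrite /j1 leqW // leq_divRL // mulnC; lia.
have h1 := aE _ Jj1; have h2 := aE _ Jj2.
have h3 := aE (R * j2 + j1)%N (leq_trans Jj1 (leq_addl _ _)).
have h4 : (delta * (R * j2 + j1) = R * (delta * j2) + delta * j1)%N by rewrite mulnDr mulnCA.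
apply: leq_trans (stepanov (j1 := j1) P1 _ ups hps) _; last first.
  have : (R * (delta * j1) <= R * (R + e + delta))%N by rewrite leq_mul2l Q2 orbT.
  move=> h; rewrite -/R (mulnDr delta) mulnCA; move: h P1; rewrite (mulnDr R (R + e)%N) (mulnDr R R).
  rewrite (mulnDl (1 + e)%N) (mulnDl 1%N) mul1n (mulnC R e) (mulnC R delta).
  lia.
rewrite -/R; move: RR h1 h2 h3 h4 P1 P2 Q1 Q2; rewrite -/D.
move: (delta * j1)%N (delta * j2)%N (a j1) (a j2) (a (R * j2 + j1)%N) (delta * (R * j2 + j1))%N.
move=> Q P x y z t RR h1 h2 h3 h4 P1 P2 Q1 Q2.
have z_eq : z = (x + R * P)%N by lia.
have xu : (R + (2 * D + 3) <= x)%N by rewrite /e in Q1; lia.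
have yv : (R <= y.-1 + (delta + D + 1))%N by lia.
have m0 : (delta + D + 1 <= (2 * D + 3) * (delta + D + 1))%N by rewrite leq_pmull // addn3.
have y0 : (0 < y)%N by lia.
have m1 : ((R + (2 * D + 3)) * y.-1 <= x * y.-1)%N by rewrite leq_mul2r xu orbT.
have m2 : ((2 * D + 3) * R <= (2 * D + 3) * y.-1 + (2 * D + 3) * (delta + D + 1))%N.
  by rewrite -mulnDr leq_mul2l yv orbT.
have m3 : (P <= y.-1 + D + 1)%N by lia.
have m4 : (R * P <= R * y.-1 + R * D + R)%N.
  by rewrite -[X in (_ + X)%N]muln1 -!mulnDr leq_mul2l m3 orbT.
have m5 : (x * y = x * y.-1 + x)%N by rewrite -[in LHS](prednK y0) mulnS addnC.
have m6 : ((2 * D + 3) * R = R * D + R * D + 3 * R)%N.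
  by rewrite mulnDl -mulnA mulSn mul1n [(D * R)%N]mulnC.
rewrite mulnDl in m1; rewrite z_eq m5; lia.
Qed.

(* Every [x1] lifts to a point of the closure of the generic point; the ideals
   below do the work of the going-up theorem for the integral extension
   [k[X] <= k[X, U]]. *)
Section Fibre.
Variable x1 : k.
Local Notation y := (X - io x1).

Lemma y_neq_cst c : y != io c.
Proof.
apply/eqP => h; have := X_neq_cst (c + x1).
by rewrite rmorphD /= -h subrK eqxx.
Qed.

Lemma y_neq0 : y != 0. Proof. by have := y_neq_cst 0; rewrite rmorph0. Qed.

Hypothesis nJ : (n * n <= J)%N.

(** The equality case of the concavity in [growth], with [y] in place of [X]. The [g] in [A i.+1]
    with [y * g] in [A i.+1], where [A i] is [funA (w * i)], form a space that contains [A i] and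
    has dimension at most [2 * a i.+1 - a i.+2], which is [a i] in the linear range. *)
Lemma fibre_degree i f : (J <= i)%N -> funA (w * i.+1) f -> funA (w * i.+1) (y * f) ->
  funA (w * i) f.
Proof.
move=> Ji Af Ayf.
pose W f := funA (w * i.+1) f /\ funA (w * i.+1) (y * f).
have [A0 AD AZ] := funA_subsp io w X U (w * i.+1).
have sW : subsp io W.
  split; first by rewrite /W mulr0.
    by move=> g h [? ?] [? ?]; split; rewrite ?mulrDr; apply: AD.
  by move=> c g [? ?]; split; [|rewrite mulrCA]; apply: AZ.
have [m hW] := sub_hasdim sW (fun g (Wg : W g) => proj1 Wg) (ha i.+1).
have yinj g : y * g = 0 -> g = 0 by move/eqP; rewrite mulf_eq0 (negbTE y_neq0) => /eqP.
have Ay g j : funA (w * j) g -> funA (w * j.+1) (y * g).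
  by rewrite mulnS addnC; apply: funA_XsubM.
have mle : (m <= a i)%N.
  have : (a i.+2 + m <= a i.+1 + a i.+1)%N.
    apply: (hasdim_submod (ha i.+2) (ha i.+1) (hasdim_scale yinj (ha i.+1)) (hasdim_scale yinj hW)).
    - by move=> g; apply: funA_le; rewrite leq_mul2l leqnSn orbT.
    - by move=> g [h Ah ->]; apply: Ay.
    - rewrite mulnS addnC => g /(funA_step_shift x1) [].
        by rewrite leq_mul2l (leq_trans nJ) ?orbT // leqW.
      by move=> g' [h [Ag' Ah ->]]; exists g', (y * h); split=> //; exists h.
    by move=> g [h [Ah Ayh] ->]; split=> //; exists h.
  by have := lin Ji; have := lin (leqW Ji); lia.
apply: (hasdim_sub_eq _ (ha i) hW mle) => // g Ag; split; last exact: Ay.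
by apply: funA_le Ag; rewrite leq_mul2l leqnSn orbT.
Qed.

Definition isA f := exists d, funA d f.

Lemma isA_D f g : isA f -> isA g -> isA (f + g).
Proof.
move=> [d hf] [e hg]; exists (maxn d e).
by apply: funA_D; [apply: funA_le hf; apply: leq_maxl|apply: funA_le hg; apply: leq_maxr].
Qed.

Lemma isA_M f g : isA f -> isA g -> isA (f * g).
Proof. by move=> [d hf] [e hg]; exists (d + e)%N; apply: funA_M. Qed.

Lemma isA_C c : isA (io c). Proof. by exists 0%N; apply: funA_C. Qed.

Lemma isA_0 : isA 0. Proof. by rewrite -(rmorph0 io); apply: isA_C. Qed.

Lemma isA_1 : isA 1. Proof. by rewrite -(rmorph1 io); apply: isA_C. Qed.

Lemma isA_X f m : isA f -> isA (f ^+ m).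
Proof. by move=> [d hf]; exists (m * d)%N; apply: funA_exp. Qed.

Lemma isA_w f : isA f -> exists i, funA (w * (J + i)) f.
Proof.
move=> [d hf]; exists d; apply: funA_le hf; apply: leq_trans (leq_pmull _ w_gt0).
exact: leq_addl.
Qed.

Lemma fibre_descent f : isA f -> funA (w * J.+1) (y * f) -> funA (w * J) f.
Proof.
move=> /isA_w [] i; elim: i => [|i IH]; first by rewrite addn0.
rewrite addnS => Af Ayf; apply: IH => //; apply: fibre_degree => //; first exact: leq_addr.
by apply: funA_le Ayf; rewrite leq_mul2l ltnS leq_addr orbT.
Qed.

(** Were [f] an inverse of [y], all its powers would by descent lie in the finite-dimensional space
    [funA (w * J)], although [f] is transcendental. *)
Lemma y_not_unit f : isA f -> y * f != 1.
Proof.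
move=> Af; apply/eqP => yf.
have Js s : funA (w * J) (f ^+ s).
  elim: s => [|s IH]; first by rewrite expr0 -(rmorph1 io); apply: funA_C.
  apply: fibre_descent; first exact: isA_X.
  rewrite exprS mulrA yf mul1r.
  by apply: funA_le IH; rewrite leq_mul2l leqnSn orbT.
have fc c : f != io c.
  apply/eqP => fE; have fn : f != 0.
    by apply: contra_eq_neq yf => ->; rewrite mulr0 eq_sym oner_eq0.
  by have := y_neq_cst c^-1; rewrite fmorphV /= -fE -(mulfK fn y) yf mul1r eqxx.
have := hasdim_indep_le (ha J) (fun i => Js _) (Xexp_indep (m := (a J).+1) fc).
by rewrite ltnn.
Qed.

Lemma mod_y f : isA f -> exists g h, [/\ funA (w * J) g, isA h & f = g + y * h].
Proof.
move=> /isA_w [] i; elim: i f => [|i IH] f.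
  rewrite addn0 => Af; exists f, 0; split=> //; last by rewrite mulr0 addr0.
  exact: isA_0.
rewrite addnS mulnS addnC => /(funA_step_shift x1)[].
  by rewrite leq_mul2l (leq_trans nJ) ?orbT // leq_addr.
move=> g [h [/IH[g' [h' [Ag' Ah' ->]]] Ah ->]].
exists g', (h' + h); split=> //; last by rewrite mulrDr addrA.
by apply: isA_D => //; eexists; apply: Ah.
Qed.

Definition ideal (I : L -> Prop) :=
  (forall f g, I f -> I g -> I (f + g)) /\ (forall f g, isA f -> I g -> I (f * g)).

Definition adj (I : L -> Prop) v f := exists g h, [/\ I g, isA h & f = g + v * h].

Lemma adj_ideal I v : isA v -> ideal I -> ideal (adj I v).
Proof.
move=> Av [ID IM]; split.
  move=> f g [f1 [f2 [If1 Af2 ->]]] [g1 [g2 [Ig1 Ag2 ->]]].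
  by exists (f1 + g1), (f2 + g2); split; [exact: ID|exact: isA_D|ring].
move=> f g Af [g1 [g2 [Ig1 Ag2 ->]]]; exists (f * g1), (f * g2).
by split; [exact: IM|exact: isA_M|ring].
Qed.

(** By [mod_y] the coordinate ring is finite-dimensional modulo [y], so [v] is modulo [I] a root of
    a polynomial that splits over [k]. If every [v - io c] were invertible modulo [I], so would be a
    product of such factors that lies in [I]. *)
Lemma adj_proper I v : ideal I -> (forall h, isA h -> I (y * h)) -> ~ I 1 -> isA v ->
  exists c, ~ adj I (v - io c) 1.
Proof.
move=> [ID IM] Iy I1 Av; apply: contrapT => nex.
have adj1 c : adj I (v - io c) 1 by apply: contrapT => h; apply: nex; exists c.
have /choice[g hg] : forall s, exists g, exists2 h, isA h & funA (w * J) g /\ v ^+ s = g + y * h.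
  by move=> s; have [g [h [Ag Ah e]]] := mod_y (isA_X s Av); exists g, h.
have [c cn c0] := hasdim_dependent (m := (a J).+1) (e := fun s : 'I__ => g s) (ha J)
  (fun s => let: ex_intro2 _ _ (conj Ag _) := hg s in Ag) (ltnSn _).
pose q : {poly k} := \sum_i c 0 i *: 'X^i.
have qv : I (map_poly io q).[v].
  have -> : (map_poly io q).[v] = lc io c (fun s => g s) + \sum_i io (c 0 i) * (v ^+ i - g i).
    rewrite rmorph_sum horner_sum -big_split; apply: eq_bigr => i _ /=.
    by rewrite map_polyZ map_polyXn hornerZ hornerXn; ring.
  have I0 : I 0.
    have := IM 0 _ _ (Iy 0 _); rewrite mul0r; apply; exact: isA_0.
  rewrite c0 add0r; apply: (big_ind I) => // i _; apply: IM; first exact: isA_C.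
  by have [h Ah [_ ->]] := hg i; rewrite addrC addKr; apply: Iy.
have qn : q != 0.
  apply: contraNneq cn => q0; apply/eqP/rowP => i; rewrite mxE.
  have : q`_i = 0 by rewrite q0 coef0.
  rewrite /q coef_sum (bigD1 i) //= coefZ coefXn eqxx mulr1 big1 ?addr0 // => l li.
  rewrite coefZ coefXn eq_sym (_ : (_ == _) = false) ?mulr0 //.
  exact: negbTE li.
have [rs qE] := closed_field_poly_normal q.
have Iprod : I (\prod_(r <- rs) (v - io r)).
  have := IM _ _ (isA_C (lead_coef q)^-1) qv.
  rewrite qE map_polyZ hornerZ mulrA -rmorphM -qE mulVf ?lead_coef_eq0 // rmorph1 mul1r.
  rewrite rmorph_prod horner_prod; congr I; apply: eq_bigr => r _.
  by rewrite rmorphB /= map_polyX map_polyC hornerXsubC.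
have Aprod l : isA (\prod_(r <- l) (v - io r)).
  elim: l => [|r l IH]; first by rewrite big_nil; exact: isA_1.
  rewrite big_cons; apply: isA_M => //; apply: isA_D => //.
  by rewrite -rmorphN; apply: isA_C.
have main l : adj I (\prod_(r <- l) (v - io r)) 1.
  elim: l => [|r l [g1 [h1 [Ig1 Ah1 e1]]]].
    exists 0, 1; rewrite big_nil add0r mul1r; split=> //; last exact: isA_1.
    have := IM 0 _ _ Iprod; rewrite mul0r; apply; exact: isA_0.
  have [g2 [h2 [Ig2 Ah2 e2]]] := adj1 r.
  have A1 := isA_1.
  exists (1 * g1 + \prod_(r <- l) (v - io r) * h1 * g2), (h1 * h2); split.
  - by apply: ID; apply: IM => //; apply: isA_M.
  - exact: isA_M.
  rewrite big_cons; move: (\prod_(_ <- _) _) e1 => Q e1.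
  rewrite [LHS]e1; transitivity (g1 + Q * h1 * (g2 + (v - io r) * h2)); last by ring.
  by rewrite -e2 mulr1.
have [g1 [h1 [Ig1 Ah1 e1]]] := main rs.
by apply: I1; rewrite e1; apply: ID => //; rewrite mulrC; apply: IM.
Qed.

Lemma fibre_ideal (l : seq ('I_n * 'I_n)) : exists I (g : 'I_n * 'I_n -> k),
  [/\ ideal I, forall h, isA h -> I (y * h), ~ I 1 &
    forall x h, x \in l -> isA h -> I ((U x.1 x.2 - io (g x)) * h)].
Proof.
elim: l => [|x l [I [g [idI Iy I1 Ig]]]].
  exists (fun f => exists2 h, isA h & f = y * h), (fun=> 0); split=> //.
  - split; first by move=> f f' [h Ah ->] [h' Ah' ->]; exists (h + h'); [exact: isA_D|ring].
    by move=> f f' Af [h Ah ->]; exists (f * h); [exact: isA_M|ring].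
  - by move=> h Ah; exists h.
  by move=> [h Ah] /esym/eqP; apply/negP/y_not_unit.
have [xl|xl] := boolP (x \in l).
  exists I, g; split=> // x' h; rewrite inE => /orP[/eqP ->|]; exact: Ig.
have AU : isA (U x.1 x.2) by exists 1%N; apply: funA_U.
have [c hc] := adj_proper idI Iy I1 AU.
have AUc : isA (U x.1 x.2 - io c) by apply: isA_D => //; rewrite -rmorphN; apply: isA_C.
have Isub f : I f -> adj I (U x.1 x.2 - io c) f.
  move=> If; exists f, 0; rewrite mulr0 addr0; split=> //.
  exact: isA_0.
exists (adj I (U x.1 x.2 - io c)), (fun x' => if x' == x then c else g x'); split=> //.
- exact: adj_ideal.
- by move=> h Ah; apply/Isub/Iy.
move=> x' h; rewrite inE; case: eqVneq => [-> _ Ah|_ /= x'l Ah]; last exact/Isub/Ig.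
exists 0, h; rewrite add0r; split=> //.
by rewrite -(mulr0 y); apply: Iy; rewrite -(rmorph0 io); apply: isA_C.
Qed.

Lemma fibre_nonempty : exists g, onC0 (x1, g).
Proof.
have [I [g [[ID IM] Iy I1 Ig]]] := fibre_ideal (enum {: 'I_n * 'I_n}).
exists (\matrix_(i, j) g (i, j)); set P := (_, _).
(* Modulo [I], every function is congruent to its value at [P]. A polynomial that vanishes at the
   generic point therefore has its value at [P] in [I], and a proper ideal contains no constant
   other than 0. *)
have ev d f phi : Pol d f phi -> isA f /\ I (f - io (phi P)).
  have I0 : I 0 by rewrite -(mulr0 y); apply: Iy; rewrite -(rmorph0 io); apply: isA_C.
  elim=> {d f phi} [c|d f phi h [Af IH]|d f phi i j h [Af IH]|d f f' phi psi h [Af IH] h' [Af' IH']|] //.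
  - by split; [exact: isA_C|rewrite subrr].
  - have AX : isA X by exists w; apply: funA_X.
    split; first exact: isA_M.
    have -> : X * f - io (x1 * phi P) = X * (f - io (phi P)) + y * io (phi P) by rewrite rmorphM; ring.
    by apply: ID; [apply: IM|apply: Iy; apply: isA_C].
  - have AU : isA (U i j) by exists 1%N; apply: funA_U.
    split; first exact: isA_M.
    have -> : U i j * f - io (P.2 i j * phi P) =
        U i j * (f - io (phi P)) + (U i j - io (g (i, j))) * io (phi P).
      have gE : P.2 i j = g (i, j) by rewrite /P mxE.
      by rewrite gE rmorphM; ring.
    apply: ID; [exact: IM|]; apply: (Ig (i, j)); [exact: mem_enum|exact: isA_C].
  split; first exact: isA_D.
  have -> : f + f' - io (phi P + psi P) = (f - io (phi P)) + (f' - io (psi P)) by rewrite rmorphD; ring.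
  exact: ID.
move=> d phi /ev[_]; rewrite sub0r => Iphi; apply/eqP/negPn/negP => pn.
apply: I1; have := IM _ _ (isA_C (- (phi P)^-1)) Iphi.
by rewrite rmorphN mulrNN -rmorphM mulVf // rmorph1.
Qed.

End Fibre.

End Bounds.
End Growth.

(** * Frobenius endomorphisms and powers of power series *)

Definition frobx (p e : nat) (R : comNzRingType) of p \in [pchar R] := fun x : R => x ^+ (p ^ e).

Section Frobx.
Variables (p e : nat) (R : comNzRingType) (ch : p \in [pchar R]).
Fact frobx_is_additive : zmod_morphism (@frobx p e R ch).
Proof.
move=> x y; rewrite /frobx.
have := expr_pchar_sum e [:: x - y; y] id ch; rewrite !big_cons !big_nil !addr0 subrK => ->.
by rewrite addrK.
Qed.
Fact frobx_is_multiplicative : monoid_morphism (@frobx p e R ch).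
Proof. by split=> [|x y]; rewrite /frobx ?expr1n ?exprMn. Qed.
HB.instance Definition _ := GRing.isZmodMorphism.Build R R (@frobx p e R ch) frobx_is_additive.
HB.instance Definition _ := GRing.isMonoidMorphism.Build R R (@frobx p e R ch) frobx_is_multiplicative.
End Frobx.

Lemma ps_expX (k : fieldType) p e (f : pser k) m : p \in [pchar k] -> (0 < e)%N ->
  (f ^+ (p ^ e)) m = if (p ^ e %| m)%N then f (m %/ p ^ e)%N ^+ (p ^ e) else 0.
Proof.
move=> ch e0; set q := (p ^ e)%N.
have q1 : (1 < q)%N.
  by rewrite -(expn0 p) ltn_exp2l // prime_gt1 // (pcharf_prime ch).
have chS : p \in [pchar (pser k)] := rmorph_pchar (@psC k) ch.
elim/ltn_ind: m f => m IH f; have [g fg] := ps_dec f.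
have fE : f ^+ q = psC (f 0%N ^+ q) + psX k ^+ q * g ^+ q.
  rewrite {1}fg rmorphXn -exprMn.
  by have := expr_pchar_sum e [:: psC (f 0%N); psX k * g] id chS; rewrite !big_cons !big_nil !addr0.
rewrite fE psD psXnM /psC; case: (posnP m) => [->|m0].
  by rewrite leqNgt (ltnW q1) dvdn0 div0n addr0.
rewrite add0r; case: leqP => [qm|mq]; last by rewrite gtnNdvd.
rewrite IH; last by rewrite ltn_subrL m0 (ltnW q1).
move: (subnK qm); move: (m - q)%N => m' <-.
rewrite dvdn_addl // divnDr // divnn (ltnW q1) addn1.
case: ifP => // _; congr (_ ^+ _).
by rewrite fg psD psXM add0r.
Qed.

(** * The curve [g^(q) = g (T - x)] for a matrix [T] over a finite field *)

Section Branch.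
Variables (F : finFieldType) (k : closedFieldType) (iF : {rmorphism F -> k}).
Variables (p e : nat) (ch : p \in [pchar k]) (hq : #|F| = (p ^ e)%N).
Variables (n' : nat) (T : 'M[F]_n'.+1).
Local Notation n := n'.+1.
Local Notation q := (p ^ e)%N.
Local Notation w := (p ^ e).-1.

Lemma q_gt1 : (1 < q)%N. Proof. by rewrite -hq finNzRing_gt1. Qed.
Lemma wS_q : w.+1 = q. Proof. by rewrite prednK // ltnW // q_gt1. Qed.
Lemma w_gt0 : (0 < w)%N. Proof. by rewrite -ltnS wS_q q_gt1. Qed.
Lemma e_gt0 : (0 < e)%N. Proof. by have := q_gt1; case: e. Qed.

(* [branch], the series with coefficients [branch_coef m] evaluated at [T], solves
   [u^(q) = u + Z^w u T] with [u = 1 + O(Z)]; comparing coefficients of [Z^j] gives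
   the recursion. *)
Fixpoint branch_rec (s j : nat) : {poly F} :=
  if s is s'.+1 then
    if j == 0%N then 1 else
    (if (q %| j)%N then branch_rec s' (j %/ q) else 0) - (if (w <= j)%N then 'X * branch_rec s' (j - w) else 0)
  else 0.

Lemma branch_rec_stable s s' j : (j < s)%N -> (j < s')%N -> branch_rec s j = branch_rec s' j.
Proof.
elim: s s' j => [|s IH] [|s'] j //=; rewrite !ltnS => js js'.
case: posnP => // j0; congr (_ - _); case: ifP => // h.
  by have := ltn_Pdiv q_gt1 j0 => h1; apply: IH; apply: leq_trans h1 _.
have : (j - w < j)%N by rewrite ltn_subrL w_gt0.
by move=> h1; congr (_ * _); apply: IH; apply: leq_trans h1 _.
Qed.

Definition branch_coef j := branch_rec j.+1 j.

Lemma branch_coefE j : (0 < j)%N ->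
  (if (q %| j)%N then branch_coef (j %/ q) else 0) =
  branch_coef j + (if (w <= j)%N then 'X * branch_coef (j - w) else 0).
Proof.
move=> j0; rewrite /branch_coef [branch_rec j.+1 j]/= gtn_eqF // (@branch_rec_stable j (j %/ q).+1) ?ltn_Pdiv ?q_gt1 //.
by rewrite (@branch_rec_stable j (j - w).+1) ?subrK // ltn_subrL w_gt0.
Qed.

Definition branch : 'M[pser k]_n := \matrix_(i, j) (fun m => iF (horner_mx T (branch_coef m) i j)).

Let Tk : 'M[k]_n := map_mx iF T.

Lemma iF_q c : iF c ^+ q = iF c.
Proof. by rewrite -rmorphXn -hq expf_card. Qed.

Lemma branchE i j : branch i j ^+ w.+1 =
  branch i j + psX k ^+ w * \sum_l psC (Tk l j) * branch i l.
Proof.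
apply: funext => m; rewrite wS_q ps_expX ?e_gt0 // psD psXnM.
have -> : (if (w <= m)%N then (\sum_l psC (Tk l j) * branch i l) (m - w)%N else 0) =
    iF ((if (w <= m)%N then horner_mx T ('X * branch_coef (m - w)) else 0) i j).
  case: ifP => _; last by rewrite mxE rmorph0.
  rewrite mulrC rmorphM /= horner_mx_X mxE rmorph_sum.
  transitivity (\sum_l (psC (Tk l j) * branch i l) (m - w)%N).
    by elim/big_rec2: _ => [|x y1 y2 _]; rewrite ?ps0 // psD => ->.
  by apply: eq_bigr => l _; rewrite psCM !mxE rmorphM mulrC.
rewrite [branch i j]mxE -rmorphD; case: (posnP m) => [->|m0].
  by rewrite dvdn0 div0n [in RHS]leqNgt w_gt0 /= [X in _ + X]mxE addr0 iF_q.
have h := congr1 (fun f => iF (horner_mx T f i j)) (branch_coefE m0).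
transitivity (iF (horner_mx T (if (q %| m)%N then branch_coef (m %/ q) else 0) i j)).
  by case: ifP => _; rewrite ?iF_q // (rmorph0 (horner_mx T)) mxE rmorph0.
rewrite h; congr (iF _); rewrite (rmorphD (horner_mx T)) /= mxE; congr (_ + _).
by case: ifP => _ //; rewrite (rmorph0 (horner_mx T)).
Qed.

Lemma branch0 i j : branch i j 0%N = (i == j)%:R.
Proof. by rewrite mxE /branch_coef /= rmorph1 mxE rmorph_nat. Qed.

Lemma branch00 : branch 0 0 0%N = 1. Proof. by rewrite branch0 eqxx. Qed.

Local Notation L := {fraction (pser k)}.
Let tau : {rmorphism pser k -> L} := @tofrac (pser k).

Lemma tau_inj : injective tau.
Proof. by move=> x y /eqP; rewrite tofrac_eq => /eqP. Qed.

Local Notation io := (cst tau).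
Local Notation X := (Xt tau w).
Local Notation U := (Ut tau branch).
Local Notation Z := (Zt tau).
Local Notation Pol := (@Pol k L io n w X U).
Local Notation funA := (@funA k L io n w X U).
Local Notation onC0 := (@onC0 k L io n w X U).

Definition branch_UE := UE tau_inj branchE.

Definition frobP (P : point k n) : point k n := (P.1 ^+ q, map_mx (frobx e ch) P.2).

Lemma frob_branch i j : ps_map (frobx e ch) (branch i j) = branch i j.
Proof. by apply: funext => m; rewrite /ps_map mxE; apply: iF_q. Qed.

(** [phi'] has the [q]-th roots of the coefficients of [phi]. As the coefficients of [branch] lie in
    [F], the expansion of [f] at infinity is the Frobenius image of that of [f'], so [f'] vanishes
    with [f]. Hence Frobenius preserves the component. *)
Lemma Pol_frob d f phi : Pol d f phi -> exists f' phi' f0,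
  [/\ Pol d f' phi', Z ^+ d * f' = tau f0, Z ^+ d * f = tau (ps_map (frobx e ch) f0) &
      forall P, phi' P ^+ q = phi (frobP P)].
Proof.
have Z0 := Z_neq0 tau_inj.
elim=> {d f phi} [c|d f phi _ [f' [phi' [f0 [h1 h2 h3 h4]]]]|d f phi i j _ [f' [phi' [f0 [h1 h2 h3 h4]]]]
  |d f g phi psi _ [f' [phi' [f0 [h1 h2 h3 h4]]]] _ [g' [psi' [g0 [h1' h2' h3' h4']]]]
  |d d' f phi dd' _ [f' [phi' [f0 [h1 h2 h3 h4]]]]].
- have [y yE] := closed_root c (ltnW q_gt1).
  exists (io y), (fun=> y), (psC y); split; [exact: Pol_C|by rewrite mul1r| |by []].
  by rewrite mul1r ps_mapC; congr (tau (psC _)); rewrite -yE.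
- have ZX g : Z ^+ (d + w) * (X * g) = - (Z ^+ d * g).
    rewrite exprD /X -[RHS]mulrN -mulrA; congr (_ * _).
    by rewrite mulNr mulrN mulrA (ZnV tau_inj) mul1r.
  exists (X * f'), (fun P => P.1 * phi' P), (- f0); split.
  + exact: Pol_X.
  + by rewrite rmorphN -h2 ZX.
  + by rewrite !rmorphN -h3 ZX.
  by move=> P; rewrite exprMn h4.
- have ZU g : Z ^+ d.+1 * (U i j * g) = tau (branch i j) * (Z ^+ d * g).
    rewrite exprS mxE.
    have -> : Z * Z ^+ d * (Z^-1 * tau (branch i j) * g) =
      Z * Z^-1 * (tau (branch i j) * (Z ^+ d * g)) by ring.
    by rewrite mulfV // mul1r.
  exists (U i j * f'), (fun P : point k n => P.2 i j * phi' P), (branch i j * f0); split.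
  + exact: Pol_U.
  + by rewrite rmorphM -h2 ZU.
  + by rewrite rmorphM /= frob_branch rmorphM -h3 ZU.
  by move=> P; rewrite exprMn h4 /frobP /= mxE.
- exists (f' + g'), (fun P => phi' P + psi' P), (f0 + g0); split.
  + exact: Pol_D.
  + by rewrite mulrDr rmorphD h2 h2'.
  + by rewrite mulrDr !rmorphD h3 h3'.
  by move=> P; rewrite -h4 -h4'; apply: (rmorphD (frobx e ch)).
have ZZ g : Z ^+ d' * g = Z ^+ (d' - d) * (Z ^+ d * g) by rewrite mulrA -exprD subnK.
exists f', phi', (psX k ^+ (d' - d) * f0); split => //.
+ exact: Pol_le h1.
+ by rewrite rmorphM rmorphXn ZZ h2.
by rewrite !rmorphM !rmorphXn /= ps_mapX ZZ h3.
Qed.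

Lemma onC0_frob P : onC0 P -> onC0 (frobP P).
Proof.
move=> cP d phi /Pol_frob[f' [phi' [f0 [h1 h2 h3 h4]]]].
rewrite -h4; suff f'0 : f' = 0.
  by rewrite f'0 in h1; rewrite (cP _ _ h1) expr0n gtn_eqF // ltnW // q_gt1.
have f00 : f0 = 0.
  apply: (@ps_map_eq0 _ _ (frobx e ch)); apply: tau_inj.
  by rewrite rmorph0 -h3 mulr0.
apply/eqP; move/eqP: h2; rewrite f00 rmorph0 mulf_eq0 expf_eq0.
by rewrite (negbTE (Z_neq0 tau_inj)) andbF.
Qed.

Lemma onC0_rel P : onC0 P -> map_mx (frobx e ch) P.2 = P.2 *m (Tk - P.1%:M).
Proof.
move=> cP; apply/matrixP => i j; rewrite mulmxBr mul_mx_scalar !mxE /frobx.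
have h1 : Pol q (U i j ^+ q) (fun P => P.2 i j ^+ q).
  by apply: (Pol_eq (Pol_exp q (Pol_coordU io w X U i j))); rewrite ?muln1.
have h2 : Pol q (\sum_l io (Tk l j) * U i l - X * U i j)
    (fun P : point k n => \sum_l Tk l j * P.2 i l - P.1 * P.2 i j).
  apply: Pol_B.
    apply: (@Pol_le _ _ _ _ _ _ _ 1); first by rewrite ltnW // q_gt1.
    by apply: Pol_sum => l; apply: Pol_Z; apply: Pol_coordU.
  apply: (Pol_eq (Pol_M (Pol_coordX io w X U) (Pol_coordU io w X U i j))) => //.
  by rewrite addn1 wS_q.
rewrite -branch_UE wS_q in h2.
rewrite (onC0_eq cP h1 h2); congr (_ - _).
by apply: eq_bigr => l _; rewrite mulrC.
Qed.

Lemma branch_comm : branch *m map_mx (@psC k) Tk = map_mx (@psC k) Tk *m branch.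
Proof.
apply/matrixP => i j; apply: funext => m; rewrite !mxE.
have sumE (J : Type) (r : seq J) (f : J -> pser k) :
    (\sum_(l <- r) f l) m = \sum_(l <- r) f l m.
  by elim/big_rec2: _ => [|x y1 y2 _]; rewrite ?ps0 // psD => ->.
rewrite !sumE; have := congr1 (horner_mx T) (mulrC (branch_coef m) 'X).
rewrite !rmorphM /= horner_mx_X => /matrixP/(_ i j); rewrite !mxE => /(congr1 iF); rewrite !rmorph_sum => h.
transitivity (\sum_l iF (horner_mx T (branch_coef m) i l * T l j)).
  by apply: eq_bigr => l _; rewrite mulrC !mxE psCM rmorphM mulrC.
by rewrite h; apply: eq_bigr => l _; rewrite !mxE psCM rmorphM.
Qed.

Lemma onC0_comm P : onC0 P -> P.2 *m Tk = Tk *m P.2.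
Proof.
move=> cP; apply/matrixP => i j; rewrite !mxE.
have h1 : Pol 1 (\sum_l io (Tk l j) * U i l) (fun P => \sum_l Tk l j * P.2 i l).
  by apply: Pol_sum => l; apply: Pol_Z; apply: Pol_coordU.
have h2 : Pol 1 (\sum_l io (Tk i l) * U l j) (fun P => \sum_l Tk i l * P.2 l j).
  by apply: Pol_sum => l; apply: Pol_Z; apply: Pol_coordU.
have e12 : \sum_l io (Tk l j) * U i l = \sum_l io (Tk i l) * U l j.
  have := branch_comm => /matrixP/(_ i j); rewrite !mxE => /(congr1 (fun f => Z^-1 * tau f)).
  rewrite !rmorph_sum !mulr_sumr => h.
  transitivity (\sum_l Z^-1 * tau (branch i l * map_mx (@psC k) Tk l j)).
    by apply: eq_bigr => l _; rewrite !mxE rmorphM /cst /= mulrC -mulrA.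
  by rewrite h; apply: eq_bigr => l _; rewrite !mxE rmorphM /cst /= mulrCA.
rewrite e12 in h1; rewrite -(onC0_eq cP h1 h2).
by apply: eq_bigr => l _; rewrite mulrC.
Qed.

Lemma Pol_det d (M : 'M[L]_n) (Phi : 'I_n -> 'I_n -> point k n -> k) :
  (forall i j, Pol d (M i j) (Phi i j)) ->
  exists d', Pol d' (\det M) (fun P => \det (\matrix_(i, j) Phi i j P)).
Proof.
move=> h; eexists; rewrite /determinant.
apply: (Pol_eq (Pol_sum (index_enum _) (fun s : 'S_n => Pol_Z ((-1) ^+ s)
  (Pol_prod (index_enum _) (fun i => h i (s i)))))) => [||P]; first exact: leqnn.
  by apply: eq_bigr => s _; rewrite rmorphXn rmorphN1.
by apply: eq_bigr => s _; congr (_ * _); apply: eq_bigr => i _; rewrite mxE.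
Qed.

Lemma U_frob : map_mx (frobx e (pchar_L tau ch)) U = U *m (map_mx io Tk - X%:M).
Proof.
apply/matrixP => i j; rewrite mulmxBr mul_mx_scalar [LHS]mxE [RHS]mxE.
rewrite [(U *m _) i j]mxE [Y in _ + Y]mxE [(X *: U) i j]mxE.
transitivity (U i j ^+ w.+1); first by rewrite wS_q.
rewrite branch_UE; congr (_ - _).
by apply: eq_bigr => l _; rewrite mulrC [map_mx io Tk l j]mxE.
Qed.

Lemma detU_neq0 : \det U != 0.
Proof.
have -> : U = Z^-1 *: map_mx tau branch by apply/matrixP => i j; rewrite !mxE.
rewrite detZ mulf_neq0 ?expf_neq0 ?invr_neq0 ?(Z_neq0 tau_inj) // det_map_mx.
rewrite -(rmorph0 tau) (inj_eq tau_inj).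
pose ev (f : pser k) := f 0%N.
have ev_add : zmod_morphism ev by [].
have ev_mul : monoid_morphism ev by split=> // f g; apply: psM0.
pose evA := GRing.isZmodMorphism.Build _ _ ev ev_add.
pose evM := GRing.isMonoidMorphism.Build _ _ ev ev_mul.
pose evR : {rmorphism pser k -> k} := HB.pack ev evA evM.
apply/eqP => /(congr1 evR); rewrite -det_map_mx rmorph0.
have -> : map_mx evR branch = 1%:M by apply/matrixP => i j; rewrite [LHS]mxE /= /ev branch0 mxE.
by rewrite det1 => /eqP; rewrite oner_eq0.
Qed.

(** At the generic point, take determinants in [U_frob] and cancel [\det U], which is nonzero
    because [branch] starts with the identity. The relation makes the matrix of a point invertible
    unless its first coordinate is an eigenvalue of [T]. *)
Lemma onC0_det P : onC0 P -> \det P.2 ^+ w = \det (Tk - P.1%:M).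
Proof.
move=> cP; have [d1 h1] := Pol_det (fun i j => Pol_coordU io w X U i j).
have hT i j : Pol w ((map_mx io Tk - X%:M) i j) (fun P => Tk i j - P.1 *+ (i == j)).
  rewrite [Y in Pol w Y]mxE [(map_mx io Tk) i j]mxE [Y in _ + Y]mxE [X%:M i j]mxE.
  apply: Pol_B; first exact: Pol_const.
  case: eqP => _; first exact: Pol_coordX.
  by rewrite !mulr0n -(rmorph0 io); apply: Pol_const.
have [d2 h2] := Pol_det hT.
have e12 : \det U ^+ w = \det (map_mx io Tk - X%:M).
  apply: (mulfI detU_neq0); rewrite -exprS wS_q -det_mulmx -U_frob.
  by rewrite det_map_mx.
have h1w := Pol_exp w h1; rewrite e12 in h1w.
have := onC0_eq cP h1w h2.
have -> : (\matrix_(i, j) P.2 i j) = P.2 by apply/matrixP => i j; rewrite mxE.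
by move=> ->; congr (\det _); apply/matrixP => i j; rewrite !mxE.
Qed.

(* The [q ^ N]-Frobenius acts on the fibre above [x] as right multiplication by
   [eta N x]. *)
Definition eta N (x : k) : 'M[k]_n := \prod_(i < N) (Tk - (x ^+ (q ^ i))%:M).

Lemma onC0_iter N x g : onC0 (x, g) ->
  onC0 (x ^+ (q ^ N), g *m eta N x) /\
  forall i j, g i j ^+ (q ^ N) = (g *m eta N x) i j.
Proof.
move=> cP; elim: N => [|N [IH1 IH2]].
  by rewrite /eta big_ord0 expn0 expr1 mulmx1; split=> // i j; rewrite expr1.
have h1 := onC0_frob IH1; have h2 := onC0_rel IH1.
have etaS : g *m eta N.+1 x = map_mx (frobx e ch) (g *m eta N x).
  by rewrite h2 /= -mulmxA /eta big_ord_recr.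
split; first by rewrite etaS expnSr exprM; exact: h1.
by move=> i j; rewrite etaS mxE expnSr exprM IH2.
Qed.

(* The stabilizer of the chosen component of the curve. *)
Definition stabH : {set 'M[F]_n} :=
  [set g | (\det g != 0) && `[< forall P, onC0 P -> onC0 (P.1, map_mx iF g *m P.2) >]].

Lemma stabH1 : 1%:M \in stabH.
Proof.
rewrite inE det1 oner_eq0 /=; apply/asboolP => -[x g] cP.
by rewrite map_mx1 mul1mx.
Qed.

Lemma stabHM g h : g \in stabH -> h \in stabH -> g *m h \in stabH.
Proof.
rewrite !inE => /andP[dg /asboolP hg] /andP[dh /asboolP hh].
rewrite det_mulmx mulf_neq0 //=; apply/asboolP => P cP.
by rewrite map_mxM -mulmxA; apply: (hg (_, _)); apply: hh.
Qed.

(** Frobenius preserves the component and here fixes [x]; its action by right multiplication is also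
    a left multiplication, because [g] commutes with [T]. *)
Lemma onC0_eta N x g (h : 'M[F]_n) : onC0 (x, g) -> x ^+ (q ^ N) = x ->
  eta N x = map_mx iF h -> onC0 (x, map_mx iF h *m g).
Proof.
move=> cP xN eh; have [h1 _] := onC0_iter N cP.
rewrite -eh; suff -> : eta N x *m g = g *m eta N x by rewrite xN in h1.
have comm := onC0_comm cP; rewrite /eta.
elim/big_ind: _ => [|a b ha hb|i _]; first by rewrite mul1mx mulmx1.
  by rewrite -[LHS]mulmxA hb mulmxA ha -mulmxA.
by rewrite mulmxBl mulmxBr /= comm scalar_mxC.
Qed.

Lemma Pol_lmul (h : 'M[F]_n) d f phi : Pol d f phi ->
  exists f', Pol d f' (fun P => phi (P.1, map_mx iF h *m P.2)).
Proof.
elim=> {d f phi} [c|d f phi _ [f' h1]|d f phi i j _ [f' h1]|d f g phi psi _ [f' h1] _ [g' h2]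
   |d d' f phi dd' _ [f' h1]].
- by exists (io c); apply: Pol_C.
- by exists (X * f'); apply: (Pol_X h1).
- exists ((\sum_l io (iF (h i l)) * U l j) * f').
  have hU : Pol 1 (\sum_l io (iF (h i l)) * U l j) (fun P => (map_mx iF h *m P.2) i j).
    apply: (Pol_eq (Pol_sum (index_enum _) (fun l => Pol_Z (iF (h i l)) (Pol_coordU io w X U l j)))) => // P.
    by rewrite mxE; apply: eq_bigr => l _; rewrite mxE.
  exact: (Pol_M hU h1).
- by exists (f' + g'); apply: (Pol_D h1 h2).
by exists f'; apply: Pol_le h1.
Qed.

Definition nonsingular_fixed N (x : k) := x ^+ (q ^ N) = x /\ \det (Tk - x%:M) != 0.

Lemma onC0_unit x g : onC0 (x, g) -> \det (Tk - x%:M) != 0 -> g \in unitmx.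
Proof.
move=> /onC0_det /= dE dn; rewrite unitmxE unitfE; apply: contraNneq dn => d0.
by rewrite -dE d0 expr0n gtn_eqF ?w_gt0.
Qed.

(** Above each [x] of the list lie [#|stabH|] points of the component, the translates of one of them
    by [stabH], and Frobenius acts on all of them through the same matrix [h]. Stepanov's bound
    applies to the set of all these points. *)
Lemma stab_count_le : exists C R0, forall mu N (h : 'M[F]_n) (xs : seq k),
  (p ^ mu * p ^ mu = q ^ N)%N -> (R0 <= p ^ mu)%N -> uniq xs ->
  (forall x, x \in xs -> nonsingular_fixed N x /\ eta N x = map_mx iF h) ->
  (size xs * #|stabH| <= p ^ mu * p ^ mu + C * p ^ mu)%N.
Proof.
have [a [J [delta [ha d0 nJ lin]]]] := growth tau_inj w_gt0 branchE.
have [C [R0 st]] := stepanov_bound tau_inj w_gt0 branch00 ha lin ch d0.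
exists C, R0 => mu N h xs RN R0R uxs hxs.
have /choice[g hg] : forall x, exists g, onC0 (x, g).
  by move=> x; exact: (fibre_nonempty tau_inj w_gt0 branchE ha lin ch x nJ).
pose pt (x : k) (c : 'M[F]_n) : point k n := (x, map_mx iF c *m g x).
have uE x (c c' : 'M[F]_n) : x \in xs -> map_mx iF c *m g x = map_mx iF c' *m g x -> c = c'.
  move=> xxs; have [[_ gx] _] := hxs _ xxs; have ug := onC0_unit (hg x) gx.
  move/(congr1 (mulmx ^~ (invmx (g x)))); rewrite !(mulmxK ug).
  exact: map_mx_inj.
have := st mu (map_mx iF h) [seq pt x c | x <- xs, c <- enum stabH] R0R.
rewrite size_allpairs -cardE; apply.
  apply: allpairs_uniq => //; first exact: enum_uniq.
  move=> [x c] [x' c'] /allpairsP[[y d] /= [yxs _ [-> ->]]] /allpairsP[[y' d'] /= [_ _ [-> ->]]].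
  by rewrite /pt => -[<-] /(uE _ _ _ yxs) ->.
move=> P /allpairsP[[x c] /= [xxs]]; rewrite mem_enum inE => /andP[_ /asboolP hc] ->.
have cP : onC0 (pt x c) by apply: hc (hg x).
split=> //; have [[xN _] eN] := hxs _ xxs; have [_ h2] := onC0_iter N cP.
by rewrite RN; split=> //= i j; rewrite h2 eN.
Qed.

Lemma size_filter_sum (I : finType) (S : eqType) (P : I -> pred S) (s : seq S) :
  (forall x, x \in s -> exists i, P i x) -> (size s <= \sum_i size (filter (P i) s))%N.
Proof.
elim: s => [|x s IH] h //=; have [i0 Pi] := h x (mem_head _ _).
have {}IH := IH (fun y ys => h y (mem_behead (s := x :: s) ys)).
apply: (@leq_trans (\sum_i (P i x + size (filter (P i) s)))%N); last first.
  by apply: leq_sum => i _; case: (P i x).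
by rewrite big_split /= -add1n leq_add // (bigD1 i0) //= Pi.
Qed.

(** If [h] moves the component off itself, some polynomial vanishes on the component while its
    translate by [h] does not; points above the [x] of class [h] are among the finitely many zeros
    of the translate. The bound does not involve [N], and there are finitely many [h]. *)
Lemma nonstab_count_bounded : exists C, forall N (xs : seq k), uniq xs ->
  (forall x, x \in xs -> nonsingular_fixed N x /\ exists2 h : 'M[F]_n, h \notin stabH & eta N x = map_mx iF h) ->
  (size xs <= C)%N.
Proof.
have [a [J [delta [ha d0 nJ lin]]]] := growth tau_inj w_gt0 branchE.
have /choice[g hg] : forall x, exists g, onC0 (x, g).
  by move=> x; exact: (fibre_nonempty tau_inj w_gt0 branchE ha lin ch x nJ).
have /choice[C hC] : forall h : 'M[F]_n, exists C, forall N (xs : seq k), uniq xs ->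
    h \notin stabH -> (forall x, x \in xs -> nonsingular_fixed N x /\ eta N x = map_mx iF h) -> (size xs <= C)%N.
  move=> h; have [hH|hH] := boolP (h \in stabH); first by exists 0%N.
  (* A singular [h] does not occur: [g x *m eta N x] belongs to a point above [x] again, so it is
     invertible. *)
  have [dh|dh] := eqVneq (\det h) 0.
    exists 0%N => N [|x xs] // _ _ /(_ x (mem_head _ _))[[xN gx] ex].
    have [h1 _] := onC0_iter N (hg x); have := onC0_unit h1; rewrite xN => /(_ gx).
    by rewrite unitmxE det_mulmx ex det_map_mx dh rmorph0 mulr0 unitr0.
  move: (hH); rewrite inE dh /= => /asboolPn nst.
  have [P0 [d [phi [cP0 h0 phiP0]]]] : exists P0 d phi,
      [/\ onC0 P0, Pol d 0 phi & phi (P0.1, map_mx iF h *m P0.2) != 0].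
    apply: contrapT => nex; apply: nst => P cP d phi h0.
    by apply/eqP/negPn/negP => hn; apply: nex; exists P, d, phi.
  have [f' hf'] := Pol_lmul h h0.
  have fn : f' != 0.
    apply: contraNneq phiP0 => f0; rewrite f0 in hf'.
    by apply/eqP; apply: (cP0 _ _ hf').
  exists (delta * d)%N => N xs uxs _ hxs.
  rewrite -(size_map (fun x => (x, g x) : point k n)).
  apply: (zeros_le w_gt0 ha lin _ fn hf').
  - by eexists; apply: Pol_le hf'; rewrite leq_pmull // w_gt0.
  - by rewrite map_inj_uniq // => x y [].
  move=> _ /mapP[x xxs ->]; split; first exact: hg.
  have [[xN gx] ex] := hxs _ xxs.
  exact: (onC0_eta (hg x) xN ex h0).
exists (\sum_h C h)%N => N xs uxs hxs.
apply: leq_trans (size_filter_sum (P := fun (h : 'M[F]_n) x => (eta N x == map_mx iF h) && (h \notin stabH)) _) _.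
  by move=> x /hxs[_ [h hH eh]]; exists h; rewrite eh eqxx.
apply: leq_sum => h _; case: (boolP (h \in stabH)) => hH.
  by rewrite (eq_filter (a2 := pred0)) ?filter_pred0 // => x; rewrite andbF.
apply: (hC h N) => //; first exact: filter_uniq.
move=> x; rewrite mem_filter andbT => /andP[/eqP ex /hxs[gx _]]; by [].
Qed.

End Branch.

(** * Monic irreducible polynomials and points over finite extensions *)

Definition isprime (F : finFieldType) (p : {poly F}) : bool :=
  `[< p \is monic /\ irreducible_poly p >].

Section Primes.
Variable F : finFieldType.
Implicit Types f g p : {poly F}.

Lemma isprimeP p : reflect (p \is monic /\ irreducible_poly p) (isprime p).
Proof. exact: asboolP. Qed.

Lemma isprime_size p : isprime p -> (1 < size p)%N.
Proof. by move=> /isprimeP[_ []]. Qed.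

Lemma isprime_deg p : isprime p -> (0 < deg p)%N.
Proof. by move/isprime_size; rewrite /deg; case: (size p) => [|[]]. Qed.

Lemma isprime_monic p : isprime p -> p \is monic.
Proof. by move=> /isprimeP[]. Qed.

Lemma isprime_neq0 p : isprime p -> p != 0.
Proof. by move/isprime_monic/monic_neq0. Qed.

Lemma size_deg f : f != 0 -> size f = (deg f).+1.
Proof. by rewrite /deg -size_poly_gt0; case: (size f). Qed.

Lemma isprime_dvd_eq p p' : isprime p -> isprime p' -> p %| p' -> p = p'.
Proof.
move=> pp pp' dv; have /isprimeP[_ [_ ir]] := pp'; apply/eqP.
rewrite -eqp_monic ?isprime_monic //; apply: ir dv.
by rewrite gtn_eqF // isprime_size.
Qed.

Lemma isprime_coprime p f : isprime p -> coprimep p f = ~~ (p %| f).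
Proof. by move=> /isprimeP[_ ip]; apply: irreducible_poly_coprime. Qed.

Lemma prime_factor f : (1 < size f)%N -> exists2 p, isprime p & p %| f.
Proof.
move=> sf; pose Q s := `[< exists2 g : {poly F}, (1 < size g)%N /\ g %| f & size g = s >].
have exQ : exists s, Q s by exists (size f); apply/asboolP; exists f.
case: (ex_minnP exQ) => s /asboolP[g [sg gf] gs] smin.
have g0 : g != 0 by rewrite -size_poly_gt0 ltnW.
have lg : lead_coef g != 0 by rewrite lead_coef_eq0.
exists ((lead_coef g)^-1 *: g); last by rewrite dvdpZl // invr_eq0.
apply/isprimeP; split; first by rewrite monicE lead_coefZ mulVf.
split; first by rewrite size_scale // invr_eq0.
move=> h sh; rewrite dvdpZr ?invr_eq0 // => hg.
have h0 : h != 0 by apply: contraNneq g0 => h0; rewrite -dvd0p -h0.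
have : (s <= size h)%N.
  apply: smin; apply/asboolP; exists h => //; split; last exact: dvdp_trans gf.
  by rewrite ltn_neqAle eq_sym sh size_poly_gt0.
rewrite -gs => sgh; rewrite /eqp dvdpZl ?dvdpZr ?invr_eq0 // hg /=.
by have := dvdp_size_eqp hg; rewrite eqn_leq sgh dvdp_leq // => /esym; rewrite /eqp hg.
Qed.

Lemma prime_power p f : isprime p -> f \is monic ->
  (forall p', isprime p' -> p' %| f -> p' = p) -> exists s, f = p ^+ s.
Proof.
move=> pp; elim: {f}(size f) {-2}f (leqnn (size f)) => [|s IH] f.
  by rewrite leqn0 size_poly_eq0 => /eqP -> /monic_neq0; rewrite eqxx.
move=> sf mf h; have [s1|s1] := leqP (size f) 1.
  exists 0%N; rewrite expr0; apply/eqP; rewrite -eqp_monic ?monic1 //.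
  by rewrite -size_poly_eq1 eqn_leq s1 size_poly_gt0 monic_neq0.
have [p' pp' p'f] := prime_factor s1; have p'p := h _ pp' p'f.
have /dvdpP[g fE] : p %| f by rewrite -p'p.
have mg : g \is monic by move: mf; rewrite fE monicMr // isprime_monic.
have [||t gE] := IH g _ mg.
- have := sf; rewrite fE size_Mmonic ?monic_neq0 // ?isprime_monic //.
  by have := isprime_size pp; lia.
- by move=> p'' pp'' p''g; apply: h => //; rewrite fE dvdp_mulr.
by exists t.+1; rewrite fE gE exprSr.
Qed.

End Primes.

Section Points.
Variables (F : finFieldType) (k : closedFieldType) (iF : {rmorphism F -> k}).
Variables (p e : nat) (ch : p \in [pchar k]) (hq : #|F| = (p ^ e)%N).
Local Notation q := (p ^ e)%N.
Local Notation "f ^k" := (map_poly iF f) (at level 2, format "f ^k").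

Local Notation q_gt1 := (q_gt1 hq).

Lemma frobn_inj N : injective (fun x : k => x ^+ (q ^ N)).
Proof.
move=> x y /= h; apply/eqP; rewrite -subr_eq0.
have : frobx (e * N) ch (x - y) == 0.
  by rewrite rmorphB /= /frobx !expnM h subrr.
by rewrite expf_eq0 => /andP[].
Qed.

Lemma frob_fixed (c : k) : c ^+ q = c -> exists a, c = iF a.
Proof.
move=> cq; have := congr1 (fun f : {poly k} => f.[c]) (congr1 (map_poly iF) (finField_genPoly F)).
rewrite /= rmorphB /= map_polyXn map_polyX hq !hornerE cq subrr rmorph_prod horner_prod.
move=> /esym/eqP; rewrite prodf_seq_eq0 => /hasP[a _ /=].
rewrite rmorphB /= map_polyX map_polyC hornerXsubC subr_eq0 => /eqP ->.
by exists a.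
Qed.

Lemma poly_fixed (f : {poly k}) : (forall i, f`_i ^+ q = f`_i) -> exists g, f = g^k.
Proof.
move=> h; have /choice[a ha] : forall i, exists a, f`_i = iF a by move=> i; apply: frob_fixed.
exists (\poly_(i < size f) a i); apply/polyP => i.
rewrite coef_map coef_poly; case: ltnP => si; first exact: ha.
by rewrite nth_default //; apply/esym/rmorph0.
Qed.

Definition conjpoly N (x : k) : {poly k} := \prod_(i < N) ('X - (x ^+ (q ^ i))%:P).

Lemma conjpoly_fixed N x : x ^+ (q ^ N) = x -> exists g, conjpoly N x = g^k.
Proof.
move=> xN; apply: poly_fixed => i.
transitivity ((map_poly (frobx e ch) (conjpoly N x))`_i); first by rewrite coef_map.
suff -> : map_poly (frobx e ch) (conjpoly N x) = conjpoly N x by [].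
rewrite /conjpoly rmorph_prod.
case: N xN => [|N] xN; first by rewrite !big_ord0.
rewrite big_ord_recr [RHS]big_ord_recl [LHS]mulrC /=; congr (_ * _).
  rewrite rmorphB /= map_polyX map_polyC /= /frobx -exprM -expnSr xN expn0 expr1; by [].
apply: eq_bigr => j _; rewrite rmorphB /= map_polyX map_polyC /= /frobx -exprM -expnSr.
by [].
Qed.

(** The norm of ['X - x] from the field with [q ^ N] elements down to [F], for [x] in that field; 0
    is a junk value. *)
Definition nrm N (x : k) : {poly F} :=
  if pselect (exists g, conjpoly N x = g^k) is left ex then projT1 (cid ex) else 0.

Lemma nrmE N x : x ^+ (q ^ N) = x -> (nrm N x)^k = conjpoly N x.
Proof.
move=> xN; rewrite /nrm; case: pselect => [ex|nex]; first by case: (cid ex).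
by case: nex; apply: conjpoly_fixed.
Qed.

Lemma nrm_monic N x : x ^+ (q ^ N) = x -> nrm N x \is monic.
Proof. by move=> xN; rewrite -(map_monic iF) nrmE // monic_prod_XsubC. Qed.

Lemma nrm_deg N x : x ^+ (q ^ N) = x -> deg (nrm N x) = N.
Proof.
move=> xN; rewrite /deg -(size_map_poly iF) nrmE // size_prod_XsubC.
by rewrite /index_enum -enumT size_enum_ord.
Qed.

Lemma eta_nrm n' (T : 'M[F]_n'.+1) N x : x ^+ (q ^ N) = x ->
  eta iF p e T N x = map_mx iF (horner_mx T (nrm N x)).
Proof.
move=> xN; rewrite map_horner_mx nrmE // rmorph_prod; apply: eq_bigr => i _.
by rewrite rmorphB /= horner_mx_X horner_mx_C.
Qed.

Lemma horner_frob (f : {poly F}) x i : f^k.[x ^+ (q ^ i)] = f^k.[x] ^+ (q ^ i).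
Proof.
elim: i => [|i IH]; first by rewrite expn0 !expr1.
rewrite !expnSr !exprM -IH -[RHS]/(frobx e ch _) -horner_map /=; congr (_.[_]).
apply/polyP => j; rewrite !coef_map /= /frobx -rmorphXn -hq expf_card; by [].
Qed.

Lemma root_frob (f : {poly F}) x i : root f^k (x ^+ (q ^ i)) = root f^k x.
Proof.
by rewrite /root horner_frob expf_eq0 expn_gt0 (ltnW q_gt1).
Qed.

Lemma prime_root_uniq p1 p2 x : isprime p1 -> isprime p2 ->
  root p1^k x -> root p2^k x -> p1 = p2.
Proof.
move=> pp1 pp2 r1 r2; apply: isprime_dvd_eq => //.
apply: contraTT isT => np; have : coprimep p1^k p2^k by rewrite coprimep_map isprime_coprime.
by move=> /coprimep_root/(_ r1); rewrite (rootP r2) eqxx.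
Qed.

Lemma nrm_prime_root N x p' : x ^+ (q ^ N) = x -> isprime p' -> p' %| nrm N x -> root p'^k x.
Proof.
move=> xN pp' dv; have /closed_rootP[y ry] : size p'^k != 1%N.
  by rewrite size_map_poly gtn_eqF // isprime_size.
have : root (nrm N x)^k y by apply: root_dvdp ry; rewrite dvdp_map.
rewrite nrmE // rootE horner_prod prodf_seq_eq0 => /hasP[i _ /=].
rewrite hornerXsubC subr_eq0 => /eqP yE.
by rewrite yE root_frob in ry.
Qed.

Lemma nrm_power N x p' : x ^+ (q ^ N) = x -> (0 < N)%N -> isprime p' -> root p'^k x ->
  (deg p' %| N)%N /\ nrm N x = p' ^+ (N %/ deg p').
Proof.
move=> xN N0 pp' rx; have [|s sE] := prime_power pp' (nrm_monic xN).
  move=> p'' pp'' dv; apply: (prime_root_uniq pp'' pp' _ rx).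
  exact: nrm_prime_root dv.
have dE : N = (s * deg p')%N.
  by rewrite -{1}(nrm_deg xN) sE /deg size_exp mulnC.
by rewrite sE dE dvdn_mull // mulnK // isprime_deg.
Qed.

Lemma nrm_prime N x : x ^+ (q ^ N) = x -> (0 < N)%N ->
  exists2 p', isprime p' & root p'^k x.
Proof.
move=> xN N0; have [|p' pp' dv] := @prime_factor _ (nrm N x).
  by rewrite size_deg ?nrm_deg // monic_neq0 // nrm_monic.
by exists p' => //; apply: nrm_prime_root dv.
Qed.

(** The first [deg p' + 1] conjugates of [x] are roots of [p'], so two of them coincide; by
    [nrm_power] every period is a multiple of [deg p'], which leaves only [deg p'] itself. *)
Lemma prime_period p' x : isprime p' -> root p'^k x ->
  x ^+ (q ^ deg p') = x /\ forall i j, (i < j < deg p')%N -> x ^+ (q ^ i) != x ^+ (q ^ j).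
Proof.
move=> pp' rx.
have per i j : (i < j)%N -> x ^+ (q ^ i) = x ^+ (q ^ j) -> x ^+ (q ^ (j - i)) = x.
  move=> ij h; apply: (@frobn_inj i).
  by rewrite /= -exprM -expnD subnK ?(ltnW ij).
have perd i j : (i < j)%N -> x ^+ (q ^ i) = x ^+ (q ^ j) -> (deg p' %| j - i)%N.
  move=> ij h; have := per _ _ ij h => xm.
  by have [] := nrm_power xm (etrans (subn_gt0 _ _) ij) pp' rx.
have dist i j : (i < j < deg p')%N -> x ^+ (q ^ i) != x ^+ (q ^ j).
  move=> /andP[ij jd]; apply/eqP => /(perd _ _ ij) /dvdn_leq.
  by rewrite subn_gt0 ij leqNgt (leq_ltn_trans (leq_subr _ _) jd) => /(_ isT).
split=> //.
pose xs := [seq x ^+ (q ^ i) | i <- iota 0 (deg p').+1].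
have : ~~ uniq xs.
  apply/negP => uxs; have := max_poly_roots (p := p'^k) (rs := xs).
  rewrite map_poly_eq0 isprime_neq0 // => /(_ isT) h.
  have : (size xs < size p'^k)%N.
    apply: h => //; apply/allP => _ /mapP[i _ ->]; by rewrite root_frob.
  by rewrite size_map size_iota size_map_poly (size_deg (isprime_neq0 pp')) ltnn.
move=> /(uniqPn 0)[i [j [ij]]]; rewrite size_map size_iota ltnS => jd.
have jd' : (j < (deg p').+1)%N by [].
have id' : (i < (deg p').+1)%N := ltn_trans ij jd'.
rewrite !(nth_map 0%N) ?size_iota // !nth_iota // !add0n => h.
have := perd _ _ ij h => dv; have xm := per _ _ ij h.
have /eqP jE : (j - i)%N == deg p'.
  by rewrite eqn_leq (leq_trans (leq_subr _ _) jd) dvdn_leq // subn_gt0.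
by rewrite -jE.
Qed.

Lemma froots_exist N : (0 < N)%N -> exists rs : seq k,
  [/\ uniq rs, size rs = (q ^ N)%N & forall x, (x \in rs) = (x ^+ (q ^ N) == x)].
Proof.
move=> N0; pose P : {poly k} := 'X^(q ^ N) - 'X.
have qN1 : (1 < q ^ N)%N by rewrite -(expn0 q) ltn_exp2l // q_gt1.
have sP : size P = (q ^ N).+1.
  by rewrite /P size_polyDl ?size_polyXn // size_polyN size_polyX.
have [rs PE] := closed_field_poly_normal P.
have lP : lead_coef P = 1.
  by rewrite /P lead_coefDl ?lead_coefXn // size_polyXn size_polyN size_polyX.
rewrite lP scale1r in PE.
exists rs; split.
- rewrite -separable_prod_XsubC -PE unlock /P derivB derivX derivXn -mulr_natr.
  have chP : p \in [pchar {poly k}] by apply: rmorph_pchar (@polyC k) _ ch.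
  have -> : (q ^ N)%:R = 0 :> {poly k}.
    apply/eqP; rewrite -(dvdn_pcharf chP) -expnM dvdn_exp // muln_gt0 N0 andbT.
    by have := q_gt1; case: (e).
  by rewrite mulr0 sub0r -[- 1]scaleN1r coprimepZr ?oppr_eq0 ?oner_eq0 // coprimep1.
- by apply/eqP; rewrite -eqSS -sP PE size_prod_XsubC.
move=> x; have := root_prod_XsubC rs x; rewrite -PE => <-.
by rewrite /root /P !hornerE subr_eq0.
Qed.

Definition froots N : seq k :=
  if pselect (0 < N)%N is left N0 then projT1 (cid (froots_exist N0)) else [::].

Lemma frootsP N : (0 < N)%N ->
  [/\ uniq (froots N), size (froots N) = (q ^ N)%N &
    forall x, (x \in froots N) = (x ^+ (q ^ N) == x)].
Proof. by move=> N0; rewrite /froots; case: pselect => // N0'; case: (cid _). Qed.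

Lemma mem_froots N x : (0 < N)%N -> x \in froots N -> x ^+ (q ^ N) = x.
Proof. by move=> N0; have [_ _ ->] := frootsP N0 => /eqP. Qed.

Lemma count_prime_roots N p' : (0 < N)%N -> isprime p' -> (deg p' %| N)%N ->
  count (root p'^k) (froots N) = deg p'.
Proof.
move=> N0 pp' dN; have [ufr _ mfr] := frootsP N0.
have /closed_rootP[x rx] : size p'^k != 1%N.
  by rewrite size_map_poly gtn_eqF // isprime_size.
have [xd dist] := prime_period pp' rx.
pose xs := [seq x ^+ (q ^ i) | i <- iota 0 (deg p')].
have uxs : uniq xs.
  rewrite map_inj_in_uniq ?iota_uniq // => i j; rewrite !mem_iota /= !add0n => id jd h.
  case: (ltngtP i j) => // ij.
    by have := dist i j; rewrite ij jd h eqxx => /(_ isT).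
  by have := dist j i; rewrite ij id h eqxx => /(_ isT).
rewrite -size_filter -[RHS](size_iota 0) -(size_map (fun i => x ^+ (q ^ i)) (iota _ _)).
apply/perm_size/uniq_perm => //; first exact: filter_uniq.
move=> y; rewrite mem_filter mfr; apply/andP/idP => [[ry _]|/mapP[i _ ->]].
  have [_ pE] := nrm_power xd (isprime_deg pp') pp' rx.
  rewrite divnn (isprime_deg pp') expr1 in pE.
  have : root (nrm (deg p') x)^k y by rewrite pE.
  rewrite nrmE // rootE horner_prod prodf_seq_eq0 => /hasP[i _ /=].
  rewrite hornerXsubC subr_eq0 => /eqP ->; apply/mapP; exists (val i) => //.
  by rewrite mem_iota /= add0n ltn_ord.
split; first by rewrite root_frob.
apply/eqP; rewrite -exprM mulnC exprM; congr (_ ^+ _).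
move/dvdnP: dN => [m ->]; rewrite mulnC expnM.
elim: m => [|m IH]; first by rewrite expn0 expr1.
by rewrite expnS exprM xd.
Qed.

(** Points are grouped by their minimal polynomials: a prime of degree [d] dividing [N] has [d]
    roots, and the norm of each root is the power of the prime with exponent [N %/ d]. *)
Lemma sum_points (V : comNzRingType) (G : {poly F} -> V) N : (0 < N)%N ->
  \sum_(x <- froots N) G (nrm N x) =
  \sum_(d < N.+1 | (0 < d)%N && (d %| N)%N)
    \sum_(f in monics F d | isprime (val f)) (G (val f ^+ (N %/ d))) *+ d.
Proof.
move=> N0.
transitivity (\sum_(x <- froots N) \sum_(d < N.+1 | (0 < d)%N && (d %| N)%N)
    \sum_(f in monics F d | isprime (val f)) (G (val f ^+ (N %/ d))) *+ (root (val f)^k x)).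
  rewrite !big_seq; apply: eq_bigr => x /(mem_froots N0) xN.
  have [p0 pp0 r0] := nrm_prime xN N0.
  have [dN nE] := nrm_power xN N0 pp0 r0.
  have dN' : (deg p0 < N.+1)%N by rewrite ltnS dvdn_leq.
  have sp0 : (size p0 <= (deg p0).+1)%N by rewrite size_deg ?isprime_neq0.
  rewrite (bigD1 (Ordinal dN')) /= ?isprime_deg //.
  rewrite (bigD1 (NPoly sp0)) /=; last first.
    by rewrite inE /= isprime_monic // size_deg ?isprime_neq0 // eqxx.
  rewrite r0 mulr1n -nE big1 ?addr0 => [|f /andP[/andP[fm fp] fn]]; last first.
    case rf : (root _ _) => //; case/eqP: fn; apply: val_inj => /=.
    exact: (prime_root_uniq fp pp0 rf r0).
  rewrite big1 ?addr0 // => d /andP[_ dn]; rewrite big1 // => f /andP[fm fp].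
  case rf : (root _ _) => //; case/eqP: dn; apply: val_inj => /=.
  rewrite -(prime_root_uniq fp pp0 rf r0) /deg; move: fm; rewrite inE => /andP[_ /eqP ->].
  by [].
rewrite exchange_big; apply: eq_bigr => d /andP[d0 dN].
rewrite exchange_big; apply: eq_bigr => f /andP[fm fp].
have df : deg (val f) = d by rewrite /deg; move: fm; rewrite inE => /andP[_ /eqP ->].
have cE : count (root (val f)^k) (froots N) = d by rewrite count_prime_roots ?df.
transitivity (G (val f ^+ (N %/ d)) *+ count (root (val f)^k) (froots N)).
  2: by congr (_ *+ _).
elim: (froots N) => [|x s IH]; first by rewrite big_nil mulr0n.
by rewrite big_cons IH /= -mulrnDr.
Qed.

End Points.

(** * Power sums and Newton's identities *)

Section Cabs.
Variable R : realType.
Implicit Types x y z : R[i].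

Lemma cabs0 : cabs (0 : R[i]) = 0. Proof. exact: ComplexField.Normc.normc0. Qed.
Lemma cabs1 : cabs (1 : R[i]) = 1. Proof. exact: ComplexField.Normc.normc1. Qed.
Lemma cabsM x y : cabs (x * y) = cabs x * cabs y.
Proof. exact: ComplexField.Normc.normcM. Qed.
Lemma cabs_eq0 x : (cabs x == 0) = (x == 0).
Proof.
apply/eqP/eqP => [|->]; last exact: cabs0.
exact: ComplexField.Normc.eq0_normc.
Qed.
Lemma cabs_ge0 x : 0 <= cabs x.
Proof. by case: x => a b; rewrite /cabs /= sqrtr_ge0. Qed.
Lemma cabsD x y : cabs (x + y) <= cabs x + cabs y.
Proof. exact: le_normcD. Qed.
Lemma cabsN x : cabs (- x) = cabs x.
Proof. exact: normcN. Qed.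
Lemma cabsB x y : cabs (x - y) <= cabs x + cabs y.
Proof. by rewrite -(cabsN y) cabsD. Qed.
Lemma cabsX x m : cabs (x ^+ m) = cabs x ^+ m.
Proof. by elim: m => [|m IH]; rewrite ?cabs1 // !exprS cabsM IH. Qed.
Lemma cabsV x : cabs x^-1 = (cabs x)^-1.
Proof. exact: ComplexField.Normc.normcV. Qed.
Lemma cabs_real (a : R) : cabs a%:C = `|a|.
Proof. by rewrite /cabs /= expr0n /= addr0 sqrtr_sqr. Qed.
Lemma cabs_nat m : cabs (m%:R : R[i]) = m%:R.
Proof. by rewrite -(rmorph_nat (real_complex R)) cabs_real ger0_norm. Qed.
Lemma cabs_sum (J : Type) (r : seq J) (P : pred J) (f : J -> R[i]) :
  cabs (\sum_(i <- r | P i) f i) <= \sum_(i <- r | P i) cabs (f i).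
Proof.
elim/big_rec2: _ => [|i y x _ h]; first by rewrite cabs0.
by apply: le_trans (cabsD _ _) _; rewrite lerD2l.
Qed.
Lemma cabs_gt0 x : (0 < cabs x) = (x != 0).
Proof. by rewrite lt0r cabs_ge0 cabs_eq0 andbT. Qed.

Lemma geometric_unbounded (a : R) K J0 :
  1 < a -> exists2 J, (J0 <= J)%N & K < a ^+ J.
Proof.
move=> a1; pose d := a - 1; have d0 : 0 < d by rewrite subr_gt0.
have bern m : 1 + m%:R * d <= a ^+ m.
  elim: m => [|m IH]; first by rewrite mul0r addr0.
  have a0 : 0 <= a by apply: ltW; apply: lt_trans a1.
  rewrite exprS; apply: le_trans (ler_wpM2l a0 IH).
  have -> : a = 1 + d by rewrite addrC subrK.
  have : 0 <= m%:R * d * d by rewrite !mulr_ge0 // ltW.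
  by rewrite -natr1; nra.
pose J := maxn J0 (Num.bound (`|K| / d)).
exists J; first exact: leq_maxl.
apply: lt_le_trans (bern J).
have : `|K| / d < J%:R.
  apply: lt_le_trans (archi_boundP _) _; first by rewrite divr_ge0 // ltW.
  by rewrite ler_nat leq_maxr.
rewrite ltr_pdivrMr // => h; have := ler_norm K; lra.
Qed.

(* A polynomial that vanishes at all the [x] in [b0 :: s] other than [b] turns the
   power sums into a multiple of [b ^+ J]; the weight [c >= 0] of [b0] cannot cancel
   that multiple even if [b0 = b]. *)
Lemma power_sum_bound (s : seq R[i]) (c K B : R) (b0 : R[i]) J0 :
  0 <= c -> 0 < B ->
  (forall J, (J0 <= J)%N ->
    cabs (\sum_(b <- s) b ^+ J + c%:C * b0 ^+ J) <= K * B ^+ J) ->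
  forall b, b \in s -> cabs b <= B.
Proof.
move=> c0 B0 h b bs; rewrite leNgt; apply/negP => Bb.
pose t := [seq x <- b0 :: s | x != b].
pose Q : {poly R[i]} := \prod_(x <- t) ('X - x%:P).
have Qt x : x \in t -> Q.[x] = 0 by move=> xt; apply/rootP; rewrite root_prod_XsubC.
have Qb : Q.[b] != 0.
  rewrite -rootE root_prod_XsubC mem_filter eqxx //.
have Qx x : x \in b0 :: s -> Q.[x] = Q.[b] *+ (x == b).
  move=> xs; case: eqVneq => [->|xb]; first by rewrite mulr1n.
  by rewrite mulr0n Qt // mem_filter xb.
pose S J := \sum_(x <- s) x ^+ J + c%:C * b0 ^+ J.
pose W : R := (count_mem b s)%:R + c *+ (b0 == b).
have W1 : 1 <= W.
  rewrite /W; have : (0 < count_mem b s)%N by rewrite -has_count has_pred1.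
  rewrite -(ler_nat R) => h1; have : 0 <= c *+ (b0 == b) by rewrite mulrn_wge0.
  by lra.
have SQ J : \sum_(j < size Q) Q`_j * S (J + j)%N = W%:C * Q.[b] * b ^+ J.
  have horn x : \sum_(j < size Q) Q`_j * x ^+ (J + j) = Q.[x] * x ^+ J.
    rewrite horner_coef mulr_suml; apply: eq_bigr => j _.
    by rewrite exprD; ring.
  rewrite /S; under eq_bigr do rewrite mulrDr mulr_sumr.
  rewrite big_split /= exchange_big /=.
  rewrite (eq_bigr (fun x => Q.[x] * x ^+ J)) => [|x _]; last exact: horn.
  have -> : \sum_(j < size Q) Q`_j * (c%:C * b0 ^+ (J + j)) = c%:C * (Q.[b0] * b0 ^+ J).
    by rewrite -horn mulr_sumr; apply: eq_bigr => j _; ring.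
  rewrite Qx ?mem_head // big_seq (eq_bigr (fun x => (Q.[b] * b ^+ J) *+ (x == b))); last first.
    move=> x xs; rewrite Qx ?inE ?xs ?orbT //; case: eqP => [->|_] //.
    by rewrite mulr0n mul0r.
  rewrite -big_seq; have -> : \sum_(i <- s) Q.[b] * b ^+ J *+ (i == b) =
      (count_mem b s)%:R * (Q.[b] * b ^+ J).
    elim: (s) => [|x l IH]; first by rewrite big_nil mul0r.
    by rewrite big_cons IH /= natrD mulrDl; congr (_ + _); rewrite mulr_natl.
  rewrite /W rmorphD rmorph_nat rmorphMn /= -!mulrA mulrDl; congr (_ + _).
  by case: eqP => [->|_]; rewrite ?mulr1n // !mulr0n !mul0r mulr0.
pose K' := \sum_(j < size Q) cabs Q`_j * (K * B ^+ j).
have bound J : (J0 <= J)%N -> cabs Q.[b] * cabs b ^+ J <= K' * B ^+ J.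
  move=> JJ; apply: (@le_trans _ _ (W * (cabs Q.[b] * cabs b ^+ J))).
    by rewrite ler_peMl // mulr_ge0 ?exprn_ge0 ?cabs_ge0.
  have -> : W * (cabs Q.[b] * cabs b ^+ J) = cabs (W%:C * Q.[b] * b ^+ J).
    by rewrite !cabsM cabs_real cabsX mulrA ger0_norm // (le_trans ler01).
  rewrite -SQ; apply: le_trans (cabs_sum _ _ _) _.
  rewrite /K' mulr_suml; apply: ler_sum => j _; rewrite cabsM -mulrA.
  apply: ler_wpM2l; first exact: cabs_ge0.
  by rewrite -mulrA -exprD addnC; apply: h; rewrite (leq_trans JJ) // leq_addl.
have [J JJ Jb] := @geometric_unbounded (cabs b / B) (K' / cabs Q.[b]) J0
  (etrans (ltr_pdivlMr _ _ B0) (etrans (congr1 (fun u => u < cabs b) (mul1r B)) Bb)).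
have := bound J JJ; have Q0 : 0 < cabs Q.[b] by rewrite cabs_gt0.
move: Jb; rewrite expr_div_n ltr_pdivrMr // mulrAC ltr_pdivlMr ?exprn_gt0 //.
rewrite [X in _ < X]mulrC => h1 h2.
by have := lt_le_trans h1 h2; rewrite ltxx.
Qed.

End Cabs.

Section Newton.
Variable C : closedFieldType.

Definition recip (s : seq C) : {poly C} := \prod_(b <- s) (1 - b *: 'X).

Definition psum (s : seq C) N := \sum_(b <- s) b ^+ N.

Lemma recip_cons b s N : (recip (b :: s))`_N =
  (recip s)`_N - (if N is N'.+1 then b * (recip s)`_N' else 0).
Proof.
rewrite /recip big_cons mulrBl mul1r coefB -scalerAl coefZ coefXM.
by case: N => [|N] //=; rewrite mulr0.
Qed.

(** For [f = recip s], this compares coefficients in [X f' + f * \sum_k psum s k X^k = 0], where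
    [k > 0]. *)
Lemma newton_psum s N :
  (recip s)`_N *+ N + \sum_(j < N) psum s j.+1 * (recip s)`_(N - j.+1) = 0.
Proof.
elim: s N => [|b s IH] N.
  rewrite /recip big_nil coef1 (eq_bigr (fun=> 0)); last first.
    by move=> j _; rewrite /psum big_nil mul0r.
  by rewrite big1_eq addr0; case: N => [|N]; rewrite ?mulr0n ?mul0rn.
case: N => [|N]; first by rewrite big_ord0 mulr0n addr0.
(* Multiplication by the geometric series of [b] undoes the factor [1 - b X], so the sum
   telescopes. *)
have tel : \sum_(j < N.+1) b ^+ j.+1 * (recip (b :: s))`_(N.+1 - j.+1) =
    b * (recip s)`_N.
  rewrite big_ord_recr /= subnn recip_cons subr0.
  suff -> : \sum_(i < N) b ^+ i.+1 * (recip (b :: s))`_(N.+1 - i.+1) =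
      b * (recip s)`_N - b ^+ N.+1 * (recip s)`_0 by rewrite subrK.
  have h m : (m <= N)%N -> \sum_(i < m) b ^+ i.+1 * (recip (b :: s))`_(N.+1 - i.+1) =
      b * (recip s)`_N - b ^+ m.+1 * (recip s)`_(N - m).
    elim: m => [|m IHm] mN; first by rewrite big_ord0 expr1 subn0 subrr.
    rewrite big_ord_recr /= IHm ?(ltnW mN) // subSS recip_cons.
    have [t tE] : exists t, (N - m)%N = t.+1 by exists (N - m.+1)%N; rewrite subnSK.
    rewrite tE.
    have -> : (N - m.+1)%N = t by lia.
    by rewrite [b ^+ m.+2]exprSr; ring.
  by rewrite h // subnn.
have main := IH N.+1; have main' := IH N.
rewrite (eq_bigr (fun j : 'I_N.+1 => b ^+ j.+1 * (recip (b :: s))`_(N.+1 - j.+1) +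
   (psum s j.+1 * (recip s)`_(N.+1 - j.+1) -
    b * (if (N - j)%N is t.+1 then psum s j.+1 * (recip s)`_t else 0)))); last first.
  move=> j _; rewrite {1}/psum big_cons mulrDl -/(psum s _); congr (_ + _).
  rewrite subSS recip_cons mulrBr; congr (_ - _).
  by case: (N - j)%N => [|t]; rewrite ?mulr0 // mulrCA.
rewrite big_split /= tel sumrB -mulr_sumr.
have -> : \sum_(i < N.+1) (if (N - i)%N is t.+1 then psum s i.+1 * (recip s)`_t else 0) =
    \sum_(i < N) psum s i.+1 * (recip s)`_(N - i.+1).
  rewrite big_ord_recr /= subnn addr0; apply: eq_bigr => i _.
  have [t tE] : exists t, (N - i)%N = t.+1 by exists (N - i.+1)%N; rewrite subnSK.
  by rewrite tE; congr (_ * _`_ _); have := ltn_ord i; lia.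
have -> : \sum_(i < N) psum s i.+1 * (recip s)`_(N - i.+1) = - ((recip s)`_N *+ N).
  by apply/eqP; rewrite -addr_eq0 addrC main'.
have -> : \sum_(i < N.+1) psum s i.+1 * (recip s)`_(N.+1 - i.+1) = - ((recip s)`_N.+1 *+ N.+1).
  by apply/eqP; rewrite -addr_eq0 addrC main.
have gen (x y z : C) : x - (y + z) + (y + (- x + z)) = 0 by ring.
by rewrite recip_cons mulrnBl mulrN opprK mulrnAr [(b * _) *+ _]mulrS gen.
Qed.

Lemma recip_factor (f : {poly C}) : f`_0 = 1 -> exists2 s, f = recip s & size s = (size f).-1.
Proof.
move=> f0; have [rs fE] := closed_field_poly_normal f.
have fn : f != 0 by apply: contra_eq_neq f0 => ->; rewrite coef0 eq_sym oner_eq0.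
have rn r : r \in rs -> r != 0.
  move=> rrs; apply: contra_eq_neq f0 => r0.
  rewrite -horner_coef0 fE hornerZ horner_prod (big_rem r) //= hornerXsubC r0 subrr.
  by rewrite mul0r mulr0 eq_sym oner_eq0.
exists [seq r^-1 | r <- rs]; last first.
  by rewrite size_map fE size_scale ?lead_coef_eq0 // size_prod_XsubC.
have h : \prod_(r <- rs) ('X - r%:P) = (\prod_(r <- rs) - r) *: recip [seq r^-1 | r <- rs].
  rewrite /recip big_map; elim: (rs) rn => [|r l IH] rn; first by rewrite !big_nil scale1r.
  rewrite !big_cons IH => [|r' r'l]; last by apply: rn; rewrite inE r'l orbT.
  rewrite -scalerAr [- r * _]mulrC -scalerA; congr (_ *: _).
  rewrite scalerAl; congr (_ * _).
  rewrite scalerBr scalerA mulNr mulfV ?rn ?mem_head // scaleN1r opprK.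
  by rewrite addrC -mul_polyC mulr1 polyCN.
have rec0 l : (recip l)`_0 = 1.
  rewrite -horner_coef0 horner_prod big1 // => b _.
  by rewrite !(hornerE, mulr0, subr0).
move: fE; rewrite h scalerA; move: (lead_coef f * _) => a fE.
by move: f0; rewrite fE coefZ rec0 mulr1 => ->; rewrite scale1r.
Qed.

(** Newton's recursion determines the sequence, as its last term enters with coefficient 1; the sign
    comes from comparison with [newton_psum]. *)
Lemma psum_unique s (c : nat -> C) :
  (forall N, (0 < N)%N ->
     (recip s)`_N *+ N = \sum_(j < N) c j.+1 * (recip s)`_(N - j.+1)) ->
  (recip s)`_0 = 1 ->
  forall N, (0 < N)%N -> c N = - psum s N.
Proof.
move=> hc h0; elim/ltn_ind => -[|N] // IH _.
have := newton_psum s N.+1; rewrite hc // -big_split big_ord_recr /= subnn h0 !mulr1.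
rewrite big1 ?add0r => [|j _]; last first.
  by rewrite IH ?ltnS // mulNr addNr.
by move/eqP; rewrite addr_eq0 => /eqP.
Qed.

End Newton.

(** * The von Mangoldt identity and the logarithmic derivative of the L-function *)

Lemma sum_multiples N d (b : nat -> nat) : (0 < d)%N ->
  (forall i, (0 < b i)%N -> (d * i <= N)%N) ->
  (\sum_(j < N | d %| j.+1) b (j.+1 %/ d) = \sum_(i < N) b i.+1)%N.
Proof.
move=> d0 bN.
transitivity (\sum_(j < N) \sum_(i < N | j.+1 == d * i.+1) b i.+1)%N.
  rewrite [LHS]big_mkcond; apply: eq_bigr => j _; case: ifP => [/dvdnP[m jE]|dj].
    have m0 : (0 < m)%N by move: jE; case: m.
    have mN : (m.-1 < N)%N.
      rewrite prednK //; apply: leq_trans (ltn_ord j); rewrite jE leq_pmulr //.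
    rewrite (big_pred1 (Ordinal mN)) => [|i]; first by rewrite jE mulnK //= prednK.
    by rewrite jE mulnC eqn_pmul2l // -{1}(prednK m0) eqSS eq_sym.
  rewrite big1 // => i /eqP jE; by rewrite jE dvdn_mulr in dj.
rewrite (exchange_big_dep predT) //=; apply: eq_bigr => i _.
rewrite sum_nat_const; case: (posnP (b i.+1)) => [->|bi]; first by rewrite muln0.
have h := bN _ bi; have jN : ((d * i.+1).-1 < N)%N.
  by rewrite prednK // muln_gt0 d0.
rewrite (eq_card1 (x := Ordinal jN)) ?mul1n // => j.
by rewrite !inE -val_eqE /= -[RHS]eqSS prednK ?muln_gt0 ?d0.
Qed.

Section DegreeIdentity.
Variable F : finFieldType.
Implicit Types f g p : {poly F}.

Lemma monicsP N (f : {poly_N.+1 F}) :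
  reflect (val f \is monic /\ deg (val f) = N) (f \in monics F N).
Proof.
rewrite inE; apply: (iffP andP) => -[mf].
  by move/eqP; rewrite /deg => ->.
by move=> fN; rewrite size_deg ?monic_neq0 // fN.
Qed.

Lemma degM f g : f \is monic -> g \is monic -> deg (f * g) = (deg f + deg g)%N.
Proof.
move=> mf mg; rewrite {1}/deg size_monicM ?monic_neq0 // !size_deg ?monic_neq0 //.
by rewrite addnS.
Qed.

Lemma deg_exp p i : deg (p ^+ i) = (deg p * i)%N.
Proof. exact: size_exp. Qed.

(* The multiplicity of [p] in [f], provided that it is at most [N]. *)
Definition vp N p f := (\sum_(i < N) (p ^+ i.+1 %| f)%R)%N.

Lemma isprime_exp_dvd p p' f i : isprime p -> isprime p' -> p != p' ->
  (p ^+ i %| p' * f) = (p ^+ i %| f).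
Proof.
move=> pp pp' ne; apply: Gauss_dvdpr; apply: coprimep_expl.
rewrite isprime_coprime //; apply: contraNN ne => dv.
by rewrite (isprime_dvd_eq pp pp' dv).
Qed.

Lemma vp_mul N p p' f : isprime p -> isprime p' -> f \is monic ->
  (deg f < N)%N -> vp N p (p' * f) = (vp N p f + (p == p'))%N.
Proof.
move=> pp pp' mf fN; case: eqVneq => [<-|ne]; last first.
  by rewrite addn0; apply: eq_bigr => i _; rewrite isprime_exp_dvd.
case: N fN => // N fN; rewrite /vp big_ord_recl [in RHS]big_ord_recr /= expr1 dvdp_mulr //.
have -> : (p ^+ N.+1 %| f) = false.
  apply/negbTE/negP => /dvdp_leq; rewrite monic_neq0 // => /(_ isT).
  rewrite !size_deg ?monic_neq0 // ?monic_exp // ?isprime_monic // ltnS deg_exp.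
  by rewrite leqNgt (leq_trans fN) // leq_pmull // isprime_deg.
rewrite addn0 addnC; congr (_ + _)%N; apply: eq_bigr => i _.
by rewrite exprS dvdp_mul2l // isprime_neq0.
Qed.

Lemma deg_vp N f : f \is monic -> (deg f <= N)%N ->
  (\sum_(d < N.+1) \sum_(g in monics F d | isprime (val g)) d * vp N (val g) f = deg f)%N.
Proof.
elim: {f}(size f) {-2}f (leqnn (size f)) => [|s IH] f.
  by rewrite leqn0 size_poly_eq0 => /eqP -> /monic_neq0; rewrite eqxx.
move=> sf mf fN; have [s1|s1] := leqP (size f) 1.
  have f1 : deg f = 0%N by rewrite /deg; case: (size f) s1 => [|[]].
  rewrite f1 big1 // => d _; rewrite big1 // => g /andP[gm gp].
  rewrite /vp big1 ?muln0 // => i _; apply/eqP; rewrite eqb0; apply/negP => /dvdp_leq.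
  rewrite monic_neq0 // => /(_ isT) h; have := leq_trans h s1.
  rewrite size_deg ?expf_neq0 ?isprime_neq0 // ltnS leqn0 deg_exp.
  by rewrite muln_eq0 orbF gtn_eqF // isprime_deg.
have [p pp /dvdpP[f1 fE]] := prime_factor s1.
have mf1 : f1 \is monic by move: mf; rewrite fE monicMr // isprime_monic.
have dE : deg f = (deg f1 + deg p)%N.
  rewrite /deg fE size_Mmonic ?monic_neq0 // ?isprime_monic //.
  by rewrite (size_deg (monic_neq0 mf1)) (size_deg (isprime_neq0 pp)) addnS.
have p0 := isprime_deg pp.
have f1N : (deg f1 < N)%N by lia.
have sf1 : (size f1 <= s)%N.
  have := sf; rewrite (size_deg (monic_neq0 mf)) (size_deg (monic_neq0 mf1)); lia.
have {}IH := IH f1 sf1 mf1 (ltnW f1N).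
have pN : (deg p < N.+1)%N by lia.
have spN : (size p <= (deg p).+1)%N by rewrite size_deg ?isprime_neq0.
rewrite dE -IH [RHS]addnC.
have -> : deg p = (\sum_(d < N.+1) \sum_(g in monics F d | isprime (val g)) d * (val g == p))%N.
  rewrite (bigD1 (Ordinal pN)) //= (bigD1 (NPoly spN)) /=; last first.
    by rewrite pp andbT; apply/monicsP; rewrite /= isprime_monic.
  rewrite eqxx muln1 big1 ?addn0 => [|g /andP[/andP[_ _] gn]]; last first.
    case: eqP => [ge|]; last by rewrite muln0.
    by case/eqP: gn; apply: val_inj.
  rewrite big1 ?addn0 // => d dn; rewrite big1 // => g /andP[/monicsP[_ gd] _].
  case: eqP => [ge|]; last by rewrite muln0.
  by case/eqP: dn; apply: val_inj; apply: etrans (esym gd) (congr1 _ ge).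
rewrite -big_split; apply: eq_bigr => d _; rewrite -big_split; apply: eq_bigr => g /andP[_ gp].
by rewrite /= fE mulrC vp_mul // mulnDr addnC.
Qed.

(** Von Mangoldt's identity, that is, unique factorization read through degrees: each prime power
    dividing [f] counts with the degree of its prime. The terms are sorted by the degree [j.+1] of
    the prime power. *)
Lemma deg_identity N f : f \is monic -> deg f = N ->
  (\sum_(j < N) \sum_(d < j.+2 | (0 < d) && (d %| j.+1))
    \sum_(g in monics F d | isprime (val g)) d * (val g ^+ (j.+1 %/ d)%N %| f)%R = N)%N.
Proof.
move=> mf fN; rewrite -[RHS]fN -(deg_vp mf (eq_leq fN)).
transitivity (\sum_(j < N) \sum_(d < N.+1 | (0 < d) && (d %| j.+1))
   \sum_(g in monics F d | isprime (val g)) d * (val g ^+ (j.+1 %/ d)%N %| f)%R)%N.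
  apply: eq_bigr => j _.
  rewrite (big_ord_widen_cond N.+1 (fun d => (0 < d)%N && (d %| j.+1)%N) (fun d =>
    \sum_(g in monics F d | isprime (val g)) d * (val g ^+ (j.+1 %/ d)%N %| f)%R)%N) //; last first.
    by rewrite ltnS.
  apply: eq_bigl => d; case: (boolP ((0 < d)%N && (d %| j.+1)%N)) => //=.
  by move=> /andP[_ /(dvdn_leq (ltn0Sn _)) h]; rewrite ltnS h.
rewrite (exchange_big_dep (fun d : 'I_N.+1 => (0 < d)%N)) /=; last by move=> j d _ /andP[].
rewrite [RHS](bigID (fun d : 'I_N.+1 => (0 < d)%N)) /= [X in (_ + X)%N]big1 ?addn0; last first.
  by move=> d; rewrite -eqn0Ngt => /eqP ->; rewrite big1.
apply: eq_bigr => d d0; rewrite d0 exchange_big; apply: eq_bigr => g /andP[/monicsP[gm gd] gp].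
rewrite -big_distrr; congr (_ * _)%N.
rewrite (sum_multiples (b := fun i => (val g ^+ i %| f)%R : nat)) // => i.
rewrite lt0b => /dvdp_leq; rewrite monic_neq0 // => /(_ isT).
by rewrite !size_deg ?monic_neq0 ?monic_exp // ltnS deg_exp gd fN.
Qed.

End DegreeIdentity.

Section CharSums.
Variables (F : finFieldType) (C : comNzRingType) (chi : {poly F} -> C).
Hypothesis chiM : forall f g, chi (f * g) = chi f * chi g.
Implicit Types f g p : {poly F}.

(* The coefficients of the L-function of [chi] and of its logarithmic derivative. *)
Definition Lsum N := \sum_(f in monics F N) chi (val f).
Definition csum N := \sum_(d < N.+1 | (0 < d)%N && (d %| N)%N)
    \sum_(f in monics F d | isprime (val f)) (chi (val f ^+ (N %/ d))) *+ d.

Lemma Lsum_dvd N g : g \is monic -> (deg g <= N)%N ->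
  \sum_(f in monics F N | g %| val f) chi (val f) = chi g * Lsum (N - deg g).
Proof.
move=> mg gN; rewrite /Lsum mulr_sumr.
have sg := size_deg (monic_neq0 mg).
have sM (h : {poly F}) : (size h <= (N - deg g).+1)%N -> (size (g * h)%R <= N.+1)%N.
  move=> sh; apply: leq_trans (size_polyMleq _ _) _; rewrite sg addSn /=.
  by apply: (@leq_trans (deg g + (N - deg g).+1)); rewrite ?leq_add2l // addnS subnKC.
have sD (f : {poly F}) : (size f <= N.+1)%N -> (size (f %/ g)%R <= (N - deg g).+1)%N.
  by rewrite size_divp ?monic_neq0 // sg /= => h; rewrite -subSn // leq_sub2r.
rewrite (reindex_onto (fun h : {poly_(N - deg g).+1 F} => npolyp N.+1 (g * val h))
  (fun f : {poly_N.+1 F} => npolyp (N - deg g).+1 (val f %/ g))) /=; last first.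
  move=> f /andP[_ gf]; apply: val_inj => /=.
  by rewrite npolypK ?sM // npolypK ?sD ?size_npoly // mulrC divpK.
apply: eq_big => [h|h _]; last first.
  by rewrite /= npolypK ?sM ?size_npoly // chiM.
rewrite /= npolypK ?sM ?size_npoly // dvdp_mulIl andbT.
have -> : npolyp (N - deg g).+1 ((g * val h) %/ g) = h.
  by apply: val_inj; rewrite /= mulKp ?monic_neq0 // npolypK ?size_npoly.
rewrite eqxx andbT; apply/monicsP/monicsP; rewrite /= npolypK ?sM ?size_npoly // => -[mh dh].
  move: mh; rewrite monicMl // => mh; split=> //.
  by apply/eqP; rewrite -(eqn_add2l (deg g)) subnKC // -degM // dh.
split; first by rewrite monicMl.
by rewrite degM // dh subnKC.
Qed.

(** In each term of [Lsum N], the factor [N] is replaced by von Mangoldt's sum over the prime powers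
    dividing [f]; complete multiplicativity then splits the prime power off the sum over its
    multiples. *)
Lemma newton_char N : Lsum N *+ N = \sum_(j < N) csum j.+1 * Lsum (N - j.+1).
Proof.
rewrite /Lsum -sumrMnl.
transitivity (\sum_(f in monics F N) \sum_(j < N) \sum_(d < j.+2 | (0 < d)%N && (d %| j.+1)%N)
    \sum_(g in monics F d | isprime (val g)) chi (val f) *+ (d * (val g ^+ (j.+1 %/ d)%N %| val f)%R)).
  apply: eq_bigr => f /monicsP[mf df]; apply: etrans (congr1 (fun m => chi (val f) *+ m) (esym (deg_identity mf df))) _.
  rewrite -sumrMnr; apply: eq_bigr => j _; rewrite -sumrMnr; apply: eq_bigr => d _.
  by rewrite -sumrMnr.
rewrite exchange_big; apply: eq_bigr => j _.
rewrite exchange_big mulr_suml; apply: eq_bigr => d /andP[d0 dj].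
rewrite exchange_big mulr_suml; apply: eq_bigr => g /andP[/monicsP[mg dg] gp].
rewrite mulrnAl -/(Lsum _).
have dE : deg (val g ^+ (j.+1 %/ d)) = j.+1 by rewrite deg_exp dg mulnC divnK.
have -> : (N - j.+1)%N = (N - deg (val g ^+ (j.+1 %/ d)))%N by rewrite dE.
rewrite -Lsum_dvd ?monic_exp // ?dE //.
rewrite -sumrMnl [RHS]big_mkcondr; apply: eq_bigr => f _.
by case: ifP => _; rewrite ?muln0 ?mulr0n // muln1.
Qed.

End CharSums.

(** What one [t i] lacks must be supplied by the others, each of which exceeds the average
    [r / #|H|] by at most [d / #|H|]. *)
Lemma count_le_nearly_uniform (R : realFieldType) (I : finType) (H : {set I})
    (t : I -> R) (r d m : R) : (0 < #|H|)%N -> 0 <= d ->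
  (forall i, i \in H -> t i * #|H|%:R <= r + d) ->
  r - m <= \sum_(i in H) t i -> 0 <= m ->
  forall i, i \in H -> `|t i - r / #|H|%:R| <= d + m.
Proof.
move=> h0 d0 up low m0 i iH; set h : R := #|H|%:R.
have h1 : 1 <= h by rewrite ler1n.
have hp : 0 < h by apply: lt_le_trans h1.
have tu j : j \in H -> t j <= r / h + d / h.
  by move=> jH; rewrite -mulrDl ler_pdivlMr //; apply: up.
have dh : d / h <= d by rewrite ler_pdivrMr // ler_peMr.
have dh0 : 0 <= d / h by rewrite divr_ge0 // ltW.
rewrite ler_norml; apply/andP; split; last by have := tu i iH; lra.
move: low; rewrite (bigD1 i) //= => low.
have : \sum_(j in H | j != i) t j <= \sum_(j in H | j != i) (r / h + d / h).
  by apply: ler_sum => j /andP[jH _]; apply: tu.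
rewrite sumr_const => low2.
have cE : #|[pred j | (j \in H) && (j != i)]|.+1 = #|H|.
  by rewrite [RHS](cardD1 i) iH add1n; congr _.+1; apply: eq_card => j; rewrite !inE andbC.
have hE : h = #|[pred j | (j \in H) && (j != i)]|%:R + 1 by rewrite /h -cE -natr1.
have rh : r = r / h * h by rewrite divfK // gt_eqF.
have dhh : d = d / h * h by rewrite divfK // gt_eqF.
move: low2; rewrite -mulr_natr.
rewrite (_ : #|_|%:R = h - 1); last by rewrite hE addrK; congr (_%:R); apply: eq_card.
move=> low2.
have e1 : (r / h + d / h) * (h - 1) = r + d - r / h - d / h.
  by rewrite mulrBr mulr1 mulrDl -rh -dhh; ring.
rewrite e1 in low2; lra.
Qed.

(** * The Riemann hypothesis for Dirichlet characters *)

Section RH.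
Variables (R : realType) (F : finFieldType) (n' : nat) (T : 'M[F]_n'.+1).
Variables (chi : {poly F} -> R[i]) (nn : nat).
Hypothesis chi1 : chi 1 = 1.
Hypothesis chiM : forall f g, chi (f * g) = chi f * chi g.
Hypothesis chi_le1 : forall f, cabs (chi f) <= 1.
Hypothesis chiT : forall f g, horner_mx T f = horner_mx T g -> chi f = chi g.
Hypothesis vanish : forall j, (nn <= j)%N -> Lsum chi j = 0.

(* The junk value is 0 on the matrices that are not polynomials in [T]. *)
Definition chi_mx (A : 'M[F]_n'.+1) : R[i] :=
  if pselect (exists f, horner_mx T f = A) is left ex then chi (projT1 (cid ex)) else 0.

Lemma chi_mxE f : chi_mx (horner_mx T f) = chi f.
Proof.
rewrite /chi_mx; case: pselect => [ex|nex]; last by case: nex; exists f.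
by case: (cid ex) => g /= gf; apply: chiT.
Qed.

Lemma chi_mx_le1 A : cabs (chi_mx A) <= 1.
Proof.
rewrite /chi_mx; case: pselect => [ex|_]; first exact: chi_le1.
by rewrite cabs0.
Qed.

(** The polynomials in [T] that belong to [H] form a finite set of invertible matrices closed under
    multiplication, on which [chi_mx] is multiplicative: the sum is the size of this set or 0. This
    is the source of [0 <= c] in [csum_even]. *)
Lemma sum_chi_mx (H : {set 'M[F]_n'.+1}) :
  (forall A B, A \in H -> B \in H -> A *m B \in H) ->
  (forall A, A \in H -> A \in unitmx) ->
  exists m : nat, \sum_(A in H) chi_mx A = m%:R.
Proof.
move=> HM Hu.
pose H' := [set A in H | `[< exists f, horner_mx T f = A >]].
have -> : \sum_(A in H) chi_mx A = \sum_(A in H') chi_mx A.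
  rewrite (bigID (fun A => `[< exists f, horner_mx T f = A >])) /= addrC big1 ?add0r.
    by apply: eq_bigl => A; rewrite inE.
  move=> A /andP[_ /asboolPn nex]; rewrite /chi_mx; case: pselect => //.
have [triv|] := pselect (forall A, A \in H' -> chi_mx A = 1).
  exists #|H'|; rewrite -sum1_card natr_sum; apply: eq_bigr => A AH.
  exact: triv.
move=> /existsNP[A0 /not_implyP[A0H A0n]]; exists 0%N.
move: (A0H); rewrite inE => /andP[A0H1 /asboolP[f0 f0E]].
have im : [set A0 *m A | A in H'] = H'.
  apply/eqP; rewrite eqEcard card_in_imset ?leqnn ?andbT; last first.
    by move=> A B _ _ /(congr1 (mulmx (invmx A0))); rewrite !(mulKmx (Hu _ A0H1)).
  apply/subsetP => _ /imsetP[A AH ->]; move: AH; rewrite !inE => /andP[AH /asboolP[f fE]].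
  rewrite HM //=; apply/asboolP; exists (f0 * f).
  by rewrite rmorphM /= f0E fE.
have : \sum_(A in H') chi_mx A = chi_mx A0 * \sum_(A in H') chi_mx A.
  rewrite -{1}im big_imset /=; last first.
    by move=> A B _ _ /(congr1 (mulmx (invmx A0))); rewrite !(mulKmx (Hu _ A0H1)).
  rewrite mulr_sumr; apply: eq_bigr => A; rewrite inE => /andP[_ /asboolP[f <-]].
  by rewrite -f0E -[X in chi_mx X](rmorphM (horner_mx T)) !chi_mxE chiM.
move/eqP; rewrite -[X in X == _]mul1r -subr_eq0 -mulrBl mulf_eq0 subr_eq0 eq_sym.
by move=> /orP[/eqP|/eqP ->].
Qed.

Lemma Lsum0 : Lsum chi 0 = 1.
Proof.
have s1 : (size (1%R : {poly F}) <= 1)%N by rewrite size_poly1.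
rewrite /Lsum (bigD1 (NPoly s1)) /=; last by apply/monicsP; rewrite /= monic1 /deg size_poly1.
rewrite chi1 big1 ?addr0 // => f /andP[/monicsP[mf df] fn].
case/eqP: fn; apply: val_inj => /=; apply/eqP; rewrite -eqp_monic ?monic1 //.
by rewrite -size_poly_eq1 size_deg ?monic_neq0 // df.
Qed.

(** The L-function is a polynomial of degree less than [nn] with constant term 1; [s] lists its
    inverse roots, and [newton_char] is Newton's recursion for it. *)
Lemma csum_roots : exists2 s : seq R[i], (size s <= nn)%N &
  forall N, (0 < N)%N -> csum chi N = - psum s N.
Proof.
pose P : {poly R[i]} := \poly_(j < nn) Lsum chi j.
have Pj j : P`_j = Lsum chi j.
  by rewrite coef_poly; case: ltnP => // /vanish ->.
have [s Ps ss] : exists2 s, P = recip s & size s = (size P).-1.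
  by apply: recip_factor; rewrite Pj Lsum0.
exists s; first by rewrite ss (leq_trans (leq_pred _)) // size_poly.
apply: psum_unique => [N N0|]; last by rewrite -Ps Pj Lsum0.
rewrite -Ps Pj newton_char //; apply: eq_bigr => j _.
by rewrite Pj.
Qed.

Section Closure.
Variables (k : closedFieldType) (iF : {rmorphism F -> k}).
Variables (p e : nat) (ch : p \in [pchar k]) (hq : #|F| = (p ^ e)%N).
Local Notation q := (p ^ e)%N.
Local Notation n := n'.+1.
Let Tk : 'M[k]_n := map_mx iF T.

Lemma count_singular_le (xs : seq k) : uniq xs ->
  (forall x, x \in xs -> \det (Tk - x%:M) = 0) -> (size xs <= n)%N.
Proof.
move=> uxs hxs; have := max_poly_roots (p := char_poly Tk) (rs := xs).
rewrite monic_neq0 ?char_poly_monic // size_char_poly ltnS; apply => //.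
apply/allP => x /hxs d0; rewrite -eigenvalue_root_char.
rewrite /eigenvalue /eigenspace kermx_eq0 row_free_unit unitmxE d0.
by rewrite unitr0.
Qed.

(* Only even exponents occur, since [stepanov] needs a square number of elements. *)
Lemma csum_even : exists (c K : R) J0, 0 <= c /\ forall J, (J0 <= J)%N ->
  cabs (csum chi (2 * J) - c%:C * (q%:R ^+ 2) ^+ J) <= K * q%:R ^+ J.
Proof.
have q1 : (1 < q)%N := q_gt1 hq.
have [C1 [R0 cin]] := stab_count_le iF ch hq T.
have [C2 cout] := nonstab_count_bounded iF ch hq T.
set H := stabH iF p e T in cin cout.
have H1 : 1%:M \in H by apply: stabH1.
have Hg0 : (0 < #|H|)%N by apply/card_gt0P; exists 1%:M.
have [m mE] : exists m : nat, \sum_(A in H) chi_mx A = m%:R.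
  apply: sum_chi_mx => A; first by move=> B; apply: stabHM.
  by rewrite inE unitmxE unitfE => /andP[].
(* At most [n] points are eigenvalues of [T], and at most [C2] others have their class outside
   [H]. *)
pose h : R := #|H|%:R; pose m0 : R := (n + C2)%:R.
have h0 : 0 < h by rewrite ltr0n.
(* [c] is the mean of [chi_mx] over [H]. In the second constant, [m0] accounts for the excluded
   points and [C1 + m0] for the deviation of each of the [h] classes from [q ^ N / h]. The third
   ensures [R0 <= q ^ J]. *)
exists (m%:R / h), (m0 + h * (C1%:R + m0)), (R0 + 1)%N; split.
  by rewrite divr_ge0 ?ler0n.
move=> J JJ; pose N := (2 * J)%N; have N0 : (0 < N)%N by rewrite /N; lia.
have [urs srs mrs] := frootsP ch hq N0; set rs := froots ch hq N in urs srs mrs.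
pose r1 : R := q%:R ^+ J.
have r11 : 1 <= r1 by rewrite exprn_ege1 // ler1n ltnW.
have r1q : (p ^ (e * J))%:R = r1 by rewrite expnM natrX.
have rN : (p ^ (e * J) * p ^ (e * J) = q ^ N)%N by rewrite -expnD -expnM /N; congr (_ ^ _)%N; lia.
have R0J : (R0 <= p ^ (e * J))%N.
  rewrite expnM; apply: leq_trans (ltnW (ltn_expl J q1)); lia.
pose G x := chi (nrm iF p e N x).
have cE : csum chi N = \sum_(x <- rs) G x.
  by rewrite /G (sum_points iF ch hq chi N0).
pose hm x := horner_mx T (nrm iF p e N x).
pose ok x := \det (Tk - x%:M) != 0.
pose inH x := ok x && (hm x \in H).
have okgood x : x \in rs -> ok x -> nonsingular_fixed iF p e T N x /\ eta iF p e T N x = map_mx iF (hm x).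
  rewrite mrs => /eqP xN okx; split; first by split.
  exact: eta_nrm.
have outle : (count (predC inH) rs <= n + C2)%N.
  have : (count (predC inH) rs <= count (predC ok) rs + count (fun x => ok x && (hm x \notin H)) rs)%N.
    rewrite -count_predUI; apply: leq_trans (leq_addr _ _).
    apply: sub_count => x /=; rewrite /inH negb_and; case: (ok x) => //=.
  move/leq_trans; apply; apply: leq_add; rewrite -size_filter.
    apply: count_singular_le; first exact: filter_uniq.
    by move=> x; rewrite mem_filter => /andP[/negPn/eqP].
  apply: (cout N); first exact: filter_uniq.
  move=> x; rewrite mem_filter => /andP[/andP[okx hx] xrs].
  have [gx ex] := okgood _ xrs okx; split=> //; by exists (hm x).
pose t (A : 'M[F]_n) : R := (count (fun x => inH x && (hm x == A)) rs)%:R.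
have mainE : \sum_(x <- rs | inH x) G x = \sum_(A in H) (t A)%:C * chi_mx A.
  rewrite (partition_big hm (mem H)) /=; last by move=> x /andP[].
  apply: eq_bigr => A _; rewrite (eq_bigr (fun=> chi_mx A)); last first.
    by move=> x /andP[_ /eqP <-]; rewrite chi_mxE.
  rewrite big_const_seq iter_addr_0 -[LHS]mulr_natl; congr (_ * _).
  by rewrite /t rmorph_nat.
have tsum : h * 0 + q%:R ^+ N - m0 <= \sum_(A in H) t A.
  rewrite mulr0 add0r /t -natr_sum.
  have -> : (\sum_(A in H) count (fun x => inH x && (hm x == A)) rs = count inH rs)%N.
    have -> : count inH rs = (\sum_(x <- rs | inH x) 1)%N by rewrite sum1_count.
    rewrite (partition_big hm (mem H)) /=; last by move=> x /andP[].
    by apply: eq_bigr => A _; rewrite sum1_count.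
  have := count_predC inH rs; rewrite srs => cc.
  rewrite lerBlDr /m0 -natrX -natrD ler_nat; lia.
have tup A : A \in H -> t A * #|H|%:R <= q%:R ^+ N + C1%:R * r1.
  move=> AH; rewrite /t -natrM -natrX -r1q -natrM -natrD ler_nat -rN -size_filter.
  apply: (cin (e * J)%N N A) => //; first exact: filter_uniq.
  move=> x; rewrite mem_filter => /andP[/andP[/andP[okx _] /eqP <-] xrs].
  exact: okgood.
have C1r : 0 <= C1%:R * r1 by rewrite mulr_ge0 // (le_trans ler01).
have m00 : 0 <= m0 by rewrite ler0n.
rewrite mulr0 add0r in tsum.
have unif := count_le_nearly_uniform Hg0 C1r tup tsum m00.
have -> : csum chi (2 * J) - (m%:R / h)%:C * (q%:R ^+ 2) ^+ J =
   \sum_(A in H) (t A - q%:R ^+ N / h)%:C * chi_mx A + \sum_(x <- rs | ~~ inH x) G x.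
  rewrite -/N cE (bigID inH) /= mainE addrAC; congr (_ + _).
  have -> : (m%:R / h)%:C * (q%:R ^+ 2) ^+ J =
      \sum_(A in H) (q%:R ^+ N / h)%:C * chi_mx A :> R[i].
    have natC i : i%:R = (i%:R : R)%:C :> R[i] by rewrite rmorph_nat.
    rewrite -mulr_sumr mE -exprM -/N !natC -rmorphXn -!rmorphM.
    by congr (_%:C); ring.
  rewrite -sumrB; apply: eq_bigr => A _.
  by rewrite -mulrBl -rmorphB.
apply: le_trans (cabsD _ _) _; rewrite mulrDl [X in _ <= X]addrC; apply: lerD; last first.
  apply: le_trans (cabs_sum _ _ _) _.
  apply: (@le_trans _ _ (\sum_(x <- rs | ~~ inH x) 1)).
    by apply: ler_sum => x _; apply: chi_le1.
  rewrite big_const_seq iter_addr_0.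
  apply: (@le_trans _ _ m0); first by rewrite ler_nat.
  by rewrite ler_peMr.
apply: le_trans (cabs_sum _ _ _) _.
apply: (@le_trans _ _ (\sum_(A in H) (C1%:R * r1 + m0))).
  apply: ler_sum => A AH; rewrite cabsM cabs_real.
  apply: le_trans (unif A AH); rewrite ler_piMr // chi_mx_le1 //.
rewrite sumr_const -[X in X <= _]mulr_natl -/h -/r1 -[X in _ <= X]mulrA ler_pM2l // mulrDl lerD2l.
by rewrite ler_peMr.
Qed.

End Closure.

Lemma csum_le N : (0 < N)%N -> cabs (csum chi N) <= nn%:R * Num.sqrt (#|F|%:R) ^+ N.
Proof.
move=> N0; have [k [iF _]] := countable_algebraic_closure F.
have [p pp chF] := finPcharP F.
have ch : p \in [pchar k] := rmorph_pchar iF chF.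
have [s ss cE] := csum_roots.
have [c [K [J0 [c0 hJ]]]] := csum_even iF ch (card_pprimeChar chF).
rewrite -(card_pprimeChar chF) in hJ.
have q0 : 0 < #|F|%:R :> R by rewrite ltr0n; apply/card_gt0P; exists 0.
have root b : b \in s -> cabs b <= Num.sqrt #|F|%:R.
  (* Only even exponents are controlled, so the bound is applied to the squares of the inverse
     roots, with the main term as a weighted power of [q ^ 2]. *)
  move=> bs; have := @power_sum_bound R [seq b ^+ 2 | b <- s] c K #|F|%:R (#|F|%:R ^+ 2) J0.+1 c0 q0.
  move=> /(_ _ (b ^+ 2)); rewrite cabsX => h.
  rewrite -(ler_pXn2r (n := 2)) ?nnegrE ?cabs_ge0 ?sqrtr_ge0 // sqr_sqrtr ?(ltW q0) //.
  apply: h; last by apply: (map_f (fun b => b ^+ 2)).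
  move=> J JJ; have {}hJ := hJ J (ltnW JJ).
  rewrite big_map -cabsN opprD; rewrite cE in hJ; last by lia.
  apply: le_trans hJ; rewrite /psum; under eq_bigr do rewrite -exprM.
  by rewrite lexx.
rewrite cE // cabsN; apply: le_trans (cabs_sum _ _ _) _.
apply: (@le_trans _ _ (\sum_(b <- s) Num.sqrt #|F|%:R ^+ N)).
  rewrite !big_seq; apply: ler_sum => b bs; rewrite cabsX.
  by apply: lerXn2r; rewrite ?nnegrE ?cabs_ge0 ?sqrtr_ge0 // root.
rewrite big_const_seq count_predT iter_addr_0 -[X in X <= _]mulr_natl.
by rewrite ler_wpM2r ?exprn_ge0 ?sqrtr_ge0 // ler_nat.
Qed.

End RH.

(** * Polynomials of bounded size and residue classes *)

Lemma size_npolyp_le (F : finFieldType) n (p : {poly F}) :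
  (size (npolyp n p) <= size p)%N.
Proof.
by apply/leq_sizeP => i si; rewrite coef_npolyp nth_default // if_same.
Qed.

(** Sums over polynomials are indexed by types that carry a size bound; this changes the bound when
    it exceeds all sizes that occur. *)
Lemma sum_npoly (F : finFieldType) (V : nmodType) n n' (P : pred {poly F}) (G : {poly F} -> V) :
  (forall f, P f -> (size f <= n)%N && (size f <= n')%N) ->
  \sum_(f : {poly_n F} | P (val f)) G (val f) = \sum_(f : {poly_n' F} | P (val f)) G (val f).
Proof.
move=> h.
rewrite (reindex_onto (fun f : {poly_n' F} => npolyp n (val f)) (fun f : {poly_n F} => npolyp n' (val f))) /=.
  apply: eq_big => [f|f /andP[]].
    case: (leqP (size (val f)) n) => sf.
      have -> : npolyp n' (npolyp n (val f)) = f.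
        by apply: val_inj; rewrite /= !npolypK // size_npoly.
      by rewrite eqxx andbT npolypK.
    have -> : P (val f) = false by apply/negP => /h; rewrite leqNgt sf.
    apply/negbTE/negP => /andP[_ /eqP /(congr1 (fun f : {poly_n' F} => size (val f))) /= fE].
    by move: sf; rewrite -fE ltnNge (leq_trans (size_npolyp_le _ _)) // size_npoly.
  move=> Pf /eqP fE; congr G; move: Pf => /h /andP[_ s2].
  by move/(congr1 val): fE => fE; apply: etrans fE; rewrite /= (npolypK s2).
move=> f Pf; have /andP[_ s2] := h _ Pf.
by apply: val_inj; rewrite /= [polyn (npolyp n' _)]npolypK // npolypK ?size_npoly.
Qed.

(* Multiplication by ['X] on [F[X]/(m)]: a polynomial in this matrix determines the
   residue class of the polynomial. *)
Section MulX.
Variables (F : finFieldType) (m : {poly F}) (n' : nat).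
Hypothesis dm : deg m = n'.+1.
Implicit Types f g : {poly F}.

Lemma m_neq0 : m != 0.
Proof. by apply: contra_eq_neq dm => ->; rewrite /deg size_poly0. Qed.

Lemma size_modm f : (size (f %% m)%R <= n'.+1)%N.
Proof. by have := ltn_modp f m; rewrite m_neq0 (size_deg m_neq0) dm ltnS. Qed.

Definition mulXmx : 'M[F]_n'.+1 := \matrix_(i, j) (('X * 'X^i) %% m)`_j.

Definition modrow f : 'rV[F]_n'.+1 := \row_j (f %% m)`_j.

Lemma modrow_inj f g : modrow f = modrow g -> f %% m = g %% m.
Proof.
move=> /rowP h; apply/polyP => i; case: (ltnP i n'.+1) => [lt|ge].
  by have := h (Ordinal lt); rewrite !mxE.
by rewrite !nth_default // (leq_trans (size_modm _) ge).
Qed.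

Lemma modp_lin (I : Type) (r : seq I) (c : I -> F) (G : I -> {poly F}) :
  (\sum_(i <- r) c i *: G i) %% m = \sum_(i <- r) c i *: (G i %% m).
Proof.
elim: r => [|i r IH]; first by rewrite !big_nil mod0p.
by rewrite !big_cons modpD modpZl IH.
Qed.

Lemma modrow_mulX f : modrow f *m mulXmx = modrow ('X * f).
Proof.
apply/rowP => j; rewrite !mxE.
have -> : ('X * f) %% m = ('X * (f %% m)) %% m by rewrite modp_mul.
rewrite -[f %% m in RHS]coefK poly_def mulr_sumr.
rewrite (eq_bigr (fun i : 'I__ => (f %% m)`_i *: ('X * 'X^i))) => [|i _]; last by rewrite scalerAr.
rewrite modp_lin coef_sum.
rewrite (big_ord_widen n'.+1 (fun i => ((f %% m)`_i *: (('X * 'X^i) %% m))`_j)) ?size_modm //.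
rewrite [RHS]big_mkcond; apply: eq_bigr => i _ /=; rewrite !mxE.
case: ltnP => si; first by rewrite coefZ.
by rewrite nth_default // mul0r.
Qed.

Lemma modrow_horner f : modrow 1 *m horner_mx mulXmx f = modrow f.
Proof.
suff h g : modrow g *m horner_mx mulXmx f = modrow (g * f) by rewrite h mul1r.
elim/poly_ind: f g => [|f c IH] g.
  by rewrite rmorph0 mulr0 mulmx0; apply/rowP => j; rewrite !mxE mod0p coef0.
rewrite rmorphD rmorphM /= horner_mx_X horner_mx_C mulmxDr mulmxA IH modrow_mulX.
rewrite mul_mx_scalar; apply/rowP => j; rewrite !mxE -coefZ -modpZl -coefD -modpD.
by rewrite -mul_polyC; congr ((_ %% _)`_ _); ring.
Qed.

End MulX.

(** * Dirichlet characters and their sums over primes *)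

Section Characters.
Variables (R : realType) (F : finFieldType) (m : {poly F}) (chi : {poly F} -> R[i]).
Hypothesis dm : (0 < deg m)%N.
Hypothesis chi_char : is_character m chi.
Implicit Types f g : {poly F}.

Let m0 : m != 0.
Proof. by apply: contraTneq dm => ->; rewrite /deg size_poly0. Qed.

Let size_mod f : (size (f %% m)%R <= deg m)%N.
Proof. by have := ltn_modp f m; rewrite m0 (size_deg m0) ltnS. Qed.

Lemma modp_mulmod f g : (f %% m * (g %% m)) %% m = (f * g) %% m.
Proof. by rewrite modp_mul mulrC modp_mul mulrC. Qed.

Lemma char_mod f : chi (f %% m) = chi f.
Proof.
case: chi_char => lam _ chiE; rewrite !chiE coprimep_modl modp_id //.
Qed.

Lemma char1 : chi 1 = 1.
Proof. by case: chi_char => lam [lam1 _] ->; rewrite coprime1p. Qed.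

Lemma charM f g : chi (f * g) = chi f * chi g.
Proof.
case: chi_char => lam [_ lamM] chiE; rewrite !chiE coprimepMl.
case: (boolP (coprimep f m)) => cf /=; last by rewrite mul0r.
case: (boolP (coprimep g m)) => cg; last by rewrite mulr0.
have ru h : coprimep h m -> npolyp (deg m) (h %% m) \in residue_units m.
  by move=> ch; rewrite mem_residue_units //= npolypK ?size_mod // coprimep_modl.
have := lamM _ _ (ru _ cf) (ru _ cg); rewrite /= !npolypK ?size_mod // => <-.
by rewrite modp_mulmod.
Qed.

Lemma charX f i : chi (f ^+ i) = chi f ^+ i.
Proof. by elim: i => [|i IH]; rewrite ?char1 // !exprS charM IH. Qed.

(** The powers of [f] repeat modulo [m], so two different powers of [cabs (chi f)] agree. *)
Lemma char_le1 f : cabs (chi f) <= 1.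
Proof.
pose g (i : 'I_#|{poly_(deg m) F}|.+1) := npolyp (deg m) (f ^+ i %% m).
have /injectivePn[i [j ij gij]] : ~~ injectiveb g.
  apply/injectiveP => gi; have := leq_card g gi.
  by rewrite card_ord ltnn.
have chij : chi f ^+ i = chi f ^+ j.
  move/(congr1 val): gij; rewrite /= !npolypK ?size_mod // => e.
  by rewrite -!charX -(char_mod (f ^+ i)) e char_mod.
rewrite leNgt; apply/negP => c1; have c0 := lt_trans ltr01 c1.
move/(congr1 (@cabs R)): chij; rewrite !cabsX.
by move=> /(ieexprIn c0 (negbT (gt_eqF c1))) /val_inj e; rewrite e eqxx in ij.
Qed.

Hypothesis chi_np : ~ principal m chi.

Lemma char_sum_residues : \sum_(r : {poly_(deg m) F}) chi (val r) = 0.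
Proof.
have [b branch_coef b1] : exists2 b, coprimep b m & chi b != 1.
  apply: contrapT => nex; apply: chi_np => f cf.
  by apply/eqP/negPn/negP => h; apply: nex; exists f.
pose mb (r : {poly_(deg m) F}) := npolyp (deg m) ((b * val r) %% m).
have mb_inj : injective mb.
  move=> r s /(congr1 val) /=; rewrite !npolypK ?size_mod // => /eqP.
  rewrite -subr_eq0 -modpN -modpD -mulrBr => /eqP/modp_eq0P.
  rewrite Gauss_dvdpr ?[coprimep m _]coprimep_sym // => dv.
  apply: val_inj; apply/eqP; rewrite -subr_eq0; apply: contraTT dv => ne.
  apply/negP => /(dvdp_leq ne); apply/negP; rewrite -ltnNge (size_deg m0) ltnS.
  apply: leq_trans (size_polyD _ _) _; rewrite size_polyN geq_max.
  by rewrite !size_npoly.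
have : chi b * \sum_(r : {poly_(deg m) F}) chi (val r) = \sum_(r : {poly_(deg m) F}) chi (val r).
  rewrite mulr_sumr [RHS](reindex_inj mb_inj) /=; apply: eq_bigr => r _.
  by rewrite npolypK ?size_mod // char_mod charM.
move/eqP; rewrite -[X in _ == X]mul1r -subr_eq0 -mulrBl mulf_eq0 subr_eq0 (negbTE b1).
by move/eqP.
Qed.

(** Adding a polynomial of degree less than [deg m] permutes the monic polynomials of degree [j];
    averaging over these translations produces complete sums over residues, which vanish. *)
Lemma char_Lsum0 j : (deg m <= j)%N -> Lsum chi j = 0.
Proof.
move=> mj.
have shift (f : {poly F}) (r : {poly_(deg m) F}) : f \is monic -> deg f = j ->
    (f + val r \is monic) /\ deg (f + val r) = j.
  move=> mf df; have sr : (size (val r) < size f)%N.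
    by rewrite (size_deg (monic_neq0 mf)) df ltnS (leq_trans (size_npoly r)).
  by rewrite monicE lead_coefDl // -monicE mf /deg size_polyDl.
have step (r : {poly_(deg m) F}) : Lsum chi j = \sum_(f in monics F j) chi (val f + val r).
  rewrite /Lsum; pose sh (f : {poly_j.+1 F}) := npolyp j.+1 (val f + val r).
  have sz (f : {poly_j.+1 F}) : (size (val f + val r)%R <= j.+1)%N.
    apply: leq_trans (size_polyD _ _) _; rewrite geq_max size_npoly /=.
    by rewrite (leq_trans (size_npoly r)) // leqW.
  have sh_inj : injective sh.
    by move=> f g /(congr1 val) /=; rewrite !npolypK ?sz // => /addIr /val_inj.
  rewrite (reindex_inj sh_inj) /=; apply: eq_big => [f|f _]; last by rewrite npolypK ?sz.
  apply/monicsP/monicsP; rewrite /= npolypK ?sz // => -[mf df]; last exact: shift.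
  have := shift _ (- r) mf df; rewrite /= addrK; by [].
have : (#|{poly_(deg m) F}|%:R : R[i]) * Lsum chi j = 0.
  rewrite mulr_natl -sumr_const.
  transitivity (\sum_(r : {poly_(deg m) F}) \sum_(f in monics F j) chi (val f + val r)).
    by apply: eq_bigr => r _; apply: step.
  rewrite exchange_big big1 // => f _.
  pose sh (r : {poly_(deg m) F}) := npolyp (deg m) ((val f + val r) %% m).
  have sh_inj : injective sh.
    move=> r s /(congr1 val) /=; rewrite !npolypK ?size_mod // !modpD => /addrI.
    rewrite !modp_small; first by move/val_inj.
      by rewrite (size_deg m0) ltnS size_npoly.
    by rewrite (size_deg m0) ltnS size_npoly.
  have := char_sum_residues; rewrite (reindex_inj sh_inj) /= => h.
  by rewrite -[RHS]h; apply: eq_bigr => r _; rewrite npolypK ?size_mod // char_mod.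
move/eqP; rewrite mulf_eq0 pnatr_eq0 => /orP[/eqP c0|/eqP //].
by have := card0_eq c0 (npolyp (deg m) 0); rewrite inE.
Qed.

Lemma char_csum_le N : (0 < N)%N ->
  cabs (csum chi N) <= (deg m)%:R * Num.sqrt (#|F|%:R) ^+ N.
Proof.
have [n' dE] : exists n', deg m = n'.+1 by case: (deg m) dm => // n' _; exists n'.
move=> N0.
apply: (csum_le (T := mulXmx m n') char1 charM char_le1) => //; last first.
  by move=> j; apply: char_Lsum0.
move=> f g fg; rewrite -(char_mod f) -(char_mod g); congr chi.
by apply: (modrow_inj dE); rewrite -(modrow_horner dE f) -(modrow_horner dE g) fg.
Qed.

Definition prime_sum N := \sum_(f in monics F N | isprime (val f)) chi (val f).

Lemma prime_sum0 : prime_sum 0 = 0.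
Proof.
rewrite /prime_sum big_pred0 // => f; apply/negbTE/negP => /andP[/monicsP[_ df] pf].
by have := isprime_deg pf; rewrite df.
Qed.

Lemma sqrtq_ge1 : 1 <= Num.sqrt (#|F|%:R : R).
Proof.
rewrite -[X in X <= _]sqrtr1; apply: ler_wsqrtr; rewrite ler1n.
exact: ltnW (finNzRing_gt1 F).
Qed.

Lemma card_monics_le d : (#|monics F d| <= #|F| ^ d.+1)%N.
Proof. by apply: leq_trans (max_card _) _; rewrite card_npoly. Qed.

(** In [csum chi N] the primes of degree [N] contribute [N] times the prime sum. The remaining terms
    belong to proper divisors [d <= N / 2] of [N]: there are at most [N] such [d], each with weight
    at most [N], and the at most [q ^ d.+1] polynomials of degree [d] cost a factor
    [q * q ^ (N / 2)]. *)
Lemma prime_sum_le N :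
  cabs (prime_sum N) <= ((deg m)%:R + #|F|%:R * N%:R ^+ 2) * Num.sqrt (#|F|%:R) ^+ N.
Proof.
set s := Num.sqrt _; have s1 : 1 <= s := sqrtq_ge1.
have s0 : 0 <= s by apply: le_trans s1.
have q0 : 0 <= #|F|%:R :> R by rewrite ler0n.
case: (posnP N) => [->|N0].
  rewrite prime_sum0 cabs0 expr0 mulr1 expr0n mulr0 addr0 ler0n; by [].
have := char_csum_le N0; rewrite -/s /csum.
have NN : (N < N.+1)%N by [].
rewrite (bigD1 (Ordinal NN)) /=; last by rewrite N0 dvdnn.
have -> : \sum_(f in monics F N | isprime (val f)) chi (val f ^+ (N %/ N)) *+ N = prime_sum N *+ N.
  by rewrite /prime_sum -sumrMnl; apply: eq_bigr => f _; rewrite divnn N0 expr1.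
set E := \sum_(_ | _) _ => h.
have EB : cabs E <= N%:R * (N%:R * (#|F|%:R * s ^+ N)).
  apply: le_trans (cabs_sum _ _ _) _.
  apply: (@le_trans _ _ (\sum_(d < N.+1 | (0 < d)%N && (d %| N)%N && (d != Ordinal NN)) (N%:R * (#|F|%:R * s ^+ N)))).
    apply: ler_sum => d /andP[/andP[d0 dN] dn].
    apply: le_trans (cabs_sum _ _ _) _.
    apply: (@le_trans _ _ (\sum_(f in monics F d) N%:R)).
      rewrite big_mkcondr; apply: ler_sum => f _; case: ifP => _; last by rewrite ler0n.
      rewrite -[Y in cabs Y]mulr_natl cabsM cabs_nat -[X in _ <= X]mulr1.
      apply: ler_pM; rewrite ?ler0n ?cabs_ge0 ?char_le1 // ler_nat -ltnS; exact: ltn_ord.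
    rewrite sumr_const -[X in X <= _]mulr_natl mulrC; apply: ler_wpM2l; first by rewrite ler0n.
    apply: (@le_trans _ _ (#|F| ^ d.+1)%:R); first by rewrite ler_nat card_monics_le.
    rewrite natrX exprS; apply: ler_wpM2l => //.
    have -> : #|F|%:R ^+ d = s ^+ (2 * d) by rewrite exprM sqr_sqrtr.
    apply: ler_weXn2l => //.
    move: dN dn; rewrite -val_eqE /=; move: (nat_of_ord d) => t /dvdnP[c cE] tN.
    case: c cE => [|[|c]] cE; first by move: N0; rewrite cE.
      by rewrite cE mul1n eqxx in tN.
    by rewrite cE leq_mul2r orbT.
  rewrite sumr_const -[X in X <= _]mulr_natl; apply: ler_wpM2r.
    by rewrite !mulr_ge0 ?ler0n ?exprn_ge0.
  rewrite ler_nat; apply: leq_trans (_ : #|predC1 (ord0 : 'I_N.+1)| <= N)%N.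
    apply: subset_leq_card; apply/subsetP => d; rewrite !inE => /andP[/andP[d0 _] _].
    by rewrite -val_eqE /= -lt0n.
  by have := cardC1 (ord0 : 'I_N.+1); rewrite card_ord => ->.
have N1 : 1 <= N%:R :> R by rewrite ler1n.
have h2 : N%:R * cabs (prime_sum N) <= (deg m)%:R * s ^+ N + N%:R * (N%:R * (#|F|%:R * s ^+ N)).
  have -> : N%:R * cabs (prime_sum N) = cabs (prime_sum N *+ N).
    by rewrite -[Y in _ = cabs Y]mulr_natl cabsM cabs_nat.
  have -> : prime_sum N *+ N = (prime_sum N *+ N + E) - E by rewrite addrK.
  by apply: le_trans (cabsB _ _) _; apply: lerD.
apply: le_trans (_ : N%:R * cabs (prime_sum N) <= _); first by rewrite ler_peMl ?cabs_ge0.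
by apply: le_trans h2 _; rewrite mulrDl expr2 !mulrA [N%:R * N%:R * _]mulrC !mulrA.
Qed.

End Characters.

(** * The convolution square of the prime indicator *)

Section PrimeConv.
Variables (R : realType) (F : finFieldType).
Implicit Types f g h : {poly F}.
Local Notation psi := (dirichlet_conv (ind_primes R F) (ind_primes R F)).

Lemma ind_primesE f : ind_primes R F f = (isprime f)%:R.
Proof.
by rewrite /ind_primes indicE.
Qed.

(** The bound [n] is free, so that all [f] of one degree can share the index type of their
    factors. *)
Lemma psi_sum n f : f != 0 -> (size f <= n)%N ->
  psi f = \sum_(g : {poly_n F} | isprime (val g))
     \sum_(h : {poly_n F} | isprime (val h) && (val g * val h == f)) 1.
Proof.
move=> f0 fn; rewrite /dirichlet_conv.
have szl g : g %| f -> (size g <= size f)%N by apply: dvdp_leq.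
transitivity (\sum_(g : {poly_(size f) F} | isprime (val g) && (val g %| f))
     \sum_(h : {poly_(size f) F} | isprime (val h) && (val g * val h == f)) (1 : R[i])).
  rewrite pair_big_dep /= big_mkcond [RHS]big_mkcond; apply: eq_bigr => -[g h] _ /=.
  rewrite !ind_primesE; case: (boolP (isprime (val g))) => pg /=; last by rewrite mul0r if_same.
  case: (boolP (isprime (val h))) => ph /=; last by rewrite mulr0 andbF if_same.
  rewrite !isprime_monic //= mulr1; case: eqP => [gh|]; last by rewrite andbF.
  by have := dvdp_mulIl (val g) (val h); rewrite gh => ->.
pose G m g := \sum_(h : {poly_m F} | isprime (val h) && (g * val h == f)) (1 : R[i]).
have GE g : G (size f) g = G n g.
  apply: (@sum_npoly F _ (size f) n (fun h => isprime h && (g * h == f)) (fun=> 1)) => h.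
  move=> /andP[_ /eqP gh]; have sh : (size h <= size f)%N.
    by apply: szl; rewrite -gh dvdp_mulIr.
  by rewrite sh (leq_trans sh).
transitivity (\sum_(g : {poly_(size f) F} | isprime (val g) && (val g %| f)) G n (val g)).
  by apply: eq_bigr => g _; apply: GE.
rewrite (@sum_npoly F _ (size f) n (fun g => isprime g && (g %| f)) (G n)); last first.
  by move=> g /andP[_ /szl sg]; rewrite sg (leq_trans sg).
rewrite [RHS](bigID (fun g : {poly_n F} => val g %| f)) /= [X in _ = _ + X]big1 ?addr0 //.
move=> g /andP[_ ngf]; rewrite big_pred0 // => h; apply/negbTE/negP => /andP[_ /eqP gh].
by rewrite -gh dvdp_mulIl in ngf.
Qed.

Lemma conv_sum (chi : {poly F} -> R[i]) N : (forall f g, chi (f * g) = chi f * chi g) ->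
  \sum_(f in monics F N) psi (val f) * chi (val f) =
  \sum_(a < N.+1) prime_sum chi a * prime_sum chi (N - a).
Proof.
move=> chiM.
transitivity (\sum_(g : {poly_N.+1 F} | isprime (val g))
   \sum_(h : {poly_N.+1 F} | isprime (val h) && (deg (val g * val h) == N)) chi (val g) * chi (val h)).
  transitivity (\sum_(f in monics F N) \sum_(g : {poly_N.+1 F} | isprime (val g))
     \sum_(h : {poly_N.+1 F} | isprime (val h)) (if val g * val h == val f then chi (val g) * chi (val h) else 0)).
    apply: eq_bigr => f /monicsP[mf df].
    rewrite (@psi_sum N.+1) ?monic_neq0 // ?size_npoly // mulr_suml.
    apply: eq_bigr => g _; rewrite mulr_suml big_mkcondr /=.
    apply: eq_bigr => h _; case: eqP => // <-.
    by rewrite mul1r chiM.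
  rewrite exchange_big; apply: eq_bigr => g pg; rewrite exchange_big [RHS]big_mkcondr.
  apply: eq_bigr => h ph; rewrite -big_mkcondr /=.
  have mgh : val g * val h \is monic by rewrite monicMl isprime_monic.
  case: eqP => dgh.
    have sgh : (size (val g * val h)%R <= N.+1)%N by rewrite (size_deg (monic_neq0 mgh)) dgh.
    rewrite (big_pred1 (NPoly sgh)) // => f; apply/andP/eqP => [[_ /eqP fE]|->].
      by apply: val_inj.
    by split=> //; apply/monicsP.
  rewrite big_pred0 // => f; apply/negbTE/negP => /andP[/monicsP[_ df] /eqP fE].
  by case: dgh; rewrite fE.
have prE a : (a <= N)%N -> prime_sum chi a =
    \sum_(g : {poly_N.+1 F} | isprime (val g) && (deg (val g) == a)) chi (val g).
  move=> aN; rewrite -(@sum_npoly F _ a.+1 N.+1 (fun g => isprime g && (deg g == a)) chi); last first.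
    move=> g /andP[/isprime_neq0 g0 /eqP dg]; rewrite (size_deg g0) dg leqnn /=; lia.
  apply: eq_bigl => g; rewrite andbC; case: (boolP (isprime _)) => //= pg.
  apply/monicsP/eqP => [[]//|dg]; split=> //; exact: isprime_monic.
have dN (g : {poly_N.+1 F}) : (deg (val g) < N.+1)%N.
  rewrite ltnS /deg; have := size_npoly g; case: (size _) => //.
rewrite (partition_big (fun g : {poly_N.+1 F} => Ordinal (dN g)) predT) //=.
apply: eq_bigr => a _; rewrite prE -1?ltnS //; rewrite mulr_suml.
apply: eq_big => [g|g /andP[pg /eqP ga]]; first by rewrite -val_eqE.
have ga' : deg (val g) = a by rewrite -ga.
rewrite prE ?leq_subr // mulr_sumr; apply: eq_bigl => h.
case: (boolP (isprime (val h))) => //= ph.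
rewrite degM ?isprime_monic // ga'; have := ltn_ord a; lia.
Qed.

Lemma conv_char_le m (chi : {poly F} -> R[i]) N :
  (0 < deg m)%N -> is_character m chi -> ~ principal m chi ->
  cabs (\sum_(f in monics F N) psi (val f) * chi (val f)) <=
  N.+1%:R * ((deg m)%:R + #|F|%:R * N%:R ^+ 2) ^+ 2 * Num.sqrt (#|F|%:R) ^+ N.
Proof.
move=> dm cm np; rewrite conv_sum; last exact: (charM dm cm).
set s := Num.sqrt _; set A := _ + _.
have s0 : 0 <= s by rewrite sqrtr_ge0.
have q0 : 0 <= #|F|%:R :> R by rewrite ler0n.
apply: le_trans (cabs_sum _ _ _) _.
apply: (@le_trans _ _ (\sum_(a < N.+1) (A ^+ 2 * s ^+ N))); last first.
  by rewrite sumr_const card_ord -[X in X <= _]mulr_natl mulrA.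
apply: ler_sum => a _; have aN : (a <= N)%N by rewrite -ltnS.
have bd b : (b <= N)%N -> cabs (prime_sum chi b) <= A * s ^+ b.
  move=> bN; apply: le_trans (prime_sum_le dm cm np b) _.
  apply: ler_wpM2r; first by rewrite exprn_ge0.
  rewrite lerD2l; apply: ler_wpM2l => //.
  by apply: lerXn2r; rewrite ?nnegrE ?ler0n // ler_nat.
rewrite cabsM; have -> : A ^+ 2 * s ^+ N = (A * s ^+ a) * (A * s ^+ (N - a)).
  by rewrite mulrACA -exprD subnKC.
by apply: ler_pM; rewrite ?cabs_ge0 // bd // leq_subr.
Qed.

(** In [f = g h] the prime [g] determines [h], so the factorizations inject into the monic
    divisors. *)
Lemma psi_le_tau f : f \is monic -> cabs (psi f) <= (tau f)%:R.
Proof.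
move=> mf; have f0 := monic_neq0 mf.
rewrite (psi_sum f0 (leqnn _)); apply: le_trans (cabs_sum _ _ _) _.
rewrite /tau -sum1_card natr_sum.
apply: (@le_trans _ _ (\sum_(g : {poly_(size f) F} | isprime (val g) && (val g %| f)) (1 : R))); last first.
  rewrite [X in _ <= X](bigID (fun g : {poly_(size f) F} => isprime (val g) )) /=.
  rewrite -[X in X <= _]addr0; apply: lerD; last by apply: sumr_ge0.
  rewrite le_eqVlt; apply/orP; left; apply/eqP; apply: eq_bigl => g.
  rewrite inE; case: (boolP (isprime _)) => pg; rewrite ?andbF //= andbT.
  by rewrite isprime_monic.
rewrite [X in X <= _](bigID (fun g : {poly_(size f) F} => val g %| f)) /=.
rewrite [X in _ + X]big1 ?addr0; last first.
  move=> g /andP[_ ngf]; rewrite big_pred0 ?cabs0 // => h; apply/negbTE/negP => /andP[_ /eqP gh].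
  by have := dvdp_mulIl (val g) (val h); rewrite gh (negbTE ngf).
apply: ler_sum => g /andP[pg gf]; have /dvdpP[h fE] := gf.
have h0 : h != 0 by apply: contraNneq f0 => h0; rewrite fE h0 mul0r.
have sh : (size h <= size f)%N by rewrite fE dvdp_leq ?dvdp_mulIl // -fE.
apply: le_trans (cabs_sum _ _ _) _.
rewrite (bigID (pred1 (NPoly sh))) /= [X in _ + X]big1 ?addr0; last first.
  move=> h' /andP[/andP[_ /eqP gh] /eqP hn]; case: hn; apply: val_inj => /=.
  by apply: (mulfI (isprime_neq0 pg)); rewrite gh mulrC.
rewrite big_mkcond (bigD1 (NPoly sh)) //= big1 ?addr0; last first.
  by move=> h' /negbTE ->; rewrite andbF.
by case: ifP => _; [rewrite -[X in X <= _]/(cabs 1) cabs1 | apply: ler01].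
Qed.

Lemma psi_growth : growth_condition psi.
Proof.
exists 1; first exact: ltr01.
exists 1; first exact: ltr01.
move=> f mf; rewrite mul1r powRr1 ?ler0n //; exact: psi_le_tau.
Qed.

End PrimeConv.

(** * Orthogonality of characters and arithmetic progressions *)

Section Dual.
Variables (C : numClosedFieldType) (U : finType) (n' : nat).
Hypothesis cardU : #|U| = n'.+1.
Variables (mul : U -> U -> U) (one : U) (inv : U -> U).
Hypotheses (mulA : associative mul) (mulC : commutative mul)
  (mul1 : left_id one mul) (mulV : left_inverse one inv mul).

Let e (i : 'I_n'.+1) : U := enum_val (cast_ord (esym cardU) i).
Let r (a : U) : 'I_n'.+1 := cast_ord cardU (enum_rank a).
Let eK : cancel e r.
Proof. by move=> i; rewrite /r /e enum_valK cast_ordKV. Qed.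
Let rK : cancel r e.
Proof. by move=> a; rewrite /r /e cast_ordK enum_rankK. Qed.

Let mulI a : injective (mul a).
Proof. by move=> x y /(congr1 (mul (inv a))); rewrite !mulA mulV !mul1. Qed.

(** The regular representation of a finite abelian group given by bare operations on [U]. Acting on
    row vectors, [regmx a] translates the coordinates by [a]. *)
Definition regmx a : 'M[C]_n'.+1 := \matrix_(c, b) (e c == mul a (e b))%:R.

Lemma mul_regmx m (v : 'M[C]_(m, n'.+1)) a i b : (v *m regmx a) i b = v i (r (mul a (e b))).
Proof.
rewrite mxE (bigD1 (r (mul a (e b)))) //= big1 ?addr0 => [|c nc]; first by rewrite mxE rK eqxx mulr1.
rewrite mxE; case: eqP => [cE|_]; last by rewrite mulr0.
by rewrite -cE eK eqxx in nc.
Qed.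

Lemma regmxM a b : regmx (mul a b) = regmx a *m regmx b.
Proof.
apply/matrixP => c d; rewrite mul_regmx !mxE rK; by rewrite mulA.
Qed.

Lemma regmx1 : regmx one = 1%:M.
Proof. by apply/matrixP => c d; rewrite !mxE mul1 (inj_eq (can_inj eK)). Qed.

Lemma regmx_expn_eq1 a : exists2 k, (0 < k)%N & regmx a ^+ k = 1.
Proof.
exists (fingraph.order (mul a) one); first exact: fingraph.order_gt0.
have h k : regmx (iter k (mul a) one) = regmx a ^+ k.
  by elim: k => [|k IH]; rewrite ?regmx1 // iterS regmxM IH exprS.
by rewrite -h fingraph.iter_order ?regmx1.
Qed.

(** [regmx a] has finite order [k], and ['X^k - 1] is separable in characteristic 0. *)
Lemma regmx_diagonalizable a : diagonalizable (regmx a).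
Proof.
have [k k0 ak] := regmx_expn_eq1 a.
have [rs rsE] := closed_field_poly_normal ('X^k - 1 : {poly C}).
have mon : ('X^k - 1 : {poly C}) \is monic by apply: monicXnsubC.
rewrite (monicP mon) scale1r in rsE.
apply/diagonalizableP; exists rs.
  rewrite -separable_prod_XsubC -rsE; apply: cyclotomic.separable_Xn_sub_1.
  by rewrite pnatr_eq0 -lt0n.
by rewrite -rsE; apply: mxminpoly_min; rewrite rmorphB rmorphXn rmorph1 /= horner_mx_X ak subrr.
Qed.

(* The common eigenvectors of the regular representation are the characters, up to
   scaling. *)
Lemma dual_basis : exists2 P : 'M[C]_n'.+1, P \in unitmx &
  exists D : U -> 'I_n'.+1 -> C, forall a i b, P i (r (mul a (e b))) = D a i * P i b.
Proof.
have [P Pu /allP h] : codiagonalizable [seq regmx a | a <- enum U].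
  apply/codiagonalizableP; split=> [x y /mapP[a _ ->] /mapP[b _ ->]|x /mapP[a _ ->]].
    by rewrite /comm_mx -!regmxM mulC.
  exact: regmx_diagonalizable.
exists P => //.
have hD a : exists D : 'rV[C]_n'.+1, P *m regmx a = diag_mx D *m P.
  have /similar_diagPex[D /(similarP Pu) DE] : similar_diag P (regmx a).
    by apply: h; apply: map_f; rewrite mem_enum.
  by exists D.
have [D DE] := choice hD.
exists (fun a i => D a 0 i) => a i b; rewrite -mul_regmx DE mul_diag_mx mxE //.
Qed.

(** Each row of [P], divided by its entry at [one], is a character. As the rows are independent,
    these [#|U|] characters are distinct, hence orthogonal. The relation summed over characters is
    the transposed one, obtained by commuting the factors of [L *m Q = 1]. *)
Lemma dual_exists : exists lam : 'I_n'.+1 -> U -> C,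
  [/\ forall i, lam i one = 1,
      forall i a b, lam i (mul a b) = lam i a * lam i b &
      forall l a, \sum_i lam i (inv l) * lam i a = n'.+1%:R * (a == l)%:R].
Proof.
have [P Pu [D DE]] := dual_basis.
have Dr a i b : P i (r (mul a b)) = D a i * P i (r b) by rewrite -{1}(rK b) DE.
pose p i := P i (r one).
have mule1 a : mul a one = a by rewrite mulC mul1.
have PD a i : P i (r a) = D a i * p i by rewrite -{1}(mule1 a) Dr.
have rowP v : v *m P = 0 -> v = 0 :> 'rV_n'.+1.
  by move/(congr1 (mulmx^~ (invmx P))); rewrite mulmxK // mul0mx.
have delta0 i : delta_mx 0 i != 0 :> 'rV[C]_n'.+1.
  by apply/eqP; move/matrixP/(_ 0 i)/eqP; rewrite !mxE !eqxx oner_eq0.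
have p0 i : p i != 0.
  apply: contra_neq (delta0 i) => pi0; apply: rowP; rewrite -rowE.
  by apply/matrixP => x y; rewrite !mxE -[y]eK PD pi0 mulr0.
have D1 i : D one i = 1 by apply: (mulIf (p0 i)); rewrite -PD mul1r.
have DM i a b : D (mul a b) i = D a i * D b i.
  by apply: (mulIf (p0 i)); rewrite -PD Dr PD mulrA.
have Dinj i j : (forall a, D a i = D a j) -> i = j.
  move=> h; apply/eqP; apply: contraT => nij.
  have : delta_mx 0 i - (p i / p j) *: delta_mx 0 j = 0 :> 'rV[C]_n'.+1.
    apply: rowP; rewrite mulmxBl -scalemxAl -!rowE; apply/matrixP => x y.
    by rewrite !mxE -[y]eK !PD h mulrCA divfK // subrr.
  move/matrixP/(_ 0 i)/eqP; rewrite !mxE !eqxx /= (negbTE nij) mulr0 subr0.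
  by rewrite oner_eq0.
have DV i a : D (inv a) i * D a i = 1 by rewrite -DM mulV D1.
have orth i j : \sum_b D b i * D (inv b) j = n'.+1%:R * (i == j)%:R.
  case: eqP => [->|nij].
    rewrite (eq_bigr (fun=> 1)) => [|b _]; last by rewrite mulrC DV.
    by rewrite sumr_const -cardU mulr1.
  rewrite mulr0; apply/eqP; apply: contraT => S0; case: nij; apply: Dinj => a.
  set S := \sum_b _ in S0; have SE : S = D a i * D (inv a) j * S.
    have bij : bijective (mul a) by apply: injF_bij; apply: mulI.
    rewrite {1}/S (reindex (mul a)) /=; last by apply: onW_bij.
    rewrite mulr_sumr; apply: eq_bigr => b _.
    have -> : inv (mul a b) = mul (inv a) (inv b).
      apply: (@mulI (mul a b)); rewrite mulC mulV mulC.
      by rewrite mulA -(mulA (inv a)) (mulC (inv b)) mulA mulV mul1 -(mulC b) mulC mulV .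
    by rewrite !DM; ring.
  have h : D a i * D (inv a) j = 1 by apply: (mulIf S0); rewrite -SE mul1r.
  have := congr1 (fun x => x * D a j) h; rewrite -mulrA DV mulr1 => ->.
  by rewrite mul1r.
pose L : 'M[C]_n'.+1 := \matrix_(i, b) D (e b) i.
pose Q : 'M[C]_n'.+1 := \matrix_(b, i) (n'.+1%:R^-1 * D (inv (e b)) i).
have n0 : n'.+1%:R != 0 :> C by rewrite pnatr_eq0.
have LQ : L *m Q = 1%:M.
  apply/matrixP => i j; rewrite !mxE -[RHS](mulKf n0) -[_%:R * _]orth mulr_sumr.
  rewrite (reindex e) /=; last by exists r => ? _; [apply: eK|apply: rK].
  by apply: eq_bigr => b _; rewrite !mxE; ring.
exists (fun i a => D a i); split=> [i|i a b|l a] //.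
have /matrixP/(_ (r l) (r a)) := mulmx1C LQ; rewrite !mxE => h.
rewrite -[a == l](inj_eq (can_inj rK)) eq_sym -h mulr_sumr.
by apply: eq_bigr => i _; rewrite !mxE !rK mulrA mulVKf.
Qed.

End Dual.

Section Progression.
Variables (R : realType) (F : finFieldType) (m : {poly F}).
Hypothesis dm : (0 < deg m)%N.
Implicit Types f g l : {poly F}.

Let m0 : m != 0.
Proof. by apply: contraTneq dm => ->; rewrite /deg size_poly0. Qed.

Let size_mod f : (size (f %% m)%R <= deg m)%N.
Proof. by have := ltn_modp f m; rewrite m0 (size_deg m0) ltnS. Qed.

Let U := {r : {poly_(deg m) F} | r \in residue_units m}.
Let pol (a : U) : {poly F} := val (val a).

Let ru f : coprimep f m -> NPoly (size_mod f) \in residue_units m.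
Proof. by move=> cf; rewrite mem_residue_units //= coprimep_modl. Qed.

Let one : U := exist (fun r => r \in residue_units m) _ (ru (coprime1p m)).
Let res f : U := insubd one (NPoly (size_mod f)).

Let pol_res f : coprimep f m -> pol (res f) = f %% m.
Proof. by move=> cf; rewrite /pol /res insubdK // ru. Qed.

Let pol_coprime a : coprimep (pol a) m.
Proof. by rewrite -mem_residue_units // (valP a). Qed.

Let pol_inj : injective pol.
Proof. by move=> a b /val_inj/val_inj. Qed.

Let pol_mod a : pol a %% m = pol a.
Proof. by rewrite modp_small // (size_deg m0) ltnS size_npoly. Qed.

Let mul a b := res (pol a * pol b).

Let polM a b : pol (mul a b) = (pol a * pol b) %% m.
Proof. by rewrite pol_res // coprimepMl !pol_coprime. Qed.

(** [l'] is an inverse of [l] modulo [m], so that [chi i l'] plays the role of the complex conjugate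
    of [chi i l]. *)
Lemma residue_dual : exists chi : 'I_(phi m) -> {poly F} -> R[i],
  (forall i, is_character m (chi i)) /\
  forall l, coprimep l m -> exists2 l', coprimep l' m &
    forall f, \sum_i chi i l' * chi i f = (phi m)%:R * (m %| f - l)%R%:R.
Proof.
have mulA : associative mul.
  move=> a b c; apply: pol_inj; rewrite !polM modp_mul [in RHS]mulrC modp_mul.
  by congr (_ %% m); ring.
have mulC : commutative mul by move=> a b; apply: pol_inj; rewrite !polM mulrC.
have pol1 : pol one = 1 %% m by [].
have mul1 : left_id one mul.
  by move=> a; apply: pol_inj; rewrite polM pol1 mulrC modp_mul mulr1 pol_mod.
have hV a : exists b, mul b a = one.
  have := valP a; rewrite inE => /existsP[s /eqP sE].
  have cs : coprimep (val s) m.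
    have : coprimep (pol a * val s) m by rewrite -coprimep_modl sE coprimep_modl coprime1p.
    by rewrite coprimepMl => /andP[].
  exists (res (val s)); apply: pol_inj.
  by rewrite polM pol_res // pol1 mulrC modp_mul.
have [inv mulV] := choice hV.
have cU : #|{: U}| = phi m by rewrite card_sig; apply: eq_card => r; rewrite !inE.
have [n' nE] : exists n', phi m = n'.+1.
  by exists (phi m).-1; rewrite prednK // -cU; apply/card_gt0P; exists one.
rewrite nE; rewrite nE in cU.
have [lam [lam1 lamM lamO]] := dual_exists R[i] cU mulA mulC mul1 mulV.
pose chi (i : 'I_n'.+1) f := if coprimep f m then lam i (res f) else 0.
have resE f g : coprimep f m -> coprimep g m -> f %% m = g %% m -> res f = res g.
  by move=> cf cg fg; apply: pol_inj; rewrite !pol_res.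
exists chi; split=> [i|l cl].
  exists (fun f => lam i (res f)).
    split=> [|a b ra rb].
      rewrite -(lam1 i); congr lam.
      apply: pol_inj; rewrite pol_res ?coprimep_modl ?coprime1p //.
      by rewrite modp_id.
    rewrite !mem_residue_units // in ra rb; rewrite -lamM; congr lam.
    apply: pol_inj; rewrite polM !pol_res ?coprimep_modl ?coprimepMl ?ra ?rb //.
    by rewrite modp_mulmod modp_id.
  move=> f; rewrite /chi; case: ifP => // cf; congr lam; apply: resE; rewrite ?coprimep_modl //.
  by rewrite modp_id.
exists (pol (inv (res l))); first exact: pol_coprime.
move=> f; case: (boolP (coprimep f m)) => cf; last first.
  rewrite big1 => [|i _]; last by rewrite /chi (negbTE cf) mulr0.
  case: (boolP (m %| f - l)) => [/modp_eq0P|_]; last by rewrite mulr0.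
  move/eqP; rewrite modpD modpN subr_eq0 => /eqP fl.
  by rewrite -coprimep_modl fl coprimep_modl cl in cf.
have h := lamO (res l) (res f).
have -> : (m %| f - l) = (res f == res l).
  rewrite -(inj_eq pol_inj) !pol_res // -subr_eq0 -modpN -modpD.
  by apply/modp_eq0P/eqP.
rewrite -h; apply: eq_bigr => i _; rewrite /chi cf pol_coprime; congr (lam _ _ * _).
by apply: pol_inj; rewrite pol_res ?pol_coprime // pol_mod.
Qed.

(** Orthogonality writes the congruence condition as a mean over characters. The principal one gives
    exactly the subtracted main term, and the others contribute at most [B] each to a mean of
    [phi m] terms. *)
Lemma progression_le (psi : {poly F} -> R[i]) M l (B : R) : 0 <= B ->
  (forall chi, is_character m chi -> ~ principal m chi ->
     cabs (\sum_(f in monics F M) psi (val f) * chi (val f)) <= B) ->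
  coprimep l m -> cabs (progression_error psi M m l) <= B.
Proof.
move=> B0 hB cl; have [chi [chiC chiO]] := residue_dual.
have [l' cl' lE] := chiO _ cl.
pose S i := \sum_(f in monics F M) psi (val f) * chi i (val f).
pose S0 := \sum_(f in monics F M | coprimep (val f) m) psi (val f).
pose pr := [pred i : 'I_(phi m) | `[< principal m (chi i) >]].
have c1 : coprimep 1 m := coprime1p m.
have phi_gt0 : (0 < phi m)%N.
  by rewrite /phi; apply/card_gt0P; exists (NPoly (size_mod 1)); apply: ru.
have phi0 : (phi m)%:R != 0 :> R[i] by rewrite pnatr_eq0 -lt0n.
have chi0 i f : ~~ coprimep f m -> chi i f = 0.
  by case: (chiC i) => lam _ -> /negbTE ->.
have sum_pr (i : 'I_(phi m)) : pr i ->
    \sum_(r : {poly_(deg m) F}) chi i (val r) = (phi m)%:R.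
  move=> /asboolP pi; rewrite (bigID (fun r : {poly_(deg m) F} => coprimep (val r) m)) /=.
  rewrite [X in _ + X]big1 ?addr0 => [|r]; last exact: chi0.
  rewrite (eq_bigr (fun=> 1)) => [|r]; last exact: pi.
  rewrite sumr_const; congr _%:R; apply: eq_card => r.
  by rewrite mem_residue_units.
(* The family contains exactly one principal character: the orthogonality relation for [l = 1],
   summed over all residues, gives [phi m] on one side and [phi m] per principal character on the
   other. *)
have one_pr : #|pr|%:R = 1 :> R[i].
  have [k ck kE] := chiO _ c1.
  apply: (mulIf phi0); rewrite mul1r.
  transitivity (\sum_(r : {poly_(deg m) F}) \sum_i chi i k * chi i (val r)).
    rewrite exchange_big (bigID pr) /= [X in _ = _ + X]big1 ?addr0 => [|i /asboolP npi].
      rewrite mulr_natl -sumr_const; apply: eq_bigr => i pi.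
      by rewrite -mulr_sumr (sum_pr i pi) (asboolW pi) ?mul1r.
    by rewrite -mulr_sumr (char_sum_residues dm (chiC i) npi) mulr0.
  rewrite (bigD1 (NPoly (size_mod 1))) //= kE [X in _ + X]big1 ?addr0 => [|r nr]; last rewrite kE.
    have -> : m %| 1 %% m - 1.
      by apply/modp_eq0P; rewrite modpD modp_id modpN subrr.
    by rewrite mulr1.
  case: (boolP (m %| _)) => [/modp_eq0P|_]; last by rewrite mulr0.
  move/eqP; rewrite modpD modpN subr_eq0 => /eqP r1; case/eqP: nr.
  by apply: val_inj; rewrite /= -r1 modp_small // (size_deg m0) ltnS size_npoly.
have errE : progression_error psi M m l =
    (phi m)%:R^-1 * \sum_(i | ~~ pr i) chi i l' * S i.
  rewrite /progression_error -/S0; apply/eqP; rewrite subr_eq -mulrDr; apply/eqP.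
  apply: (mulfI phi0); rewrite mulVKf //.
  transitivity (\sum_i chi i l' * S i).
    rewrite mulr_sumr big_mkcondr /=.
    under [in RHS]eq_bigr => i _ do rewrite /S mulr_sumr.
    rewrite exchange_big /=; apply: eq_bigr => f _.
    under [in RHS]eq_bigr => i _ do rewrite mulrCA.
    by rewrite -mulr_sumr lE; case: ifP => _; rewrite ?mulr0 // mulr1 mulrC.
  rewrite (bigID pr) /= addrC; congr (_ + _).
  rewrite (eq_bigr (fun=> S0)) => [|i /asboolP pi].
    by rewrite sumr_const -[X in X = _]mulr_natl one_pr mul1r.
  rewrite pi // mul1r /S0 [RHS]big_mkcondr; apply: eq_bigr => f _.
  by case: ifP => cf; [rewrite pi ?mulr1|rewrite chi0 ?cf ?mulr0].
rewrite errE cabsM cabsV cabs_nat ler_pdivrMl ?ltr0n //.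
apply: le_trans (cabs_sum _ _ _) _.
apply: (@le_trans _ _ (\sum_(i < phi m) B)); last first.
  by rewrite sumr_const card_ord -[X in X <= _]mulr_natl.
rewrite big_mkcond; apply: ler_sum => i _; case: ifP => // /asboolP npi.
rewrite cabsM -[X in _ <= X]mul1r; apply: ler_pM; rewrite ?cabs_ge0 //.
  exact: char_le1 dm (chiC i) _.
exact: hB (chiC i) npi.
Qed.

End Progression.

(** Half of the growth is spent at each induction step: [N ^ c] and [N] are both at most multiples
    of [sqrt a ^ N], the latter by Bernoulli's inequality. *)
Lemma pow_le_geometric (R : rcfType) c (a : R) : 1 < a ->
  exists2 K, 0 < K & forall N : nat, N%:R ^+ c <= K * a ^+ N.
Proof.
elim: c a => [|c IH] a a1.
  exists 1; first exact: ltr01.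
  by move=> N; rewrite expr0 mul1r exprn_ege1 // ltW.
have a0 : 0 <= a by rewrite ltW // (lt_trans ltr01).
have b1 : 1 < Num.sqrt a by rewrite -[X in X < _]sqrtr1 ltr_sqrt // (lt_trans ltr01).
have [K K0 hK] := IH _ b1; set b := Num.sqrt a in b1 hK *.
have b0 : 0 <= b by apply: sqrtr_ge0.
have d0 : 0 < b - 1 by rewrite subr_gt0.
exists (K / (b - 1)); first by rewrite divr_gt0.
move=> N; have -> : a = b ^+ 2 by rewrite sqr_sqrtr.
have bern : N%:R * (b - 1) <= b ^+ N.
  have : 1 + N%:R * (b - 1) <= b ^+ N.
    elim: N => [|N IHN]; first by rewrite mul0r addr0 expr0.
    rewrite exprS; apply: le_trans (_ : b * (1 + N%:R * (b - 1)) <= _); last by apply: ler_wpM2l.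
    rewrite -natr1; have := ler0n R N; have := sqr_ge0 (b - 1); nra.
  by apply: le_trans; rewrite lerDr.
have hN : N%:R <= b ^+ N / (b - 1) by rewrite ler_pdivlMr.
rewrite exprSr exprAC; apply: le_trans (ler_pM _ _ (hK N) hN) _; rewrite ?exprn_ge0 ?ler0n //.
by rewrite expr2 -!mulrA [(b - 1)^-1 * _]mulrC !mulrA.
Qed.

(** * Final estimates for the Siegel-Walfisz bound and the Bombieri-Vinogradov property *)

Section PrimeConvProperties.
Variables (R : realType) (F : finFieldType).
Local Notation q := (#|F|%:R : R).
Local Notation s := (Num.sqrt q).
Local Notation psi := (dirichlet_conv (ind_primes R F) (ind_primes R F)).

Lemma card_field_gt1 : 1 < q.
Proof. by rewrite ltr1n finNzRing_gt1. Qed.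

Lemma sqrt_card_sqr N : s ^+ N * s ^+ N = q ^+ N.
Proof. by rewrite -expr2 exprAC sqr_sqrtr // ler0n. Qed.

(** The exponent [2 * e + 5] collects 1 from the [M.+1] splittings of the degree and [2 * (e + 2)]
    from the square of [deg m + q M ^ 2], in which [N ^ e] and [N ^ 2] are both bounded by
    [N ^ (e + 2)]. *)
Lemma conv_char_le_pow m chi M N e : (0 < N)%N -> (M <= N)%N ->
  (0 < deg m <= N ^ e)%N -> is_character m chi -> ~ principal m chi ->
  cabs (\sum_(f in monics F M) psi (val f) * chi (val f)) <=
  2%:R * (1 + q) ^+ 2 * N%:R ^+ (2 * e + 5) * s ^+ N.
Proof.
move=> N0 MN /andP[dm dmN] chiC chiN.
apply: le_trans (conv_char_le M dm chiC chiN) _.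
have q0 : 0 <= q by rewrite ler0n.
have N1 : 1 <= N%:R :> R by rewrite ler1n.
apply: ler_pM; rewrite ?exprn_ge0 ?mulr_ge0 ?sqrtr_ge0 ?ler0n ?exprn_ge0 ?addr_ge0 ?mulr_ge0 ?exprn_ge0 ?ler0n //; last first.
  by rewrite ler_weXn2l // sqrtq_ge1.
have h1 : M.+1%:R <= 2%:R * N%:R :> R by rewrite -natrM ler_nat; lia.
have h2 : (deg m)%:R + q * M%:R ^+ 2 <= (1 + q) * N%:R ^+ (e + 2).
  rewrite mulrDl mul1r; apply: lerD.
    apply: (@le_trans _ _ ((N ^ e)%:R)); first by rewrite ler_nat.
    by rewrite natrX ler_weXn2l // leq_addr.
  apply: ler_wpM2l => //; apply: (@le_trans _ _ (N%:R ^+ 2)).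
    by apply: lerXn2r; rewrite ?nnegrE ?ler0n // ler_nat.
  by rewrite ler_weXn2l // leq_addl.
have h3 : ((deg m)%:R + q * M%:R ^+ 2) ^+ 2 <= ((1 + q) * N%:R ^+ (e + 2)) ^+ 2.
  by apply: lerXn2r; rewrite ?nnegrE ?addr_ge0 ?mulr_ge0 ?exprn_ge0 ?addr_ge0 ?ler0n.
apply: le_trans (ler_pM _ _ h1 h3) _; rewrite ?exprn_ge0 ?addr_ge0 ?mulr_ge0 ?exprn_ge0 ?ler0n //.
have -> : (2 * e + 5 = ((e + 2) * 2).+1)%N by lia.
by rewrite exprMn -exprM (exprS N%:R (_ * 2)) mulrACA !mulrA.
Qed.

Lemma max_error_le N k (m : {poly_k.+1 F}) : (0 < N)%N -> (k <= N)%N -> m \in monics F k ->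
  max_progression_error psi N (val m) <= 2%:R * (1 + q) ^+ 2 * N%:R ^+ 7 * s ^+ N.
Proof.
move=> N0 kN /monicsP[mm dmk].
have q0 : 0 <= q by rewrite ler0n.
have N1 : 1 <= N%:R :> R by rewrite ler1n.
have s1 : 1 <= s := sqrtq_ge1 R F.
set Bd := (X in _ <= X); have Bd0 : 0 <= Bd.
  by rewrite /Bd !mulr_ge0 ?exprn_ge0 ?addr_ge0 ?sqrtr_ge0 ?ler0n.
apply/bigmax_leP; split=> // M _; apply/bigmax_leP; split=> // l; rewrite coprimep_sym => cl.
have MN : (M <= N)%N by rewrite -ltnS.
(* For [m = 1] there is one residue class and the error vanishes. Otherwise [deg m <= N] allows
   [e = 1], whence the exponent 7. *)
case: (posnP (deg (val m))) => [d0|dm].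
  have m1 : val m = 1.
    have := size_deg (monic_neq0 mm); rewrite d0 => /eqP/size_poly1P[c c0 mE].
    by move: mm; rewrite mE monicE lead_coefC => /eqP ->.
  rewrite /progression_error; suff -> : phi (val m) = 1%N.
    rewrite invr1 mul1r (eq_bigl (fun f => (f \in monics F M) && coprimep (val f) (val m))) ?subrr ?cabs0 // => f.
    have -> : val m %| val f - val l by apply: etrans (dvd1p (val f - val l)); congr (_ %| _).
    by have -> : coprimep (val f) (val m) by apply: etrans (coprimep1 (val f)); congr coprimep.
  rewrite /phi; apply: (@eq_card1 _ l) => r; rewrite mem_residue_units ?monic_neq0 //.
  have -> : coprimep (val r) (val m) by apply: etrans (coprimep1 (val r)); congr coprimep.
  rewrite inE; apply/esym/eqP/val_inj.
  by apply/polyP => i; rewrite !nth_default // (leq_trans (size_npoly _)) // d0.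
apply: progression_le => // chi chiC chiN.
apply: (@conv_char_le_pow (val m) _ _ _ 1%N) => //.
by rewrite dm expn1 dmk.
Qed.

Lemma psi_siegel_walfisz : siegel_walfisz psi.
Proof.
exists 1; first exact: ltr01.
move=> D D1 E; have D0 : 0 <= D := le_trans ler01 D1.
(* An integer above [3 D]. The power of exponent [c' + (2 * E + 5)] of [N] is absorbed by one of the
   two factors [s ^ N] of [q ^ N]. *)
pose c' := (Num.truncn (3%:R * D)).+1.
have s1 : 1 < s by rewrite -[X in X < _]sqrtr1 ltr_sqrt ?card_field_gt1 // (lt_trans ltr01 card_field_gt1).
have [K K0 hK] := pow_le_geometric (c' + (2 * E + 5)) s1.
have Q0 : 0 < 2%:R * (1 + q) ^+ 2 by rewrite mulr_gt0 ?exprn_gt0 ?ltr0n // ltr_pwDl ?ltr01 ?ler0n.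
exists (2%:R * (1 + q) ^+ 2 * K); first by rewrite mulr_gt0.
move=> N m chi d N0 dmN chiC chiN _ _.
have N1 : 1 <= N%:R :> R by rewrite ler1n.
have P0 : 0 < N%:R `^ (3%:R * D) by apply: powR_gt0; rewrite ltr0n.
have PN : N%:R `^ (3%:R * D) <= N%:R ^+ c'.
  rewrite -powR_mulrn ?ler0n //; apply: ler_powR => //.
  by apply: ltW; rewrite truncnS_gt.
apply: le_trans (conv_char_le_pow N0 (leqnn N) dmN chiC chiN) _.
rewrite [X in _ <= X]mulrA ler_pdivlMr //.
apply: le_trans (_ : 2%:R * (1 + q) ^+ 2 * N%:R ^+ (2 * E + 5) * s ^+ N * N%:R ^+ c' <= _).
  by apply: ler_wpM2l PN; rewrite !mulr_ge0 ?exprn_ge0 ?addr_ge0 ?sqrtr_ge0 ?ler0n.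
move: (2%:R * (1 + q) ^+ 2) Q0 => Q Q0; rewrite -!mulrA; apply: ler_wpM2l; first by rewrite ltW.
have -> : N%:R ^+ (2 * E + 5) * (s ^+ N * N%:R ^+ c') = s ^+ N * N%:R ^+ (c' + (2 * E + 5)).
  by rewrite [in RHS]addnC [in RHS]exprD mulrCA.
by rewrite -sqrt_card_sqr [X in _ <= X]mulrCA; apply: ler_wpM2l; rewrite ?exprn_ge0 ?sqrtr_ge0.
Qed.

Lemma expn_le_level (B : R) N k : (0 < N)%N -> k%:R <= N%:R / 2%:R - B * logq F N%:R ->
  q ^+ k <= s ^+ N / N%:R `^ B.
Proof.
move=> N0 hk; have q1 := card_field_gt1; have q0 := lt_trans ltr01 q1.
have N0' : 0 < N%:R :> R by rewrite ltr0n.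
rewrite -powR_mulrn ?(ltW q0) //.
apply: le_trans (ler_powR (ltW q1) hk) _.
rewrite powRB; last by rewrite (gt_eqF q0) implybT.
have -> : q `^ (N%:R / 2%:R) = s ^+ N.
  by rewrite mulrC powRrM powR12_sqrt ?(ltW q0) // powR_mulrn ?sqrtr_ge0.
have -> // : q `^ (B * logq F N%:R) = N%:R `^ B.
have lq : ln q != 0 by rewrite gt_eqF // ln_gt0.
by rewrite /powR (gt_eqF q0) (gt_eqF N0') /logq mulrA divfK.
Qed.

Lemma psi_bombieri_vinogradov : bombieri_vinogradov psi.
Proof.
(* Here [8 = 7 + 1]: each error carries [N ^ 7], and the moduli have at most [N + 1 <= 2 N]
   different degrees. There are at most [q ^ k.+1] moduli of degree [k], which explains the factor
   [2 q] in [K]. *)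
move=> A A0; exists (A + 8%:R); first by rewrite addr_gt0 ?ltr0n.
have q1 := card_field_gt1; have q0 := lt_trans ltr01 q1.
have Q0 : 0 < 2%:R * (1 + q) ^+ 2 by rewrite mulr_gt0 ?exprn_gt0 ?ltr0n // ltr_pwDl ?ltr01 ?ltW.
exists (2%:R * q * (2%:R * (1 + q) ^+ 2)); first by rewrite mulr_gt0 // mulr_gt0 // ltr0n.
move=> N N0; have mx k m := @max_error_le N k m N0.
move: (2%:R * (1 + q) ^+ 2) Q0 mx => Q Q0 mx.
have N1 : 1 <= N%:R :> R by rewrite ler1n.
have N0' : 0 < N%:R :> R by rewrite ltr0n.
have s0 : 0 <= s := sqrtr_ge0 _.
set B := A + 8%:R; set PB := N%:R `^ B.
have PB0 : 0 < PB by apply: powR_gt0.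
apply: (@le_trans _ _ (\sum_(k < N.+1) (q * (s ^+ N / PB)) * (Q * N%:R ^+ 7 * s ^+ N))).
  rewrite big_mkcond; apply: ler_sum => k _; case: ifP => [hk|_]; last first.
    by rewrite !mulr_ge0 ?invr_ge0 ?exprn_ge0 // ltW.
  have kN : (k <= N)%N by rewrite -ltnS.
  apply: (@le_trans _ _ (\sum_(m in monics F k) (Q * N%:R ^+ 7 * s ^+ N))).
    by apply: ler_sum => m mk; apply: mx kN mk.
  rewrite sumr_const -[X in X <= _]mulr_natl; apply: ler_wpM2r.
    by rewrite !mulr_ge0 ?exprn_ge0 // ltW.
  apply: (@le_trans _ _ ((#|F| ^ k.+1)%:R)); first by rewrite ler_nat card_monics_le.
  by rewrite natrX exprS; apply: ler_wpM2l; [rewrite ltW|apply: expn_le_level].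
rewrite sumr_const card_ord -[X in X <= _]mulr_natl.
have -> : PB = N%:R `^ A * N%:R ^+ 8.
  by rewrite /PB /B powRD ?(gt_eqF N0') ?implybT // powR_mulrn // ltW.
have PA0 : 0 < N%:R `^ A by apply: powR_gt0.
have N8 : N%:R ^+ 8 != 0 :> R by rewrite expf_neq0 // gt_eqF.
rewrite -sqrt_card_sqr.
apply: (@le_trans _ _ (2%:R * N%:R * (q * (s ^+ N / (N%:R `^ A * N%:R ^+ 8)) * (Q * N%:R ^+ 7 * s ^+ N)))).
  apply: ler_wpM2r; last by rewrite -natrM ler_nat; lia.
  by rewrite !mulr_ge0 ?invr_ge0 ?mulr_ge0 ?exprn_ge0 // ltW.
rewrite le_eqVlt; apply/orP; left; apply/eqP.
have PAn := gt_eqF PA0; have Nn := gt_eqF N0'.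
clear Q0 mx; move: (s ^+ N) (N%:R `^ A) (N%:R : R) (#|F|%:R : R) Q PAn Nn => S P n u Q' PAn Nn.
by field; rewrite PAn Nn.
Qed.

End PrimeConvProperties.

Theorem corollary1p3 (R : realType) (F : finFieldType) :
  let psi := dirichlet_conv (ind_primes R F) (ind_primes R F) in
  [/\ growth_condition psi, siegel_walfisz psi & bombieri_vinogradov psi].
Proof.
split; first exact: psi_growth.
  exact: psi_siegel_walfisz.
exact: psi_bombieri_vinogradov.
Qed.
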